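(* Let $N\ge2$ and let $\Omega\subset\mathbb{R}^N$ be a bounded and smooth domain. Then $$\lim_{p\to N^-}\frac{\Lambda_p(\Omega)}{|p-N|^{p-1}}=\frac{N\omega_N}{(N-1)^{N-1}}=\lim_{p\to N^+}\frac{\Lambda_p(\Omega)}{|p-N|^{p-1}}.$$ In particular, the function $p\in(1,\infty)\mapsto\Lambda_p(\Omega)$ is continuous at $p=N$.
   Context: $\omega_N=\pi^{N/2}/\Gamma(\frac N2+1)$ is the volume of the unit ball of $\mathbb{R}^N$, and $\|\cdot\|_s$ denotes the norm of $L^s(\Omega)$. For $p>1$ let $p^\star:=\frac{Np}{N-p}$ if $1<p<N$ and $p^\star:=\infty$ if $p\ge N$. For $1\le q<p^\star$, $$\lambda_q(\Omega):=\inf\{\|\nabla u\|_p^p: u\in W_0^{1,p}(\Omega),\ \|u\|_q=1\}$$ (depending also on $p$), and $\Lambda_p(\Omega):=\lim_{q\to p^\star}\lambda_q(\Omega)$ (limit from below; it exists). It is known that for $1<p<N$ $$\Lambda_p(\Omega)=S_p:=\pi^{\frac p2}N\left(\frac{N-p}{p-1}\right)^{p-1}\left(\frac{\Gamma(N/p)\Gamma(1+N-N/p)}{\Gamma(1+N/2)\Gamma(N)}\right)^{\frac pN},$$ the best constant in the Sobolev inequality $S\|u\|_{L^{p^\star}(\mathbb{R}^N)}^p\le\|\nabla u\|_{L^p(\mathbb{R}^N)}^p$, and that $\Lambda_N(\Omega)=0$. *)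

(* Defs.v *)
From HB Require Import structures.
From mathcomp Require Import all_boot all_order all_algebra.
From mathcomp Require Import all_classical all_reals all_analysis.
Set Implicit Arguments.
Unset Strict Implicit.
Unset Printing Implicit Defensive.
Import Order.TTheory GRing.Theory Num.Theory.
Import numFieldNormedType.Exports.
Local Open Scope classical_set_scope.
Local Open Scope ring_scope.

(* 'rV[R]_n carries the sigma-algebra generated by the coordinates, which is
   the Borel sigma-algebra of R^n. *)
Definition rV_display : measure_display.
Proof. exact: default_measure_display. Qed.

Section measurable_rV.
Context {R : realType} {n : nat}.

Definition rV_coord (i : 'I_n) (v : 'rV[R]_n) : measurableTypeR R := v 0 i.

Let rV_set0 : g_sigma_preimage rV_coord set0.
Proof. exact: sigma_algebra0. Qed.

Let rV_setC A : g_sigma_preimage rV_coord A -> g_sigma_preimage rV_coord (~` A).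
Proof. exact: sigma_algebraC. Qed.

Let rV_bigcup (F : (set 'rV[R]_n)^nat) :
  (forall i, g_sigma_preimage rV_coord (F i)) ->
  g_sigma_preimage rV_coord (\bigcup_i (F i)).
Proof. exact: sigma_algebra_bigcup. Qed.

HB.instance Definition _ := @isMeasurable.Build rV_display
  'rV[R]_n (g_sigma_preimage rV_coord) rV_set0 rV_setC rV_bigcup.

Lemma measurable_rV_coord (i : 'I_n) : measurable_fun setT (rV_coord i).
Proof.
move=> _ Y mY; rewrite setTI; apply: sub_sigma_algebra => /=.
rewrite -bigcup_seq/=; exists i => /=; first by rewrite mem_index_enum.
by exists Y => //; rewrite setTI.
Qed.

Lemma measurable_fun_rVP d (T : measurableType d) (f : T -> 'rV[R]_n) :
  (forall i, measurable_fun setT (rV_coord i \o f)) -> measurable_fun setT f.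
Proof.
move=> mf.
apply: (@measurability _ _ _ _ _ _
  (\big[setU/set0]_(i < n) preimage_set_system setT (rV_coord i) measurable)) => //.
move=> _ [B + <-]; rewrite -bigcup_seq => -[i _ [C mC <-]].
by have := mf i measurableT C mC; rewrite !setTI.
Qed.

End measurable_rV.

Section lebesgue_rV.
Context {R : realType}.

Definition rV_cons n (p : measurableTypeR R * 'rV[R]_n) : 'rV[R]_n.+1 :=
  \row_(i < n.+1) if unlift ord0 i is Some j then p.2 0 j else p.1.

Definition rV_uncons n (v : 'rV[R]_n.+1) : measurableTypeR R * 'rV[R]_n :=
  (v 0 ord0, \row_j v 0 (lift ord0 j)).

Lemma rV_consK n : cancel (@rV_cons n) (@rV_uncons n).
Proof.
case=> x v; rewrite /rV_uncons /rV_cons mxE unlift_none/=; congr (_, _).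
by apply/rowP => j; rewrite !mxE liftK.
Qed.

Lemma measurable_rV_cons n : measurable_fun setT (@rV_cons n).
Proof.
apply: measurable_fun_rVP => i; rewrite /comp /rV_coord /rV_cons.
case: (unliftP ord0 i) => [j|] ij; subst i.
- under eq_fun do rewrite mxE liftK.
  apply: (measurableT_comp (measurable_rV_coord j)); exact: measurable_snd.
- under eq_fun do rewrite mxE unlift_none.
  exact: measurable_fst.
Qed.

Lemma measurable_rV_uncons n : measurable_fun setT (@rV_uncons n).
Proof.
apply: measurable_fun_pair; first exact: (measurable_rV_coord ord0).
apply: measurable_fun_rVP => i; rewrite /comp /rV_coord /=.
under eq_fun do rewrite mxE.
exact: (measurable_rV_coord (lift ord0 i)).
Qed.

Section succ.
Variables (n : nat) (m : {sigma_finite_measure set 'rV[R]_n -> \bar R}).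

Definition lebesgue_rV_succ : set 'rV[R]_n.+1 -> \bar R :=
  pushforward (@lebesgue_measure R \x m)%E (@rV_cons n).

Let succ0 : lebesgue_rV_succ set0 = 0%E.
Proof. by rewrite /lebesgue_rV_succ /pushforward preimage_set0 measure0. Qed.

Let succ_ge0 A : (0 <= lebesgue_rV_succ A)%E.
Proof. by rewrite /lebesgue_rV_succ /pushforward measure_ge0. Qed.

Let succ_sigma_additive : semi_sigma_additive lebesgue_rV_succ.
Proof.
move=> F mF tF mUF; rewrite /lebesgue_rV_succ /pushforward preimage_bigcup.
apply: measure_semi_sigma_additive.
- by move=> k; rewrite -[X in measurable X]setTI; exact: measurable_rV_cons.
- apply/trivIsetP => /= i j _ _ ij; rewrite -preimage_setI.
  by move/trivIsetP : tF => /(_ _ _ _ _ ij) ->//; rewrite preimage_set0.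
- by rewrite -preimage_bigcup -[X in measurable X]setTI;
    exact: measurable_rV_cons.
Qed.

HB.instance Definition _ := isMeasure.Build _ _ _
  lebesgue_rV_succ succ0 succ_ge0 succ_sigma_additive.

Let succ_sigma_finite : sigma_finite setT lebesgue_rV_succ.
Proof.
have /sigma_finiteP[F [TF ndF Foo]] := sigma_finiteT (@lebesgue_measure R).
have /sigma_finiteP[G [TG ndG Goo]] := sigma_finiteT m.
exists (fun k => @rV_uncons n @^-1` (F k `*` G k)).
  rewrite -preimage_bigcup; apply/esym/seteqP; split => // v _ /=.
  have [k _ Fk] : (\bigcup_k F k) (v 0 ord0) by rewrite -TF.
  have [l _ Gl] : (\bigcup_k G k) (\row_j v 0 (lift ord0 j)) by rewrite -TG.
  exists (maxn k l) => //; split => /=.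
    by move: Fk; exact/subsetPset/ndF/leq_maxl.
  by move: Gl; exact/subsetPset/ndG/leq_maxr.
move=> k; have [mFk Fk] := Foo k; have [mGk Gk] := Goo k; split.
  rewrite -[X in measurable X]setTI; apply: measurable_rV_uncons => //.
  exact: measurableX.
rewrite /lebesgue_rV_succ /pushforward -comp_preimage.
rewrite (_ : _ \o _ = id) ?preimage_id; last first.
  by apply/funext => p /=; rewrite rV_consK.
by rewrite product_measure1E// lte_mul_pinfty// ge0_fin_numE.
Qed.

HB.instance Definition _ := Measure_isSigmaFinite.Build _ _ _
  lebesgue_rV_succ succ_sigma_finite.

End succ.

(* N-dimensional Lebesgue measure, obtained by iterating the product with the
   one-dimensional one; R^0 is a point of mass 1. *)
Fixpoint lebesgue_rV (n : nat) : {sigma_finite_measure set 'rV[R]_n -> \bar R} :=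
  match n with
  | 0 => (\d_(0 : 'rV[R]_0))
  | n'.+1 => lebesgue_rV_succ (lebesgue_rV n')
  end.

Lemma lebesgue_rV_box n (A : 'I_n -> set (measurableTypeR R)) :
  (forall i, measurable (A i)) ->
  lebesgue_rV n [set v | forall i, A i (v 0 i)] =
  (\prod_(i < n) lebesgue_measure (A i))%E.
Proof.
elim: n A => [|n IH] A mA.
  by rewrite big_ord0 /= diracE mem_set// => -[].
rewrite big_ord_recl -IH// -product_measure1E//; last first.
  rewrite [X in measurable X](_ : _ =
    \bigcap_(i in [set: 'I_n]) rV_coord i @^-1` A (lift ord0 i)).
    apply: fin_bigcap_measurable => // i _; rewrite -[X in measurable X]setTI.
    exact: measurable_rV_coord.
  by apply/seteqP; split => [v Av i _|v Av i]; [exact: Av|exact: (Av i I)].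
rewrite /= /lebesgue_rV_succ /pushforward; congr (_ _).
apply/seteqP; split => [[x v] /= Axv|[x v] /= [Ax Av] i].
  split; first by have := Axv ord0; rewrite mxE unlift_none.
  by move=> i; have := Axv (lift ord0 i); rewrite mxE liftK.
rewrite mxE; case: (unliftP ord0 i) => [j|] -> //; exact: Av.
Qed.

End lebesgue_rV.

Section smooth.
Context {R : realType} {n : nat}.
Implicit Types (f : 'rV[R]_n -> R).

Definition partial (i : 'I_n) f : 'rV[R]_n -> R :=
  fun x => 'D_(delta_mx 0 i) f x.

Fixpoint Ck (k : nat) f : Prop :=
  continuous f /\
  match k with
  | 0 => True
  | k'.+1 => forall i : 'I_n,
      (forall x, derivable f x (delta_mx 0 i)) /\ Ck k' (partial i f)
  end.

Definition Cinfty f : Prop := forall k, Ck k f.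

Definition grad f : 'rV[R]_n -> 'rV[R]_n := fun x => \row_i partial i f x.

Definition euclid (v : 'rV[R]_n) : R := Num.sqrt (\sum_i v 0 i ^+ 2).

End smooth.

Section domains.
Context {R : realType} {N : nat}.
Implicit Types (Omega : set 'rV[R]_N).

(* After relabelling and reorienting the coordinate axes, Omega is near each of
   its boundary points the epigraph of a C^oo function of the N - 1 other
   coordinates; col' i x is x without its i-th coordinate. *)
Definition smooth_boundary Omega : Prop :=
  forall x0, (closure Omega `\` Omega°) x0 ->
  exists (i : 'I_N) (b : bool) (gamma : 'rV[R]_N.-1 -> R),
    Cinfty gamma /\
    \forall x \near x0, Omega x <-> gamma (col' i x) < (-1) ^+ b * x 0 i.

Definition bounded_smooth_domain Omega : Prop :=
  [/\ open Omega, connected Omega, Omega !=set0, bounded_set Omega &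
      smooth_boundary Omega].

(* C_c^oo(Omega), the functions being extended by 0 *)
Definition test_function Omega (phi : 'rV[R]_N -> R) : Prop :=
  let supp := closure [set x | phi x != 0] in
  [/\ Cinfty phi, compact supp & supp `<=` Omega].

End domains.

Section sobolev.
Context {R : realType} {N : nat}.
Variable Omega : set 'rV[R]_N.

Definition normL (s : R) (f : 'rV[R]_N -> R) : \bar R :=
  'N[lebesgue_rV N]_(s%:E)[EFin \o (f \_ Omega)]%E.

Definition weak_gradient (u : 'rV[R]_N -> R) (Du : 'rV[R]_N -> 'rV[R]_N) : Prop :=
  forall phi, test_function Omega phi -> forall i : 'I_N,
    \int[lebesgue_rV N]_(x in Omega) (u x * partial i phi x) =
    - \int[lebesgue_rV N]_(x in Omega) (Du x 0 i * phi x).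

(* u \in W^{1,p}(Omega), Du being a representative of its weak gradient *)
Definition W1 (p : R) (u : 'rV[R]_N -> R) (Du : 'rV[R]_N -> 'rV[R]_N) : Prop :=
  [/\ measurable_fun Omega u,
      forall i : 'I_N, measurable_fun Omega (fun x => Du x 0 i),
      (normL p u < +oo)%E,
      (normL p (euclid \o Du) < +oo)%E &
      weak_gradient u Du].

(* u lies in the closure of C_c^oo(Omega) for the norm of W^{1,p}(Omega) *)
Definition W01 (p : R) (u : 'rV[R]_N -> R) (Du : 'rV[R]_N -> 'rV[R]_N) : Prop :=
  W1 p u Du /\
  exists phi : nat -> 'rV[R]_N -> R,
    [/\ forall k, test_function Omega (phi k),
        normL p (fun x => u x - phi k x) @[k --> \oo] --> 0%E &
        normL p (fun x => euclid (Du x - grad (phi k) x)) @[k --> \oo] --> 0%E].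

Definition lambda (p q : R) : R :=
  inf [set t : R | exists u Du,
    [/\ W01 p u Du, normL q u = 1%E &
        t = fine (normL p (euclid \o Du)) `^ p]].

Definition critical_exponent (p : R) : \bar R :=
  if p < N%:R then (N%:R * p / (N%:R - p))%:E else +oo%E.

Definition Lambda (p : R) : R :=
  if critical_exponent p is r%:E%E
  then lim (lambda p q @[q --> r^'-])
  else lim (lambda p q @[q --> +oo]).

End sobolev.

Definition Gamma {R : realType} (x : R) : R :=
  \int[lebesgue_measure]_(t in `]0, +oo[%classic) (t `^ (x - 1) * expR (- t)).

Definition omega (R : realType) (N : nat) : R :=
  pi `^ (N%:R / 2) / Gamma (N%:R / 2 + 1).

(* Main.v *)
From HB Require Import structures.
Require Import Defs.
From mathcomp Require Import all_boot all_order all_algebra.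
From mathcomp Require Import all_classical all_reals all_analysis.
From mathcomp Require Import measurable_realfun ring lra.
Set Implicit Arguments.
Unset Strict Implicit.
Unset Printing Implicit Defensive.
Import Order.TTheory GRing.Theory Num.Theory.
Import numFieldNormedType.Exports.
Local Open Scope classical_set_scope.
Local Open Scope ring_scope.
(* Write N* for the norm of L^(Np/(N-p)) if p < N and of L^oo if p >= N. Since
   test functions are dense, Lambda_p is the infimum of
   |grad phi|_p^p / N*(phi)^p over test functions phi, so it suffices to bound
   that quotient sharply to first order as p -> N; the value of S_p is not needed.

   Upper bounds: with x0 in Omega, phi is a smooth truncation of
   (|x - x0|^2 + rho^2)^(-a/2), a = (N-p)/(p-1), if p < N, and of
   - (|x - x0|^2 + rho^2)^(d/2), d = (p-N)/(p-1), if p > N.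

   Lower bounds: N omega_N |phi(x)| <= int |grad phi(y)| |y - x|^(1-N) dy. If
   p > N, Hoelder's inequality gives Morrey's inequality. If p < N, splitting
   the potential at a distance and at a height gives a weak-type estimate,
   which is integrated over the levels; with the splitting parameter
   eta = N - p the loss is a product of powers x^(c x), x = N - p, and tends to 1.

   Finally Lambda_N = 0 follows from Lambda_p -> 0 as p -> N+ and Hoelder's
   inequality on the bounded set Omega. *)

(** * Integration in R^n *)

(** Both test families truncate the radial p-harmonic power of |x - x0|, of exponent (p-N)/(p-1).
    For p < N a ball of radius r has p-capacity N omega_N a^(p-1) r^(N-p); for p > N the same
    formula with d in place of a is the least energy of a function equal to 1 at the centre and 0
    outside the ball. Since r^(N-p) tends to 1, the size of Omega does not affect the limit, and
    dividing by |p-N|^(p-1) leaves N omega_N / (p-1)^(p-1).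

    The delicate bound is the lower one for p < N, where r = Np/(N-p) blows up. Crude estimates
    suffice there because the integral of |phi|^r is bounded first and then raised to the power p/r
    = (N-p)/N, which tends to 0: any fixed constant, and even a fixed negative power of N-p,
    disappears in the limit. Only the norm of the kernel far from its singularity enters with a
    power comparable to r, so it alone must be sharp; this is why the far part of the potential is
    allowed the share 1 - eta of each level, with eta tending to 0. *)

Section tonelli.
Context d1 d2 (T1 : measurableType d1) (T2 : measurableType d2) (R : realType).
Local Open Scope ereal_scope.
Variables (m1 : {sigma_finite_measure set T1 -> \bar R})
  (m2 : {sigma_finite_measure set T2 -> \bar R}) (f : T1 -> T2 -> \bar R).
Hypothesis mf : measurable_fun setT (fun z : T1 * T2 => f z.1 z.2).
Hypothesis f0 : forall x y, 0 <= f x y.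

Lemma measurable_integral_snd : measurable_fun setT (fun x => \int[m2]_y f x y).
Proof.
exact: (@measurable_fun_fubini_tonelli_F _ _ _ _ _ m2 _ mf (fun z => f0 z.1 z.2)).
Qed.

Lemma tonelli_swap :
  \int[m1]_x \int[m2]_y f x y = \int[m2]_y \int[m1]_x f x y.
Proof. exact: (@fubini_tonelli _ _ _ _ _ m1 m2 _ mf (fun z => f0 z.1 z.2)). Qed.

End tonelli.

Section affine.
Context {R : realType}.
Local Open Scope ereal_scope.

(** By uniqueness of Lebesgue measure: [c] times the image measure under x -> c x + d gives each
    half-open interval its length. *)
Lemma lebesgue_measure_affine (c d : R) (A : set R) : (0 < c)%R ->
  measurable A ->
  c%:E * lebesgue_measure ((fun x => c * x + d)%R @^-1` A) = lebesgue_measure A.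
Proof.
move=> c0 mA.
have mh : measurable_fun setT (fun x : measurableTypeR R => (c * x + d)%R : measurableTypeR R).
  by apply: measurable_funD => //; exact: measurable_funM.
pose h := fun x : measurableTypeR R => (c * x + d)%R : measurableTypeR R.
have cge0 : (0 <= c)%R by exact: ltW.
pose m : {measure set _ -> \bar R} :=
  mscale (NngNum cge0) (pushforward lebesgue_measure h).
rewrite -[LHS]/(m mh A); apply/esym/lebesgue_measure_unique => //= _ [[a b]] _ <-.
rewrite /m /mscale/= /pushforward/=.
rewrite [h @^-1` _](_ : _ = `]((a - d) / c)%R, ((b - d) / c)%R]%classic); last first.
  apply/seteqP; split => x /=; rewrite !in_itv/= ltr_pdivrMr// ler_pdivlMr//;
  rewrite ltrBlDr lerBrDr mulrC//.
rewrite !lebesgue_measure_itv/= !lte_fin ltr_pM2r ?invr_gt0// ltrD2r.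
case: ifPn => ab; last by rewrite mule0.
by rewrite -!EFinD -EFinM; congr EFin; field; rewrite gt_eqF.
Qed.

Lemma ge0_integral_affine (c d : R) (f : measurableTypeR R -> \bar R) : (0 < c)%R ->
  measurable_fun setT f -> (forall x, 0 <= f x) ->
  c%:E * \int[lebesgue_measure]_x f (c * x + d)%R = \int[lebesgue_measure]_x f x.
Proof.
move=> c0 mf f0.
have mh : measurable_fun setT (fun x : measurableTypeR R => (c * x + d)%R : measurableTypeR R).
  by apply: measurable_funD => //; exact: measurable_funM.
pose h := fun x : measurableTypeR R => (c * x + d)%R : measurableTypeR R.
have cge0 : (0 <= c)%R by exact: ltW.
pose m : {measure set _ -> \bar R} :=
  mscale (NngNum cge0) (pushforward lebesgue_measure h).
rewrite -[RHS](@eq_measure_integral _ _ _ _ _ (m mh))/=.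
  rewrite ge0_integral_mscale//= ge0_integral_pushforward//.
by move=> A mA _; rewrite /m /mscale/= -(lebesgue_measure_affine d c0 mA).
Qed.

End affine.

Section affine_rV.
Context {R : realType}.
Local Open Scope ereal_scope.

Lemma ge0_integral_rV_succ n (f : 'rV[R]_n.+1 -> \bar R) :
  measurable_fun setT f -> (forall x, 0 <= f x) ->
  \int[lebesgue_rV n.+1]_x f x =
  \int[lebesgue_measure]_x \int[lebesgue_rV n]_v f (rV_cons (x, v)).
Proof.
move=> mf f0.
pose m : {measure set _ -> \bar R} :=
  pushforward (@lebesgue_measure R \x lebesgue_rV n) (@rV_cons R n).
rewrite (@eq_measure_integral _ _ _ _ (m (@measurable_rV_cons R n)))//.
rewrite ge0_integral_pushforward//=; last exact: measurable_rV_cons.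
rewrite preimage_setT fubini_tonelli1//.
by apply: measurableT_comp => //; exact: measurable_rV_cons.
Qed.

Lemma measurable_rV_affine n (c : R) (w : 'rV[R]_n) :
  measurable_fun setT (fun v : 'rV[R]_n => c *: v + w : 'rV[R]_n)%R.
Proof.
apply: measurable_fun_rVP => i; rewrite /comp /rV_coord.
under eq_fun do rewrite !mxE.
by apply: measurable_funD => //; apply: measurable_funM => //; exact: measurable_rV_coord.
Qed.

(** Dilation and translation are treated together so that one induction on the dimension serves
    both: splitting off the first coordinate costs one factor [c], and the remaining coordinates
    undergo a map of the same kind. *)
Lemma ge0_integral_rV_affine n (c : R) (w : 'rV[R]_n) (f : 'rV[R]_n -> \bar R) :
  (0 < c)%R -> measurable_fun setT f -> (forall x, 0 <= f x) ->
  (c ^+ n)%:E * \int[lebesgue_rV n]_x f (c *: x + w)%R = \int[lebesgue_rV n]_x f x.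
Proof.
move=> c0; elim: n w f => [|n IH] w f mf f0.
  by rewrite expr0 mul1e; apply: eq_integral => x _; rewrite !thinmx0.
have mfa := measurableT_comp mf (measurable_rV_affine c w).
have mfc := measurableT_comp mf (@measurable_rV_cons R n).
have mG : measurable_fun setT
   (fun x : measurableTypeR R => \int[lebesgue_rV n]_v f (rV_cons (x, v))).
  exact: (@measurable_integral_snd _ _ _ _ _ (lebesgue_rV n)
    (fun x v => f (rV_cons (x, v)))).
rewrite (ge0_integral_rV_succ mf)// ge0_integral_rV_succ// exprS EFinM -muleA.
rewrite -(ge0_integral_affine (w 0%R ord0) c0 mG); last by move=> x; exact: integral_ge0.
congr (_ * _); rewrite -ge0_integralZl//; last 3 first.
- exact: (@measurable_integral_snd _ _ _ _ _ (lebesgue_rV n)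
    (fun x v => f (c *: rV_cons (x, v) + w)%R)
    (measurableT_comp mfa (@measurable_rV_cons R n))).
- by move=> x _; exact: integral_ge0.
- by rewrite lee_fin exprn_ge0// ltW.
apply: eq_integral => x _.
rewrite -[RHS](IH (\row_j w 0 (lift ord0 j))%R
  (fun v => f (rV_cons (c * x + w 0 ord0, v)))%R)//.
  congr (_ * _); apply: eq_integral => v _; congr f.
  apply/rowP => j; rewrite !mxE; case: (unliftP ord0 j) => [k|] -> //=.
  by rewrite !mxE.
by apply: (measurableT_comp mfc); exact: measurable_fun_pair.
Qed.

Lemma ge0_integral_rV_shift n (w : 'rV[R]_n) (f : 'rV[R]_n -> \bar R) :
  measurable_fun setT f -> (forall x, 0 <= f x) ->
  \int[lebesgue_rV n]_x f (x + w)%R = \int[lebesgue_rV n]_x f x.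
Proof.
move=> mf f0; rewrite -(ge0_integral_rV_affine w ltr01 mf f0) expr1n mul1e.
by apply: eq_integral => x _; rewrite scale1r.
Qed.

Lemma ge0_integral_rV_scale n (c : R) (f : 'rV[R]_n -> \bar R) :
  (0 < c)%R -> measurable_fun setT f -> (forall x, 0 <= f x) ->
  (c ^+ n)%:E * \int[lebesgue_rV n]_x f (c *: x)%R = \int[lebesgue_rV n]_x f x.
Proof.
move=> c0 mf f0; rewrite -(ge0_integral_rV_affine 0 c0 mf f0).
by congr (_ * _); apply: eq_integral => x _; rewrite addr0.
Qed.

End affine_rV.

(** * Measurability of open sets and of continuous functions *)

Section borel_rV.
Context {R : realType} {n : nat}.

Lemma rV_ballE (x : 'rV[R]_n) e v :
  ball x e v <-> 0 < e /\ forall i, `|x 0 i - v 0 i| < e.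
Proof.
split=> [[e0 h]|[e0 h]]; split=> //; first by move=> i; exact: h.
by move=> i j; rewrite (ord1 i); exact: h.
Qed.

(** Balls of the sup norm are products of intervals, hence measurable. Those with rational centre
    and radius are countably many, and an open set is the union of those that it contains: around
    [x], take a radius [r] below e/2 and a centre within [r] of [x]. *)
Lemma open_measurable_rV (U : set 'rV[R]_n) : open U -> measurable U.
Proof.
move=> oU.
pose B (q : 'rV[rat]_n * rat) :=
  [set v : 'rV[R]_n | forall i, `|ratr (q.1 0 i) - v 0 i| < ratr q.2].
have mB q : measurable (B q).
  rewrite [B q](_ : _ = \bigcap_(i in [set: 'I_n])
    (rV_coord i @^-1` [set y | `|ratr (q.1 0 i) - y| < ratr q.2])).
    apply: fin_bigcap_measurable => // i _; rewrite -[X in measurable X]setTI.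
    apply: measurable_rV_coord => //.
    by rewrite [X in measurable X](_ : _ = ball (ratr (q.1 0 i) : R) (ratr q.2));
      [exact: measurable_ball|].
  by apply/seteqP; split => [v h i _|v h i]; [exact: h|exact: (h i I)].
rewrite (_ : U = \bigcup_q (if pselect (B q `<=` U) then B q else set0)).
  apply: countable_bigcupT_measurable => [|q]; first exact: countableP.
  by case: pselect => ?; [exact: mB|exact: measurable0].
apply/seteqP; split => [x Ux|x [q _]]; last by case: pselect => // BU /BU.
have /nbhs_ballP[e /= e0 xeU] := open_nbhs_nbhs (conj oU Ux).
have [r] := @rat_in_itvoo _ 0 (e / 2) (divr_gt0 e0 (ltr0Sn _ _)).
rewrite in_itv/= => /andP[r0 re].
have /choice[q hq] (i : 'I_n) : exists s : rat, ratr s \in `](x 0 i - ratr r), (x 0 i + ratr r)[.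
  by apply: rat_in_itvoo; rewrite ltrBlDr -addrA ltrDl addr_gt0.
have qi i : `|ratr (q i) - x 0 i| < ratr r.
  by have := hq i; rewrite in_itv/= ltr_distl.
exists (\row_i q i, r) => //; case: pselect => [_ i|[]]; first by rewrite mxE.
move=> v vB; apply: xeU; apply/rV_ballE; split => // i.
have := vB i; rewrite /= mxE => h.
rewrite (le_lt_trans (ler_distD (ratr (q i)) _ _))// (splitr e) ltrD//.
  by rewrite distrC (lt_trans (qi i)).
exact: lt_trans re.
Qed.

Lemma continuous_measurable_rV (f : 'rV[R]_n -> R) :
  continuous f -> measurable_fun setT f.
Proof.
move=> /continuousP cf; apply: (measurability _ (RGenOpens.measurableE R)).
move=> _ [_ [a [b ->]] <-]; rewrite setTI; apply: open_measurable_rV.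
by apply: cf; exact: interval_open.
Qed.

Lemma closed_measurable_rV (U : set 'rV[R]_n) : closed U -> measurable U.
Proof. by move=> /closed_openC/open_measurable_rV/measurableC; rewrite setCK. Qed.

End borel_rV.

(** Below, domains of integration are mostly put into the integrand as an [if], so that Tonelli and
    changes of variables, stated on the whole space, apply directly. *)
Lemma integral_if d (T : measurableType d) (R : realType)
    (mu : {measure set T -> \bar R}) (b : T -> bool) (f : T -> \bar R) :
  (\int[mu]_x (if b x then f x else 0) = \int[mu]_(x in [set x | b x]) f x)%E.
Proof.
rewrite [RHS]integral_mkcond; apply: eq_integral => x _; rewrite patchE.
by rewrite /in_mem/= /mem/= /in_set/= asboolb.
Qed.

(** * Integrals of powers near 0 and near infinity *)

Section power_integrals.
Context {R : realType}.
Implicit Types m s : R.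

Lemma cvgr_powRN m : 0 < m -> x `^ (- m) @[x --> +oo] --> (0 : R).
Proof.
move=> m0; apply/cvgr0Pnorm_lt => e e0.
near=> x.
have x0 : 0 < x by near: x; exact: nbhs_pinfty_gt.
rewrite ger0_norm ?powR_ge0// powRN invf_plt ?posrE ?powR_gt0//.
have -> : e^-1 = (e^-1 `^ m^-1) `^ m.
  by rewrite -powRrM mulVf ?gt_eqF// powRr1// invr_ge0 ltW.
rewrite gt0_ltr_powR// ?nnegrE ?powR_ge0 ?ltW//.
Unshelve. all: end_near. Qed.

Lemma integral_powR_tail m s : 0 < m -> 0 < s ->
  (\int[lebesgue_measure]_t (if (s < t)%R then (t `^ (- m - 1))%R%:E else 0)
   = (s `^ (- m) / m)%R%:E)%E.
Proof.
move=> m0 s0.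
rewrite integral_if (_ : [set _ | _] = `]s, +oo[%classic); last first.
  by apply/seteqP; split => x /=; rewrite in_itv/= andbT.
have mf : measurable_fun setT (fun t : R => t `^ (- m - 1)).
  exact: measurable_powR.
rewrite integral_itv_obnd_cbnd; last first.
  by apply: measurable_funTS; exact/measurable_EFinP.
have der (x : R) : 0 < x -> is_derive x 1 (fun x : R => - (x `^ (- m) / m)) (x `^ (- m - 1)).
  move=> x0; rewrite (_ : (fun _ => _) = (- m^-1) \*: (fun y : R => y `^ (- m))); last first.
    by apply/funext => y; rewrite /= scaleNr; congr (- _); exact: mulrC.
  have := is_derive1_powR (- m) x0 => d.
  apply: is_derive_eq; rewrite /= mulNr scaleNr scalerN opprK.
  by rewrite -[LHS]/(_ * _) mulKf ?gt_eqF.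
rewrite (@ge0_continuous_FTC2y _ _ (fun x => - (x `^ (- m) / m)) s 0).
- by rewrite EFinN oppeK add0e.
- by move=> x _; exact: powR_ge0.
- apply: continuous_in_subspaceT => x; rewrite inE/= in_itv/= andbT => sx.
  apply/differentiable_continuous/derivable1_diffP/derivable_powR.
  by rewrite in_itv/= andbT (lt_le_trans s0).
- rewrite -[X in _ --> X]oppr0 -[X in _ --> - X](mul0r m^-1).
  by apply: cvgN; apply: cvgMr_tmp; exact: cvgr_powRN.
- by move=> x sx; apply: ex_derive; exact/der/(lt_trans s0).
- apply: cvg_at_right_filter; have [ds _] := der _ s0.
  by move/derivable1_diffP/differentiable_continuous : ds; exact.
- move=> x; rewrite in_itv/= andbT => sx; rewrite derive1E.
  by have [_ ->] := der _ (lt_trans s0 sx).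
Qed.

Lemma integral_powR_head m s : 0 < m -> 0 < s ->
  (\int[lebesgue_measure]_t (if (0 < t < s)%R then (t `^ (m - 1))%R%:E else 0)
   = (s `^ m / m)%R%:E)%E.
Proof.
move=> m0 s0.
have der (x : R) : 0 < x -> is_derive x 1 (fun x : R => x `^ m / m : R) (x `^ (m - 1)).
  move=> x0; rewrite (_ : (fun _ => _) = m^-1 \*: (fun y : R => y `^ m)); last first.
    by apply/funext => y; rewrite /=; exact: mulrC.
  have := is_derive1_powR m x0 => d.
  by apply: is_derive_eq; rewrite -[LHS]/(_ * _) mulKf ?gt_eqF.
have mf : measurable_fun setT (fun t : R => (t `^ (m - 1))%:E).
  by apply/measurable_EFinP; exact: measurable_powR.
(* For m < 1 the integrand is unbounded at 0. The fundamental theorem of calculus is used on [[e n,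
   s[], and monotone convergence lets [e n] tend to 0; the denominator n + 2 keeps [e n] strictly
   below [s]. *)
pose e n : R := s / n.+2%:R.
have e0 n : 0 < e n by rewrite divr_gt0.
have es n : e n < s by rewrite ltr_pdivrMr// ltr_pMr// ltr1n.
rewrite integral_if.
have -> : [set t : R | 0 < t < s] = \bigcup_n `[e n, s[%classic.
  apply/seteqP; split => [x /= /andP[x0 xs]|x [n _]]/=; last first.
    by rewrite in_itv/= => /andP[/(lt_le_trans (e0 n)) ->].
  exists (Num.trunc (s / x)) => //=; rewrite in_itv/= xs andbT ler_pdivrMr//.
  rewrite mulrC -ler_pdivrMr// ltW// (lt_le_trans (truncnS_gt _))// ler_nat//.
have nd : nondecreasing_seq (fun n => `[e n, s[%classic : set R).
  move=> i j ij; rewrite subsetEset => x /=; rewrite !in_itv/= => /andP[ex ->].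
  rewrite andbT (le_trans _ ex)// ler_pM2l// lef_pV2 ?posrE// ler_nat ltnS//.
have := @ge0_nondecreasing_set_cvg_integral _ _ R _ _ lebesgue_measure nd
  (fun=> measurable_itv _) (fun=> measurable_funTS mf) (fun _ x _ => powR_ge0 x _).
move=> /cvg_lim <-//; apply/cvg_lim => //.
have int_e n : (\int[lebesgue_measure]_(x in `[e n, s[) (x `^ (m - 1))%:E =
    (s `^ m / m - e n `^ m / m)%R%:E)%E.
  rewrite integral_itv_bndo_bndc; last exact: measurable_funTS.
  rewrite (@continuous_FTC2 _ _ (fun x => x `^ m / m)) ?EFinB//.
  - apply: continuous_in_subspaceT => x; rewrite inE/= in_itv/= => /andP[ex _].
    apply/differentiable_continuous/derivable1_diffP/derivable_powR.
    by rewrite in_itv/= andbT (lt_le_trans (e0 n)).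
  - split.
    + move=> x; rewrite in_itv/= => /andP[ex _].
      by have [] := der _ (lt_trans (e0 n) ex).
    + apply: cvg_at_right_filter; have [ds _] := der _ (e0 n).
      by move/derivable1_diffP/differentiable_continuous : ds; exact.
    + apply: cvg_at_left_filter; have [ds _] := der _ s0.
      by move/derivable1_diffP/differentiable_continuous : ds; exact.
  - move=> x; rewrite in_itv/= => /andP[ex _]; rewrite derive1E.
    by have [_ ->] := der _ (lt_trans (e0 n) ex).
under eq_cvg do rewrite int_e.
apply: cvg_EFin; first by near=> n.
rewrite /comp/= -[X in _ --> X]subr0 -[X in _ --> _ - X](mul0r m^-1).
apply: cvgB; first exact: cvg_cst.
apply: cvgMr_tmp.
have e_cvg : e n @[n --> \oo] --> (0 : R).
  rewrite -[X in _ --> X](mulr0 s); apply: cvgMl_tmp.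
  by rewrite (cvg_shiftS (@harmonic R)); exact: cvg_harmonic.
apply: (@cvg_comp _ _ _ e (fun x => x `^ m) _ 0^'+); last exact: powR_cvg0.
move=> A; rewrite /at_right /within/= => /e_cvg.
rewrite !near_simpl /= => h; near=> n; apply: (near h n) => //.
Unshelve. all: end_near. Qed.
End power_integrals.
Lemma cvg_sum (R : realType) (T : Type) (F : set_system T) {FF : Filter F}
    (I : Type) (r : seq I) (f : I -> T -> R) (l : I -> R) :
  (forall i, f i x @[x --> F] --> l i) ->
  \sum_(i <- r) f i x @[x --> F] --> \sum_(i <- r) l i.
Proof.
move=> fl; elim: r => [|i r IH].
  by rewrite big_nil; under eq_fun do rewrite big_nil; exact: cvg_cst.
by rewrite big_cons; under eq_fun do rewrite big_cons; exact: cvgD.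
Qed.

(** * The Euclidean norm *)

Section euclid.
Context {R : realType} {n : nat}.
Implicit Types v w : 'rV[R]_n.

Lemma euclid_ge0 v : 0 <= euclid v.
Proof. exact: sqrtr_ge0. Qed.

Lemma sqr_euclid v : euclid v ^+ 2 = \sum_i v 0 i ^+ 2.
Proof. by rewrite sqr_sqrtr// sumr_ge0// => i _; rewrite sqr_ge0. Qed.

Lemma euclid0 : euclid (0 : 'rV[R]_n) = 0.
Proof. by rewrite /euclid big1 ?sqrtr0// => i _; rewrite mxE expr0n. Qed.

Lemma euclidZ (c : R) v : euclid (c *: v) = `|c| * euclid v.
Proof.
rewrite /euclid -sqrtr_sqr -sqrtrM ?sqr_ge0// mulr_sumr.
by congr Num.sqrt; apply: eq_bigr => i _; rewrite mxE exprMn.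
Qed.

Lemma euclidN v : euclid (- v) = euclid v.
Proof. by rewrite -scaleN1r euclidZ normrN1 mul1r. Qed.

Lemma euclid_coord v i : `|v 0 i| <= euclid v.
Proof.
rewrite -sqrtr_sqr ler_sqrt ?sumr_ge0//; last by move=> j _; rewrite sqr_ge0.
by rewrite (bigD1 i)//= lerDl sumr_ge0// => j _; rewrite sqr_ge0.
Qed.

Lemma euclid_eq0 v : (euclid v == 0) = (v == 0).
Proof.
apply/idP/idP => [/eqP v0|/eqP ->]; last by rewrite euclid0.
apply/eqP/rowP => i; rewrite mxE; apply/eqP; rewrite -normr_le0 -v0.
exact: euclid_coord.
Qed.

Lemma euclid_gt0 v : (0 < euclid v) = (v != 0).
Proof. by rewrite lt_def euclid_ge0 andbT euclid_eq0. Qed.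

Lemma cauchy_schwarz v w : `|\sum_i v 0 i * w 0 i| <= euclid v * euclid w.
Proof.
have [->|w0] := eqVneq w 0.
  by rewrite euclid0 mulr0 big1 ?normr0// => i _; rewrite mxE mulr0.
rewrite -(@ler_pXn2r _ 2)// ?nnegrE ?mulr_ge0 ?euclid_ge0//.
rewrite real_normK ?num_real// exprMn !sqr_euclid.
set C := \sum_i _; set A := \sum_i v 0 i ^+ 2; set B := \sum_i _.
have B0 : 0 < B by rewrite /B -sqr_euclid exprn_gt0// euclid_gt0.
have : 0 <= \sum_i (v 0 i * B - w 0 i * C) ^+ 2 by apply: sumr_ge0 => i _; exact: sqr_ge0.
have -> : \sum_i (v 0 i * B - w 0 i * C) ^+ 2 = B * (A * B - C ^+ 2).
  transitivity (B ^+ 2 * A - 2 * B * C * C + C ^+ 2 * B); last by ring.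
  rewrite (eq_bigr (fun i => B ^+ 2 * v 0 i ^+ 2 - 2 * B * C * (v 0 i * w 0 i) +
    C ^+ 2 * w 0 i ^+ 2)) => [|i _]; last by ring.
  by rewrite big_split/= sumrB -!mulr_sumr.
by rewrite pmulr_rge0// subr_ge0.
Qed.

Lemma ler_euclidD v w : euclid (v + w) <= euclid v + euclid w.
Proof.
rewrite -(@ler_pXn2r _ 2)// ?nnegrE ?addr_ge0 ?euclid_ge0//.
rewrite sqrrD !sqr_euclid.
have -> : \sum_i (v + w) 0 i ^+ 2 =
    \sum_i v 0 i ^+ 2 + (\sum_i v 0 i * w 0 i) *+ 2 + \sum_i w 0 i ^+ 2.
  rewrite -sumrMnl -!big_split/=.
  by apply: eq_bigr => i _; rewrite mxE; ring.
by rewrite lerD2r lerD2l lerMn2r/= (le_trans (ler_norm _)) ?cauchy_schwarz.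
Qed.

Lemma continuous_euclid : continuous (@euclid R n).
Proof.
move=> v; apply: (@continuous_comp _ _ _ (fun v => \sum_i v 0 i ^+ 2) Num.sqrt).
  apply: (@cvg_sum _ _ (nbhs v)) => i.
  apply: (@continuous_comp _ _ _ (fun v : 'rV[R]_n => v 0 i) (fun x => x ^+ 2)).
    exact: coord_continuous.
  exact: exprn_continuous.
exact: sqrt_continuous.
Qed.

Lemma measurable_euclid : measurable_fun setT (@euclid R n).
Proof. exact: continuous_measurable_rV continuous_euclid. Qed.

End euclid.
Lemma powR_posD (R : realType) (x a b : R) :
  0 < x -> x `^ (a + b) = x `^ a * x `^ b.
Proof. by move=> x0; rewrite powRD// (gt_eqF x0) implybT. Qed.

Lemma powR_posB (R : realType) (x a b : R) :
  0 < x -> x `^ (a - b) = x `^ a / x `^ b.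
Proof. by move=> x0; rewrite powR_posD// powRN. Qed.

Ltac mfun := repeat (lazymatch goal with
  | H : measurable_fun _ ?f |- measurable_fun _ ?f => exact: H
  | |- measurable_fun _ (fun x => if _ then _ else _) => apply: measurable_fun_ifT
  | |- measurable_fun _ (fun x => @?a x && @?b x) => apply: measurable_and
  | |- measurable_fun _ (fun x => (@?a x < @?b x)%R) => apply: measurable_fun_ltr
  | |- measurable_fun _ (fun x => (@?a x <= @?b x)%R) => apply: measurable_fun_ler
  | |- measurable_fun _ (Order.lt ?c) => apply: (@measurable_fun_ltr _ _ _ _ (fun=> c) id)
  | |- measurable_fun _ (Order.le ?c) => apply: (@measurable_fun_ler _ _ _ _ (fun=> c) id)
  | |- measurable_fun _ (fun x => (@?a x * @?b x)%E) => apply: emeasurable_funM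
  | |- measurable_fun _ (fun x => (@?a x + @?b x)%E) => apply: emeasurable_funD
  | |- measurable_fun _ (fun x => (@?a x)%:E) => apply/measurable_EFinP
  | |- measurable_fun _ (fun x => (@?a x * @?b x)%R) => apply: measurable_funM
  | |- measurable_fun _ (fun x => (@?a x + @?b x)%R) => apply: measurable_funD
  | |- measurable_fun _ (fun x => euclid (@?a x)) => apply: (measurableT_comp measurable_euclid)
  | |- measurable_fun _ (fun x => powR (@?a x) ?p) => apply: (measurableT_comp (measurable_powR p))
  | |- measurable_fun _ (fun x => `|@?a x|%R) => apply: (measurableT_comp (@normr_measurable _ setT))
  end; rewrite /comp); try solve
  [ assumption | exact: measurable_cst | exact: measurable_id
  | exact: measurable_fst | exact: measurable_snd | exact: measurable_euclid].

(** * Polar coordinates *)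

Section cone.
Context {R : realType} {n : nat}.
Local Open Scope ereal_scope.
Implicit Types (h : 'rV[R]_n -> \bar R).

Lemma measurable_scale_pair :
  measurable_fun setT (fun tz : measurableTypeR R * 'rV[R]_n => tz.1 *: tz.2)%R.
Proof.
apply: measurable_fun_rVP => i; rewrite /comp /rV_coord.
under eq_fun do rewrite mxE.
apply: measurable_funM; first exact: measurable_fst.
by apply: (measurableT_comp (measurable_rV_coord i)); exact: measurable_snd.
Qed.

Lemma measurable_rV_scale (c : R) :
  measurable_fun setT (fun v : 'rV[R]_n => c *: v : 'rV[R]_n)%R.
Proof.
have := measurable_rV_affine c (0 : 'rV[R]_n)%R.
by under eq_fun do rewrite addr0.
Qed.

(** Rays are indexed by the points [z] of the punctured unit ball instead of the unit sphere, which
    avoids surface measure. For fixed t substitute y = t z: the ball becomes 0 < |y| < t and dz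
    becomes t^(-n) dy, so the weight |z| gives t^(-n-1) |y|. Integrating over t > |y| yields
    |y|^(1-n) / n. *)
Lemma integral_cone h : (0 < n)%N -> measurable_fun setT h -> (forall x, 0 <= h x) ->
  \int[lebesgue_rV n]_z (if (0 < euclid z)%R && (euclid z < 1)%R then
     \int[lebesgue_measure]_t (if (0 < t)%R then h (t *: z)%R * (euclid z)%:E else 0) else 0)
  = (n%:R^-1)%:E * \int[lebesgue_rV n]_y
     (if (0 < euclid y)%R then h y * (euclid y `^ (1 - n%:R))%:E else 0).
Proof.
move=> n0 mh h0.
have n0R : (0 < n%:R :> R)%R by rewrite ltr0n.
have mhs := measurableT_comp mh measurable_scale_pair.
pose F (t : measurableTypeR R) (z : 'rV[R]_n) : \bar R :=
  if ((0 < euclid z)%R && (euclid z < 1)%R) && (0 < t)%R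
  then h (t *: z)%R * (euclid z)%:E else 0.
have mF : measurable_fun setT (fun p => F p.1 p.2) by rewrite /F; mfun.
have F0 t z : 0 <= F t z.
  by rewrite /F; case: ifP => // _; rewrite mule_ge0// lee_fin euclid_ge0.
pose G (t : measurableTypeR R) (y : 'rV[R]_n) : \bar R :=
  if (0 < euclid y)%R && (euclid y < t)%R
  then (t `^ (- n%:R - 1))%:E * (h y * (euclid y)%:E) else 0.
have mG : measurable_fun setT (fun p => G p.1 p.2).
  rewrite /G; mfun.
  by apply: (measurableT_comp mh); exact: measurable_snd.
have G0 t y : 0 <= G t y.
  rewrite /G; case: ifP => // _.
  by rewrite mule_ge0 ?lee_fin ?powR_ge0// mule_ge0// lee_fin euclid_ge0.
transitivity (\int[lebesgue_rV n]_z \int[lebesgue_measure]_t F t z).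
  apply: eq_integral => z _; rewrite /F; case: ifPn => // _.
  by rewrite integral0.
rewrite -tonelli_swap//.
transitivity (\int[lebesgue_measure]_t \int[lebesgue_rV n]_y G t y).
  apply: eq_integral => t _; have [t0|t0] := ltP 0%R t; last first.
    rewrite [LHS]integral0_eq ?[RHS]integral0_eq// => y _; rewrite /F/G.
    by case: ifPn => // /andP[y0 yt]; have := lt_le_trans (lt_trans y0 yt) t0; rewrite ltxx.
    by case: ifPn => // /andP[_ t1]; have := lt_le_trans t1 t0; rewrite ltxx.
  have mGt : measurable_fun setT (G t).
    rewrite /G; mfun.
  rewrite -(ge0_integral_rV_scale t0 mGt)// -ge0_integralZl//; last 2 first.
  - apply: (measurableT_comp mGt).
    exact: measurable_rV_scale.
  - by rewrite lee_fin exprn_ge0// ltW.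
  apply: eq_integral => z _; rewrite /F /G t0 andbT euclidZ gtr0_norm//.
  rewrite pmulr_rgt0// -[X in (_ * _ < X)%R]mulr1 ltr_pM2l//.
  case: ifPn => [_|]; last by rewrite mule0.
  rewrite muleA (muleC _ (h _ * _)) -muleA; congr (_ * _).
  rewrite -!EFinM; congr EFin.
  rewrite powR_posB//.
  rewrite powRr1 ?ltW// powRN powR_mulrn ?ltW//; field.
  by rewrite gt_eqF// expf_neq0// gt_eqF.
rewrite tonelli_swap// -ge0_integralZl//; last first.
- by move=> y _; case: ifP => // _; rewrite mule_ge0// lee_fin powR_ge0.
- by mfun.
apply: eq_integral => y _; case: ifPn => y0; last first.
  by rewrite mule0 integral0_eq// => t _; rewrite /G (negbTE y0).
rewrite /G y0/=.
transitivity (\int[lebesgue_measure]_t ((h y * (euclid y)%:E) *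
   (if (euclid y < t)%R then (t `^ (- n%:R - 1))%:E else 0))).
  by apply: eq_integral => t _; case: ifP; rewrite ?mule0// muleC.
rewrite ge0_integralZl//; last first.
- by rewrite mule_ge0// lee_fin euclid_ge0.
- by move=> t _; case: ifP => // _; rewrite lee_fin powR_ge0.
- by mfun.
rewrite integral_powR_tail// muleA (muleC _ (h y)) -!muleA; congr (_ * _).
rewrite -!EFinM; congr EFin.
rewrite powR_posD// powRr1 ?euclid_ge0//; ring.
Qed.

End cone.
Section polar.
Context {R : realType}.
Local Open Scope ereal_scope.

(** The ball is punctured so that it is exactly the set of rays of [integral_cone]. *)
Definition unit_vol n : R :=
  fine (lebesgue_rV n [set z : 'rV[R]_n | (0 < euclid z < 1)%R]).

Variable n : nat.

Lemma measurable_annulus (a b : R) :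
  measurable [set z : 'rV[R]_n | (a < euclid z < b)%R].
Proof.
have mb : measurable_fun setT (fun z : 'rV[R]_n => (a < euclid z < b)%R) by mfun.
by have := mb measurableT [set true] I; rewrite setTI.
Qed.

Lemma unit_vol_fin :
  (unit_vol n)%:E = lebesgue_rV n [set z : 'rV[R]_n | (0 < euclid z < 1)%R].
Proof.
rewrite /unit_vol fineK// ge0_fin_numE//.
have h : lebesgue_rV n [set z : 'rV[R]_n | (0 < euclid z < 1)%R] <=
    lebesgue_rV n [set v : 'rV[R]_n | forall i, `[(-1 : R)%R, (1 : R)%R]%classic (v ord0 i)].
  apply: le_measure; rewrite ?inE//; first exact: measurable_annulus.
    rewrite (_ : [set _ | _] = \bigcap_(i in [set: 'I_n])
        (rV_coord i @^-1` `[(-1 : R)%R, (1 : R)%R]%classic)).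
      apply: fin_bigcap_measurable => // i _; rewrite -[X in measurable X]setTI.
      exact: measurable_rV_coord.
    by apply/seteqP; split => [v h i _|v h i]; [exact: h|exact: (h i I)].
  move=> z /= /andP[_ z1] i; rewrite in_itv/= -ler_norml.
  exact: le_trans (euclid_coord z i) (ltW z1).
apply: (le_lt_trans h).
rewrite (lebesgue_rV_box (A := fun=> `[(-1 : R)%R, (1 : R)%R]%classic))//.
rewrite (eq_bigr (fun=> (1 - (-1) : R)%R%:E)) => [|i _]; first by rewrite prodEFin ltry.
by rewrite lebesgue_measure_itv/= lte_fin (lt_trans (ltrN10 R) ltr01).
Qed.

Lemma unit_vol_ge0 : (0 <= unit_vol n)%R.
Proof. by rewrite -lee_fin unit_vol_fin. Qed.

(** [integral_cone] is applied to g(|y|) |y|^(n-1): the power cancels the kernel |y|^(1-n), and the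
    ray integral, weighted by |z|, does not depend on [z], by the substitution t -> t |z|. *)
Lemma integral_polar (g : measurableTypeR R -> \bar R) : (0 < n)%N ->
  measurable_fun setT g -> (forall x, 0 <= g x) ->
  \int[lebesgue_rV n]_y (if (0 < euclid y)%R then g (euclid y) else 0) =
  (n%:R * unit_vol n)%:E * \int[lebesgue_measure]_t
    (if (0 < t)%R then g t * (t `^ (n%:R - 1))%:E else 0).
Proof.
move=> n0 mg g0.
have n0R : (0 < n%:R :> R)%R by rewrite ltr0n.
pose f (t : measurableTypeR R) : \bar R :=
  if (0 < t)%R then g t * (t `^ (n%:R - 1))%:E else 0.
have f0 t : 0 <= f t.
  by rewrite /f; case: ifP => // _; rewrite mule_ge0// lee_fin powR_ge0.
have mf : measurable_fun setT f by rewrite /f; mfun.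
have mge : measurable_fun setT (fun y : 'rV[R]_n => g (euclid y)).
  exact: (measurableT_comp mg measurable_euclid).
pose h (y : 'rV[R]_n) := g (euclid y) * (euclid y `^ (n%:R - 1))%:E.
have mh : measurable_fun setT h by rewrite /h; mfun.
have h0 y : 0 <= h y by rewrite mule_ge0// lee_fin powR_ge0.
transitivity (n%:R%:E * ((n%:R^-1)%:E * \int[lebesgue_rV n]_y
    (if (0 < euclid y)%R then h y * (euclid y `^ (1 - n%:R))%:E else 0))).
  rewrite muleA -EFinM divff ?gt_eqF// mul1e; apply: eq_integral => y _.
  case: ifPn => // y0; rewrite -muleA -EFinM -powR_posD//.
  by rewrite (_ : n%:R - 1 + (1 - n%:R) = 0)%R ?powRr0 ?mule1//; ring.
rewrite -(integral_cone n0 mh h0) EFinM -muleA; congr (_ * _).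
transitivity (\int[lebesgue_rV n]_z (if (0 < euclid z < 1)%R then
    \int[lebesgue_measure]_t f t else 0)).
  apply: eq_integral => z _; case: ifPn => // /andP[z0 _].
  rewrite -[RHS](ge0_integral_affine 0 z0 mf f0) -ge0_integralZl//; last 2 first.
  - by apply: (measurableT_comp mf); mfun.
  - by rewrite lee_fin ltW.
  apply: eq_integral => t _; rewrite /f addr0 pmulr_rgt0//; case: ifPn => t0.
    by rewrite /h euclidZ gtr0_norm// muleC (mulrC t).
  by rewrite mule0.
rewrite integral_if integral_cst ?unit_vol_fin 1?muleC//; exact: measurable_annulus.
Qed.

Lemma volume_ball (r : R) : (0 < n)%N -> (0 < r)%R ->
  \int[lebesgue_rV n]_y (if (0 < euclid y < r)%R then 1 else 0) =
  (unit_vol n * r ^+ n)%:E.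
Proof.
move=> n0 r0.
rewrite -(ge0_integral_rV_scale r0); last 2 first.
- by mfun.
- by move=> y; case: ifP.
rewrite mulrC EFinM; congr (_ * _).
under eq_integral => y _.
  rewrite euclidZ gtr0_norm// pmulr_rgt0// -[X in (_ * _ < X)%R]mulr1 ltr_pM2l//.
  over.
by rewrite integral_if integral_cst ?unit_vol_fin ?mul1e//; exact: measurable_annulus.
Qed.

End polar.

(** * The volume of the unit ball, from the Gaussian integral *)

Section unit_ball_volume.
Context {R : realType}.
Local Open Scope ereal_scope.

Lemma integral_expR_tail (s : R) :
  \int[lebesgue_measure]_t (if (s < t)%R then (expR (- t))%:E else 0)
  = (expR (- s))%:E.
Proof.
rewrite integral_if (_ : [set _ | _] = `]s, +oo[%classic); last first.
  by apply/seteqP; split => x /=; rewrite in_itv/= andbT.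
have cf : continuous (fun t : R => expR (- t)).
  by move=> x; apply: continuous_comp; [exact: oppr_continuous|exact: continuous_expR].
rewrite integral_itv_obnd_cbnd; last first.
  by apply: measurable_funTS; apply/measurable_EFinP; exact: continuous_measurable_fun.
have der (x : R) : is_derive x (1%R : R) (fun x => - expR (- x))%R (expR (- x)).
  by apply: is_derive_eq; rewrite mulrN1 opprK.
rewrite (@ge0_continuous_FTC2y _ _ (fun x => - expR (- x))%R s 0%R).
- by rewrite EFinN oppeK add0e.
- by move=> x _; exact: expR_ge0.
- exact: continuous_subspaceT.
- by rewrite -[X in _ --> X]oppr0; apply: cvgN; exact: cvgr_expR.
- by move=> x _; apply: ex_derive.
- by apply: cvg_at_right_filter; apply: cvgN; exact: cf.
- by move=> x _; rewrite derive1E; have [_ ->] := der x.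
Qed.

Lemma measurable_gauss_rV k :
  measurable_fun setT (fun x : 'rV[R]_k => (expR (- \sum_i x 0%R i ^+ 2))%:E).
Proof.
apply/measurable_EFinP; apply: (measurableT_comp (@measurable_expR R)).
under eq_fun do rewrite -sqr_euclid.
apply: (measurableT_comp (@oppr_measurable R setT)).
by apply: (measurableT_comp (@exprn_measurable R setT 2)); mfun.
Qed.

Lemma integral_gauss_rV n :
  \int[lebesgue_rV n]_x (expR (- \sum_i x 0%R i ^+ 2))%:E = (Num.sqrt pi ^+ n)%:E :> \bar R.
Proof.
have mg := measurable_gauss_rV.
elim: n => [|n IH].
  rewrite (eq_integral (cst (1 : \bar R))) => [|x _]; last by rewrite big_ord0 oppr0 expR0.
  by rewrite integral_cst// mul1e /= /dirac/= indicT.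
rewrite ge0_integral_rV_succ//.
transitivity (\int[lebesgue_measure]_x ((gauss_fun x)%:E * (Num.sqrt pi ^+ n)%:E : \bar R)).
  apply: eq_integral => x _; rewrite -IH -ge0_integralZl//.
    apply: eq_integral => v _; rewrite -EFinM -expRD; congr (expR _)%:E.
    rewrite big_ord_recl mxE unlift_none/= opprD; congr (- _ - _)%R.
    by apply: eq_bigr => i _; rewrite mxE liftK.
    exact: mg.
  by rewrite lee_fin expR_ge0.
rewrite ge0_integralZr//.
- by rewrite integralT_gauss -EFinM exprS.
- by apply/measurable_EFinP; exact: measurable_gauss_fun.
- by move=> x _; rewrite lee_fin expR_ge0.
Qed.

Lemma lebesgue_rV_set1 n (x : 'rV[R]_n) : (0 < n)%N -> lebesgue_rV n [set x] = 0.
Proof.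
move=> n0; have -> : [set x] = [set v : 'rV[R]_n | forall i, [set x 0%R i] (v 0%R i)].
  apply/seteqP; split => [v -> //|v h].
  by apply/rowP => i; exact: h.
rewrite (lebesgue_rV_box (A := fun i => [set x ord0 i])) => [|i]; last exact: measurable_set1.
by case: n n0 x => // n _ x; rewrite big_ord_recl lebesgue_measure_set1 mul0e.
Qed.

Lemma integral_punctured n (f : 'rV[R]_n -> \bar R) : (0 < n)%N ->
  measurable_fun setT f -> (forall x, 0 <= f x) ->
  \int[lebesgue_rV n]_y f y = \int[lebesgue_rV n]_y (if (0 < euclid y)%R then f y else 0).
Proof.
move=> n0 mf f0; apply: ge0_ae_eq_integral => //.
- by mfun.
- by move=> x _; case: ifP.
have m0 : measurable [set (0%R : 'rV[R]_n)].
  by apply: closed_measurable_rV; apply: accessible_closed_set1;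
  apply: hausdorff_accessible; exact: norm_hausdorff.
exists [set 0%R]; split => //; first exact: lebesgue_rV_set1.
move=> x /= h; apply: contrapT => /eqP x0; apply: h => _.
by rewrite euclid_gt0 x0.
Qed.

(** The integral of exp(-|x|^2) is computed twice. Coordinate by coordinate it is pi^(n/2). Writing
    exp(-|x|^2) as the integral of exp(-t) over t > |x|^2 and exchanging the integrals, the ball of
    radius sqrt t contributes its volume [unit_vol n] t^(n/2). *)
Lemma unit_vol_Gamma n : (0 < n)%N ->
  (unit_vol n)%:E * \int[lebesgue_measure]_(t in `]0%R, +oo[) (t `^ (n%:R / 2) * expR (- t))%:E
  = (pi `^ (n%:R / 2))%:E :> \bar R.
Proof.
move=> n0; transitivity ((Num.sqrt pi ^+ n)%:E : \bar R); last first.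
  by rewrite -powR_mulrn ?sqrtr_ge0// -powR12_sqrt ?pi_ge0// -powRrM mulrC.
rewrite -integral_gauss_rV integral_punctured//; last exact: measurable_gauss_rV.
pose F (x : 'rV[R]_n) (t : measurableTypeR R) : \bar R :=
  if (0 < euclid x)%R && (euclid x `^ 2 < t)%R then (expR (- t))%:E else 0.
have mF : measurable_fun setT (fun p => F p.1 p.2).
  rewrite /F; mfun; apply: (measurableT_comp (@measurable_expR R)).
  by apply: (measurableT_comp (@oppr_measurable R setT)); mfun.
transitivity (\int[lebesgue_rV n]_x \int[lebesgue_measure]_t F x t); last first.
  apply: eq_integral => x _; rewrite /F; case: ifPn => x0; last by rewrite integral0.
  by rewrite integral_expR_tail powR_mulrn ?euclid_ge0// sqr_euclid.
rewrite tonelli_swap//; last first.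
  by move=> x t; rewrite /F; case: ifP => // _; rewrite lee_fin expR_ge0.
rewrite -ge0_integralZl//; last 3 first.
- apply/measurable_EFinP; apply: measurable_funTS; apply: measurable_funM.
    exact: measurable_powR.
  apply: (measurableT_comp (@measurable_expR R)); exact: oppr_measurable.
- by move=> t _; rewrite lee_fin mulr_ge0 ?powR_ge0 ?expR_ge0.
- by rewrite lee_fin unit_vol_ge0.
rewrite (_ : `]0%R, +oo[%classic = [set t | (0 < t)%R]); last first.
  by apply/seteqP; split => x /=; rewrite in_itv/= andbT.
rewrite -integral_if; apply: eq_integral => t _; case: ifPn => t0; last first.
  rewrite integral0_eq// => x _; rewrite /F; case: ifP => // /andP[_ xt].
  by move: t0; rewrite (le_lt_trans (powR_ge0 _ _) xt).
transitivity ((expR (- t))%:E * (unit_vol n * t `^ (n%:R / 2))%:E).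
  by rewrite -!EFinM; congr EFin; ring.
have -> : (unit_vol n * t `^ (n%:R / 2))%:E = \int[lebesgue_rV n]_x
    (if (0 < euclid x < Num.sqrt t)%R then 1 else 0) :> \bar R.
  rewrite volume_ball// ?sqrtr_gt0//; congr (_ * _)%:E.
  by rewrite -powR12_sqrt ?ltW// -powR_mulrn ?powR_ge0// -powRrM mulrC.
rewrite -ge0_integralZl//; last 2 first.
- by mfun.
- by move=> x _; case: ifP.
apply: eq_integral => x _; rewrite /F.
have -> : (euclid x `^ 2 < t)%R = (euclid x < Num.sqrt t)%R.
  rewrite powR_mulrn ?euclid_ge0// -[in LHS](sqr_sqrtr (ltW t0)).
  by rewrite ltr_pXn2r// ?nnegrE ?euclid_ge0 ?sqrtr_ge0.
by case: ifP => _; rewrite ?mule1 ?mule0.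
Qed.

Lemma unit_vol_gt0 n : (0 < n)%N -> (0 < unit_vol n :> R)%R.
Proof.
move=> n0; rewrite lt_def unit_vol_ge0 andbT; apply/eqP => v0.
have /eqP := unit_vol_Gamma n0; rewrite v0 mul0e eq_sym eqe gt_eqF//.
by rewrite powR_gt0// pi_gt0.
Qed.

Lemma unit_volE n : (0 < n)%N -> unit_vol n = omega R n.
Proof.
move=> n0; have v0 := unit_vol_gt0 n0; have := unit_vol_Gamma n0.
rewrite /omega /Gamma /Rintegral addrK.
have : 0 <= \int[lebesgue_measure]_(t in `]0%R, +oo[) (t `^ (n%:R / 2) * expR (- t))%:E :> \bar R.
  by apply: integral_ge0 => t _; rewrite lee_fin mulr_ge0 ?powR_ge0 ?expR_ge0.
have p0 : (0 < (pi : R) `^ (n%:R / 2))%R by rewrite powR_gt0// pi_gt0.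
(* [Gamma] takes [fine] of this integral, so it must be shown finite. It is, since +oo times the
   positive number [unit_vol n] would not be the finite value pi^(n/2). *)
case: (\int[_]_(_ in _) _) => [r| |]//= r0.
  rewrite -EFinM => /eqP; rewrite eqe => /eqP vr; rewrite -vr mulfK//.
  by apply/eqP => rz; move: p0; rewrite -vr rz mulr0 ltxx.
by rewrite gt0_muley// lte_fin.
Qed.

End unit_ball_volume.
(** * The gradient potential *)

Section directional_derivative.
Context {R : realType} {V : normedModType R}.
Implicit Types (f : V -> R) (x y u w : V).

Lemma is_derive_line f y u (t d : R) :
  is_derive (t *: u + y) u f d <-> is_derive t 1 (fun s : R => f (s *: u + y)) d.
Proof.
have E : (fun h : R => h^-1 *: (((fun s : R => f (s *: u + y)) \o shift t) (h *: 1) -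
      (fun s : R => f (s *: u + y)) t)) =
    (fun h : R => h^-1 *: ((f \o shift (t *: u + y)) (h *: u) - f (t *: u + y))).
  by apply/funext => h /=; rewrite -[h *: 1]/(h * 1) mulr1 scalerDl addrA.
split=> -[df dE].
  by split; [rewrite /derivable E|rewrite -dE /derive E].
by split; [rewrite /derivable -E|rewrite -dE /derive -E].
Qed.

(** The increment along h (w + u) is split into the step h w from [x] and the step h u from h w + x.
    The first quotient tends to [a]. By the mean value theorem the second is the derivative along
    [u] at a point close to [x], and continuity of that derivative at [x] gives its limit. *)
Lemma is_derive_dirD f x w u (a : R) : is_derive x w f a ->
  (forall y, derivable f y u) -> {for x, continuous (fun y => 'D_u f y)} ->
  is_derive x (w + u) f (a + 'D_u f x).
Proof.
move=> [dw wE] du cu.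
pose q1 h := h^-1 *: (f (h *: w + x) - f x).
pose q2 h := h^-1 *: (f (h *: (w + u) + x) - f (h *: w + x)).
have q1a : q1 h @[h --> 0^'] --> a by rewrite -wE.
have q2b : q2 h @[h --> 0^'] --> 'D_u f x.
  apply/cvgrPdist_lt => e e0.
  have /nbhs_ballP[r /= r0 rP] : \forall y \near x, `|'D_u f x - 'D_u f y| < e.
    by move/cvgrPdist_lt : cu => /(_ _ e0).
  pose M := `|w| + `|u| + 1.
  have M0 : 0 < M by rewrite ltr_wpDl// addr_ge0.
  have near_line (h t : R) : `|h| < r / M -> `|t| <= `|h| ->
      `|'D_u f x - 'D_u f (t *: u + (h *: w + x))| < e.
    move=> hr th; apply: rP; rewrite -ball_normE /ball_/=.
    have -> : x - (t *: u + (h *: w + x)) = - (t *: u + h *: w).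
      by rewrite addrA opprD addrCA subrr addr0.
    rewrite normrN.
    rewrite (le_lt_trans (ler_normD _ _))// !normrZ.
    rewrite (@le_lt_trans _ _ (`|h| * M))//; last by rewrite -ltr_pdivlMr.
    rewrite /M 2!mulrDr mulr1 [X in X <= _]addrC -addrA lerD2l.
    by rewrite (@le_trans _ _ (`|h| * `|u|)) ?lerDl// ler_wpM2r.
  have der (h t : R) : is_derive t 1 (fun s : R => f (s *: u + (h *: w + x)))
     ('D_u f (t *: u + (h *: w + x))).
    exact: (is_derive_line f _ u t _).1 (derivableP (du _)).
  have cont (h : R) A : {within A, continuous (fun s : R => f (s *: u + (h *: w + x)))}.
    apply: continuous_subspaceT => t.
    by have [/derivable1_diffP/differentiable_continuous] := der h t.
  near=> h.
  have h0 : h != 0 by near: h; exact: nbhs_dnbhs_neq.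
  have hr : `|h| < r / M.
    near: h; apply: nbhs_dnbhs; apply/nbhs_ballP; exists (r / M) => /=.
      by rewrite divr_gt0.
    by move=> h; rewrite -ball_normE /ball_/= sub0r normrN.
  have [c ch cE] : exists2 c : R, `|c| <= `|h| &
      f (h *: u + (h *: w + x)) - f (0 *: u + (h *: w + x)) =
      'D_u f (c *: u + (h *: w + x)) * h.
    have [h_gt0|h_lt0|/esym/eqP] := ltgtP 0 h; last by rewrite (negbTE h0).
      have [c] := @MVT _ _ _ 0 h h_gt0 (fun t _ => der h t) (cont h _).
      rewrite in_itv/= subr0 => /andP[c0 ch] E; exists c => //.
      by rewrite !gtr0_norm// ltW.
    have [c] := @MVT _ _ _ h 0 h_lt0 (fun t _ => der h t) (cont h _).
    rewrite in_itv/= sub0r => /andP[ch c0] E; exists c => //.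
      by rewrite !ltr0_norm// lerN2 ltW.
    by rewrite -[LHS]opprB E mulrN opprK.
  have -> : q2 h = h^-1 *: (f (h *: u + (h *: w + x)) - f (h *: w + x)).
    by rewrite /q2 addrA -scalerDr (addrC u).
  rewrite scale0r add0r in cE; rewrite cE -[_ *: _]/(_ * _) mulrCA mulVf// mulr1.
  exact: near_line.
have q12 : h^-1 *: ((f \o shift x) (h *: (w + u)) - f x) @[h --> 0^'] --> a + 'D_u f x.
  rewrite (_ : (fun h => _) = q1 \+ q2); first exact: cvgD.
  apply/funext => h /=; rewrite /q1 /q2 -scalerDr; congr (_ *: _).
  ring.
split; first by apply/cvg_ex; exists (a + 'D_u f x).
by apply/cvg_lim.
Unshelve. all: end_near. Qed.

Lemma is_derive_dirZ f x u (k : R) : derivable f x u ->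
  is_derive x (k *: u) f (k * 'D_u f x).
Proof.
move=> /derivableP du; have [->|k0] := eqVneq k 0.
  by rewrite scale0r mul0r; exact: is_derive0.
have dl : is_derive (k * 0) (1 : R) (fun s : R => f (s *: u + x)) ('D_u f x).
  by apply/is_derive_line; rewrite mulr0 scale0r add0r.
have ds : is_derive (0 : R) (1 : R) (fun s : R => k * s) k.
  by have := @is_deriveZ R R R id k 0 1 1 _; rewrite -[k *: 1]/(k * 1) mulr1; exact.
have dc := is_derive1_comp dl ds.
have : is_derive (0 *: (k *: u) + x) (k *: u) f (k * 'D_u f x).
  apply/is_derive_line; rewrite (_ : (fun _ => _) =
    (fun s : R => f (s *: u + x)) \o (fun s => k * s)).
    by rewrite mulrC; exact: dc.
  by apply/funext => s /=; rewrite scalerA mulrC.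
by rewrite scale0r add0r.
Qed.

End directional_derivative.

Section gradient.
Context {R : realType} {n : nat}.
Implicit Types f : 'rV[R]_n -> R.

Lemma Ck_continuous k f : Ck k f -> continuous f.
Proof. by case: k => [|k] []. Qed.

(** [Ck] provides partial derivatives only. The coordinate directions are added one at a time by
    [is_derive_dirD], which asks for continuity only of the derivative being added. *)
Lemma is_derive_grad f (x v : 'rV[R]_n) : Ck 1 f ->
  is_derive x v f (\sum_i v 0 i * partial i f x).
Proof.
move=> [_ Cf].
have -> : v = \sum_i v 0 i *: delta_mx 0 i by rewrite -row_sum_delta.
rewrite (eq_bigr (fun i => v 0 i * partial i f x)) => [|i _]; last first.
  by rewrite -row_sum_delta.
elim: (index_enum _) => [|i r IH]; first by rewrite !big_nil; exact: is_derive0.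
rewrite !big_cons addrC [X in is_derive _ _ _ X]addrC.
have dZ y := is_derive_dirZ (v 0 i) ((Cf i).1 y).
have -> : v 0 i * partial i f x = 'D_(v 0 i *: delta_mx 0 i) f x.
  by rewrite (@derive_val _ _ _ _ _ _ _ (dZ x)).
apply: is_derive_dirD => //.
rewrite (_ : (fun y => _) = (fun y => v 0 i * partial i f y)); last first.
  by apply/funext => y; rewrite (@derive_val _ _ _ _ _ _ _ (dZ y)).
exact: cvgMl_tmp ((Cf i).2.1 x).
Qed.

Lemma Ck_grad_line f (x z : 'rV[R]_n) (t : R) : Ck 1 f ->
  is_derive t 1 (fun s : R => f (s *: z + x))
    (\sum_i z 0 i * partial i f (t *: z + x)).
Proof. by move=> Cf; exact: (is_derive_line f x z t _).1 (is_derive_grad _ _ Cf). Qed.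

Lemma continuous_line (g : 'rV[R]_n -> R) (x z : 'rV[R]_n) :
  continuous g -> continuous (fun s : R => g (s *: z + x)).
Proof.
move=> cg s; apply: continuous_comp; last exact: cg.
by apply: cvgD; [apply: cvgZr_tmp; exact: cvg_id|exact: cvg_cst].
Qed.

Lemma line_bound f (x z : 'rV[R]_n) (M : R) : Ck 1 f -> z != 0 ->
  (forall y, M <= euclid y -> f y = 0) ->
  (`|f x|%:E <= \int[lebesgue_measure]_t
    (if (0 < t)%R then (euclid (grad f (t *: z + x)) * euclid z)%:E else 0))%E.
Proof.
move=> Cf z0 fM; have ez : 0 < euclid z by rewrite euclid_gt0.
(* At this parameter the ray has left the support: |T z + x| >= T |z| - |x| = |M| + 1. *)
pose T := (`|M| + euclid x + 1) / euclid z.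
have T0 : 0 < T by rewrite divr_gt0// ltr_wpDl// addr_ge0// euclid_ge0.
have fT : f (T *: z + x) = 0.
  apply: fM; have := ler_euclidD (T *: z + x) (- x).
  rewrite addrK euclidN euclidZ gtr0_norm// /T divfK ?gt_eqF// -addrA addrCA => h.
  have := ler_norm M; lra.
pose g t := \sum_i z 0 i * partial i f (t *: z + x).
have cg : continuous g.
  move=> t; apply: (@cvg_sum _ _ (nbhs t)) => i; apply: cvgMl_tmp.
  by apply: continuous_line; case: Cf => _ /(_ i)[_ []].
have cfl : continuous (fun s : R => f (s *: z + x)).
  by apply: continuous_line; exact: Ck_continuous Cf.
have FTC : (\int[lebesgue_measure]_(t in `[0%R, T]) (g t)%:E = (- f x)%:E)%E.
  rewrite (@continuous_FTC2 _ g (fun s : R => f (s *: z + x)))//.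
  - by rewrite scale0r add0r fT -EFinB sub0r.
  - exact: continuous_subspaceT.
  - split.
    + by move=> t _; have [] := Ck_grad_line x z t Cf.
    + by apply: cvg_at_right_filter; exact: cfl.
    + by apply: cvg_at_left_filter; exact: cfl.
  - by move=> t _; rewrite derive1E; have [_ ->] := Ck_grad_line x z t Cf.
rewrite -normrN -abse_EFin -FTC.
have mg (D : set R) : measurable_fun D (EFin \o g).
  by apply: measurable_funTS; apply/measurable_EFinP; exact: continuous_measurable_fun.
have mgrad (D : set R) : measurable_fun D (fun t : R => (euclid (grad f (t *: z + x)) * euclid z)%:E).
  apply: measurable_funTS; apply/measurable_EFinP; apply: measurable_funM => //.
  apply: (measurableT_comp measurable_euclid); apply: measurable_fun_rVP => i.
  apply: continuous_measurable_fun; rewrite /comp/rV_coord.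
  under eq_fun do rewrite mxE.
  by apply: continuous_line; case: Cf => _ /(_ i)[_ []].
have /le_trans := @le_abse_integral _ _ R lebesgue_measure `[0%R, T]%classic
  (EFin \o g) (measurable_itv _) (mg _); apply.
apply: (@le_trans _ _ (\int[lebesgue_measure]_(t in `[0%R, T])
  (euclid (grad f (t *: z + x)) * euclid z)%:E)%E).
  apply: ge0_le_integral.
  - exact: measurable_itv.
  - by move=> t _; exact: abse_ge0.
  - by apply: measurableT_comp => //; exact: mg.
  - exact: mgrad.
  move=> t _; rewrite lee_fin mulrC.
  rewrite (_ : g t = \sum_i z 0 i * grad f (t *: z + x) 0 i) ?cauchy_schwarz//.
  by apply: eq_bigr => i _; rewrite mxE.
rewrite integral_if [X in (_ <= \int[_]_(_ in X) _)%E](_ : _ = `]0%R, +oo[%classic); last first.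
  by apply/seteqP; split => t /=; rewrite in_itv/= andbT.
rewrite integral_itv_obnd_cbnd//.
apply: ge0_subset_integral => //; first exact: mgrad.
  by move=> t _; rewrite lee_fin mulr_ge0// euclid_ge0.
by move=> t /=; rewrite !in_itv/= andbT => /andP[].
Qed.

Lemma measurable_euclid_grad f : Ck 1 f -> measurable_fun setT (fun y => euclid (grad f y)).
Proof.
move=> Cf; apply: (measurableT_comp measurable_euclid); apply: measurable_fun_rVP => i.
apply: continuous_measurable_rV; rewrite /comp/rV_coord.
under eq_fun do rewrite mxE.
by case: Cf => _ /(_ i)[_ []].
Qed.

Lemma measurable_rV_shift (w : 'rV[R]_n) :
  measurable_fun setT (fun v : 'rV[R]_n => v + w : 'rV[R]_n).
Proof.
have := measurable_rV_affine 1 w.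
by under eq_fun do rewrite scale1r.
Qed.

(** Average [line_bound] over the directions [z] of the punctured unit ball; [integral_cone] turns
    the average of the ray integrals into the potential. *)
Lemma potential_bound f (x : 'rV[R]_n) (M : R) : (1 < n)%N -> Ck 1 f ->
  (forall y, M <= euclid y -> f y = 0) ->
  ((n%:R * unit_vol n * `|f x|)%:E <= \int[lebesgue_rV n]_y
    (euclid (grad f y) * euclid (y - x) `^ (1 - n%:R))%:E)%E.
Proof.
move=> n1 Cf fM; have n0 : (0 < n)%N by exact: ltnW.
have n0R : 0 < n%:R :> R by rewrite ltr0n.
(* By convention 0 to a nonzero power is 0, so for n > 1 the kernel vanishes at y = x and the
   singular point need not be excluded. *)
have K0 : (0 : R) `^ (1 - n%:R) = 0.
  by rewrite powR0// subr_eq0 (eqr_nat R 1) neq_ltn n1.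
have mG := measurable_euclid_grad Cf.
pose h y := (euclid (grad f (y + x)))%:E : \bar R.
have mh : measurable_fun setT h.
  by apply/measurable_EFinP; apply: (measurableT_comp mG); exact: measurable_rV_shift.
have h0 y : (0 <= h y)%E by rewrite lee_fin euclid_ge0.
pose G y := (euclid (grad f y) * euclid (y - x) `^ (1 - n%:R))%:E : \bar R.
have mGK : measurable_fun setT G.
  rewrite /G; mfun; exact: measurable_rV_shift.
rewrite -/(G _) -(ge0_integral_rV_shift x mGK); last first.
  by move=> y; rewrite lee_fin mulr_ge0 ?euclid_ge0 ?powR_ge0.
rewrite (_ : (\int[lebesgue_rV n]_y G (y + x)%R = \int[lebesgue_rV n]_y
    (if (0 < euclid y)%R then h y * (euclid y `^ (1 - n%:R))%:E else 0))%E); last first.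
  apply: eq_integral => y _; rewrite /G addrK EFinM.
  case: ifPn => //; rewrite -leNgt => y0.
  by rewrite (_ : euclid y = 0) ?K0 ?mule0//; apply/eqP; rewrite eq_le y0 euclid_ge0.
rewrite -mulrA EFinM -lee_pdivlMl// -(integral_cone n0 mh h0).
rewrite [unit_vol n * _]mulrC EFinM unit_vol_fin -integral_cst; last exact: measurable_annulus.
rewrite -integral_if; apply: ge0_le_integral => //.
- by move=> z _; case: ifP; rewrite //= lee_fin.
- by mfun.
- mfun; apply: measurable_integral_snd; first last.
    by move=> z t; case: ifP => // _; rewrite mule_ge0// lee_fin euclid_ge0.
  mfun.
  apply: (measurableT_comp mh); apply: measurable_fun_rVP => i.
  rewrite /comp/rV_coord; under eq_fun do rewrite mxE.
  apply: measurable_funM; first exact: measurable_snd.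
  by apply: (measurableT_comp (measurable_rV_coord i)); exact: measurable_fst.
- move=> z _; case: ifPn => // /andP[z0 _].
  have z1 : z != 0 by rewrite -euclid_gt0.
  apply: le_trans (line_bound x Cf z1 fM) _.
  by rewrite le_eqVlt; apply/orP; left; apply/eqP; apply: eq_integral => t _; case: ifP => // _; rewrite EFinM.
Qed.

End gradient.

(** * Hoelder's inequality and the norms of the kernel |y|^(1-n) *)

Section hoelder_bound.
Context d (T : measurableType d) (R : realType) (mu : {measure set T -> \bar R}).

(** With numerical bounds [A] and [B] in place of norms, finiteness is part of the hypotheses and
    explicit values can be inserted directly. *)
Lemma hoelder_bound (a b : T -> R) (p q A B : R) :
  measurable_fun setT a -> measurable_fun setT b ->
  (forall x, 0 <= a x) -> (forall x, 0 <= b x) ->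
  0 < p -> 0 < q -> p^-1 + q^-1 = 1 -> 0 <= A -> 0 <= B ->
  (\int[mu]_x (a x `^ p)%:E <= (A `^ p)%:E)%E ->
  (\int[mu]_x (b x `^ q)%:E <= (B `^ q)%:E)%E ->
  (\int[mu]_x (a x * b x)%:E <= (A * B)%:E)%E.
Proof.
move=> ma mb a0 b0 p0 q0 pq A0 B0 Ap Bq.
have N (c : T -> R) (r C : R) : measurable_fun setT c -> (forall x, 0 <= c x) ->
    0 < r -> 0 <= C -> (\int[mu]_x (c x `^ r)%:E <= (C `^ r)%:E)%E ->
    ('N[mu]_r%:E[EFin \o c] <= C%:E)%E.
  move=> mc c0 r0 C0 Cr; rewrite unlock.
  have -> : C%:E = ((C `^ r)%:E `^ r^-1)%E.
    by rewrite poweR_EFin -powRrM mulfV ?gt_eqF// powRr1.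
  apply: gt0_ler_poweR; first by rewrite invr_ge0 ltW.
  - rewrite in_itv/= leey andbT integral_ge0// => x _; exact: poweR_ge0.
  - by rewrite in_itv/= leey andbT lee_fin powR_ge0.
  - apply: le_trans Cr; rewrite le_eqVlt; apply/orP; left; apply/eqP.
    by apply: eq_integral => x _ /=; rewrite ger0_norm.
have := hoelder mu ma mb p0 q0 pq; rewrite Lnorm1.
rewrite (eq_integral (fun x => (a x * b x)%:E)) => [h|x _]; last first.
  by rewrite /= ger0_norm// mulr_ge0.
apply: (le_trans h); rewrite EFinM; apply: lee_pmul; rewrite ?Lnorm_ge0//.
  exact: N.
exact: N.
Qed.

End hoelder_bound.

Lemma integral_powR_tail_le (R : realType) (m s : R) : 0 < m -> 0 < s ->
  (\int[lebesgue_measure]_t (if (s <= t)%R then (t `^ (- m - 1))%R%:E else 0)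
   = (s `^ (- m) / m)%R%:E)%E.
Proof.
move=> m0 s0; rewrite -integral_powR_tail// !integral_if.
rewrite [X in (\int[_]_(_ in X) _ = _)%E](_ : _ = `[s, +oo[%classic); last first.
  by apply/seteqP; split => x /=; rewrite in_itv/= andbT.
rewrite [X in (_ = \int[_]_(_ in X) _)%E](_ : _ = `]s, +oo[%classic); last first.
  by apply/seteqP; split => x /=; rewrite in_itv/= andbT.
rewrite integral_itv_obnd_cbnd//.
by apply: measurable_funTS; apply/measurable_EFinP; exact: measurable_powR.
Qed.

Section kernel.
Context {R : realType} {n : nat}.
Hypothesis n0 : (0 < n)%N.

Lemma kernel_head (s D : R) : 0 < D -> 0 < n%:R + s ->
  (\int[lebesgue_rV n]_y (if (0 < euclid y < D)%R then (euclid y `^ s)%:E else 0)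
   = (n%:R * unit_vol n * (D `^ (n%:R + s) / (n%:R + s)))%:E)%E.
Proof.
move=> D0 ns0.
pose g (r : measurableTypeR R) : \bar R := (if (r < D)%R then (r `^ s)%:E else 0)%E.
have mg : measurable_fun setT g by rewrite /g; mfun.
have g0 r : (0 <= g r)%E by rewrite /g; case: ifP => // _; rewrite lee_fin powR_ge0.
transitivity (\int[lebesgue_rV n]_y (if (0 < euclid y)%R then g (euclid y) else 0))%E.
  by apply: eq_integral => y _; rewrite /g; do 2 case: ltP.
rewrite integral_polar// [RHS]EFinM; congr (_ * _)%E.
rewrite -integral_powR_head//; apply: eq_integral => t _; rewrite /g.
case: (ltP 0 t) => //= t0; case: ifP => _; last by rewrite mul0e.
by rewrite -EFinM -powR_posD//; congr (_ `^ _)%:E; ring.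
Qed.

Lemma kernel_tail (s D : R) : 0 < D -> n%:R + s < 0 ->
  (\int[lebesgue_rV n]_y (if (D <= euclid y)%R then (euclid y `^ s)%:E else 0)
   = (n%:R * unit_vol n * (D `^ (n%:R + s) / - (n%:R + s)))%:E)%E.
Proof.
move=> D0 ns0.
pose g (r : measurableTypeR R) : \bar R := (if (D <= r)%R then (r `^ s)%:E else 0)%E.
have mg : measurable_fun setT g by rewrite /g; mfun.
have g0 r : (0 <= g r)%E by rewrite /g; case: ifP => // _; rewrite lee_fin powR_ge0.
transitivity (\int[lebesgue_rV n]_y (if (0 < euclid y)%R then g (euclid y) else 0))%E.
  apply: eq_integral => y _; rewrite /g; case: (leP D) => Dy; last by case: ifP.
  by rewrite (lt_le_trans D0).
rewrite integral_polar// [RHS]EFinM; congr (_ * _)%E.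
rewrite -[X in (D `^ X)]opprK -integral_powR_tail_le ?oppr_gt0//.
apply: eq_integral => t _; rewrite /g.
case: (leP D t) => Dt; last by rewrite mul0e; case: ifP.
have t0 := lt_le_trans D0 Dt; rewrite t0.
by rewrite -EFinM -powR_posD//; congr (_ `^ _)%:E; ring.
Qed.

End kernel.
(** For 1 < p < n, the norm of |y|^(1-n) in L^(p/(p-1)) outside the unit ball, divided by n omega_n.
    By scaling, outside the ball of radius delta it is multiplied by delta^(-(n-p)/p). *)
Definition far_norm (R : realType) (n : nat) (p : R) : R :=
  (n%:R * unit_vol n) `^ (- p^-1) * ((p - 1) / (n%:R - p)) `^ ((p - 1) / p).

(** * Morrey's inequality, the weak-type estimate and its integration over levels *)

Section potential.
Context {R : realType} {n : nat}.
Hypothesis n1 : (1 < n)%N.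
Let n0 : (0 < n)%N. Proof. exact: ltnW. Qed.
Let nR1 : 1 < n%:R :> R. Proof. by rewrite ltr1n. Qed.
Let nR0 : 0 < n%:R :> R. Proof. exact: lt_trans ltr01 nR1. Qed.
Let v0 : 0 < unit_vol n :> R. Proof. exact: unit_vol_gt0. Qed.
Let nv0 : 0 < n%:R * unit_vol n :> R. Proof. exact: mulr_gt0. Qed.
Let K0 : (0 : R) `^ (1 - n%:R) = 0.
Proof. by rewrite powR0// subr_eq0 (eqr_nat R 1) neq_ltn n1. Qed.

Variables (f G : 'rV[R]_n -> R).
Hypotheses (mf : measurable_fun setT f) (mG : measurable_fun setT G).
Hypothesis G0 : forall y, 0 <= G y.
Hypothesis fG : forall x, ((n%:R * unit_vol n * `|f x|)%:E <=
  \int[lebesgue_rV n]_y (G y * euclid (y - x) `^ (1 - n%:R))%:E)%E.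

Let K (y : 'rV[R]_n) : R := euclid y `^ (1 - n%:R).

Let mK : measurable_fun setT K.
Proof. by rewrite /K; mfun. Qed.

Let mKx (x : 'rV[R]_n) : measurable_fun setT (fun y : 'rV[R]_n => K (y - x)).
Proof. by apply: (measurableT_comp mK); exact: measurable_rV_shift. Qed.

Let mex (x : 'rV[R]_n) : measurable_fun setT (fun y : 'rV[R]_n => euclid (y - x)).
Proof. by apply: (measurableT_comp measurable_euclid); exact: measurable_rV_shift. Qed.

(** Only the kernel within distance [D] of [x] is seen by [G]. With q = p/(p-1), its q-th power is
    integrable there because n + (1-n) q = (p-n)/(p-1) is positive. Taking p-th powers, n omega_n
    appears to the power p on the left and p - 1 on the right, so one factor remains. *)
Lemma morrey_bound (D p : R) : n%:R < p -> 0 < D ->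
  forall x, (forall y, G y != 0 -> euclid (y - x) < D) ->
  ((n%:R * unit_vol n * `|f x| `^ p)%:E <=
   (((p - 1) / (p - n%:R)) `^ (p - 1) * D `^ (p - n%:R))%:E *
   \int[lebesgue_rV n]_y (G y `^ p)%:E)%E.
Proof.
move=> np D0 x GD.
have p1 : 1 < p by exact: lt_trans np.
have p0 : 0 < p by exact: lt_trans p1.
have p10 : 0 < p - 1 by rewrite subr_gt0.
have pn0 : 0 < p - n%:R by rewrite subr_gt0.
set c := (_ * D `^ _).
have c0 : 0 < c by rewrite mulr_gt0 ?powR_gt0// divr_gt0.
have : (0 <= \int[lebesgue_rV n]_y (G y `^ p)%:E)%E.
  by apply: integral_ge0 => y _; rewrite lee_fin powR_ge0.
case E : (\int[_]_y (G y `^ p)%:E)%E => [e| |]//; last by rewrite gt0_muley ?lte_fin ?leey.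
rewrite lee_fin => e0; rewrite -EFinM lee_fin.
pose m := (p - n%:R) / (p - 1).
have m0 : 0 < m by rewrite divr_gt0.
pose q := p / (p - 1).
have q0 : 0 < q by rewrite divr_gt0.
have mE : n%:R + (1 - n%:R) * q = m by rewrite /m /q; field; rewrite gt_eqF.
pose k := n%:R * unit_vol n * (D `^ m / m).
have k0 : 0 < k by rewrite mulr_gt0// divr_gt0// powR_gt0.
pose b (y : 'rV[R]_n) := if euclid (y - x) < D then K (y - x) else 0.
have mb : measurable_fun setT b.
  exact: (measurable_fun_ifT (measurable_fun_ltr (mex x) (measurable_cst D)) (mKx x)
    (measurable_cst _)).
have h1 : (\int[lebesgue_rV n]_y (G y * b y)%:E <= (e `^ p^-1 * k `^ q^-1)%:E)%E.
  apply: (hoelder_bound mG mb _ _ p0 q0) => //.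
  - by move=> y; rewrite /b; case: ifP => // _; exact: powR_ge0.
  - by rewrite /q invf_div -[X in _ + X]/((p - 1) / p); field; rewrite gt_eqF.
  - exact: powR_ge0.
  - exact: powR_ge0.
  - by rewrite E -powRrM mulVf ?gt_eqF// powRr1.
  rewrite -powRrM mulVf ?gt_eqF// powRr1 ?(ltW k0)//.
  rewrite /k -mE -kernel_head ?mE//.
  pose B (y : 'rV[R]_n) := (if (0 < euclid y < D)%R then (euclid y `^ ((1 - n%:R) * q))%:E else 0)%E.
  have mB : measurable_fun setT B by rewrite /B; mfun.
  rewrite -/(B _) -[leRHS](ge0_integral_rV_shift (- x) mB); last first.
    by move=> y; rewrite /B; case: ifP => // _; rewrite lee_fin powR_ge0.
  rewrite le_eqVlt; apply/orP; left; apply/eqP; apply: eq_integral => y _.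
  rewrite /b /B /K; have [y0|y0] := ltP 0 (euclid (y - x)).
    case: ifP => _ /=.
      by rewrite -powRrM.
    by rewrite powR0// gt_eqF.
  have -> : euclid (y - x) = 0 by apply/eqP; rewrite eq_le y0 euclid_ge0.
  by rewrite K0; case: ifP => _ /=; rewrite powR0// gt_eqF.
have h2 : n%:R * unit_vol n * `|f x| <= e `^ p^-1 * k `^ q^-1.
  rewrite -lee_fin; apply: le_trans (fG x) _; apply: le_trans h1.
  rewrite le_eqVlt; apply/orP; left; apply/eqP; apply: eq_integral => y _.
  rewrite /b; case: ifPn => // yD.
  have [->|Gy] := eqVneq (G y) 0; first by rewrite !mul0r.
  by rewrite GD in yD.
have : (n%:R * unit_vol n * `|f x|) `^ p <= (e `^ p^-1 * k `^ q^-1) `^ p.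
  apply: ge0_ler_powR => //; rewrite ?nnegrE; first exact: ltW.
    by rewrite mulr_ge0// ltW.
  by rewrite mulr_ge0// powR_ge0.
have pq : q^-1 * p = p - 1 by rewrite /q; field; rewrite !gt_eqF.
rewrite [X in X <= _]powRM ?(ltW nv0)// [X in _ <= X]powRM ?powR_ge0//.
rewrite -!powRrM mulVf ?gt_eqF// powRr1// pq.
have -> : k `^ (p - 1) = (n%:R * unit_vol n) `^ (p - 1) * c.
  rewrite /k (@powRM _ _ (D `^ m / m) _ (ltW nv0)); last first.
    by rewrite divr_ge0 ?powR_ge0 ?ltW.
  congr (_ * _); rewrite powRM ?powR_ge0 ?invr_ge0 ?(ltW m0)// /c mulrC -powRrM; congr (_ * _).
    by rewrite /m invf_div.
  by congr (_ `^ _); rewrite /m; field; rewrite gt_eqF.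
rewrite -[X in X * _ <= _](mulr_powRB1 (ltW nv0) p0).
set w := n%:R * unit_vol n; set wp := w `^ _ => h.
have wp0 : 0 < wp by rewrite powR_gt0.
rewrite -(ler_pM2l wp0) (_ : wp * (w * _) = w * wp * `|f x| `^ p); last by ring.
by rewrite (_ : wp * (c * e) = e * (wp * c)); last by ring.
Qed.

(* [A F delta^(-(n-p)/p)] bounds the part of the potential at distance at least
   [delta]; the contribution of [G <= s] to the rest is at most [s delta]. *)
Lemma weak_type_bound (p F eta delta t s : R) : 1 < p < n%:R -> 0 < F ->
  0 < eta < 1 -> 0 < t -> 0 < delta -> s * delta = eta * t / 2 ->
  (\int[lebesgue_rV n]_y (G y `^ p)%:E <= (F `^ p)%:E)%E ->
  F * (n%:R * unit_vol n * (delta `^ (- ((n%:R - p) / (p - 1))) /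
     ((n%:R - p) / (p - 1)))) `^ ((p - 1) / p) <= n%:R * unit_vol n * ((1 - eta) * t) ->
  (\int[lebesgue_rV n]_x (if (t < `|f x|)%R then 1 else 0) <=
   s^-1%:E * \int[lebesgue_rV n]_y (if (s < G y)%R then (G y)%:E else 0))%E.
Proof.
move=> /andP[p1 pn] F0 /andP[eta0 eta1] t0 d0 sd GF dt.
have s0 : 0 < s by rewrite -(pmulr_lgt0 _ d0) sd divr_gt0 ?mulr_gt0.
have p0 : 0 < p by exact: lt_trans p1.
have p10 : 0 < p - 1 by rewrite subr_gt0.
set w := n%:R * unit_vol n in dt *.
pose a := (n%:R - p) / (p - 1).
have a0 : 0 < a by rewrite divr_gt0// subr_gt0.
pose q := p / (p - 1).
have q0 : 0 < q by rewrite divr_gt0.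
have qE : q^-1 = (p - 1) / p by rewrite /q invf_div.
have mE : n%:R + (1 - n%:R) * q = - a by rewrite /a /q; field; rewrite gt_eqF.
pose k := w * (delta `^ (- a) / a).
have k0 : 0 < k by rewrite mulr_gt0// divr_gt0// powR_gt0.
pose far (x y : 'rV[R]_n) := if delta <= euclid (y - x) then K (y - x) else 0.
pose near (x y : 'rV[R]_n) := if euclid (y - x) < delta then K (y - x) else 0.
have far0 x y : 0 <= far x y by rewrite /far; case: ifP => // _; exact: powR_ge0.
have near0 x y : 0 <= near x y by rewrite /near; case: ifP => // _; exact: powR_ge0.
have mfar x : measurable_fun setT (far x).
  exact: (measurable_fun_ifT (measurable_fun_ler (measurable_cst delta) (mex x)) (mKx x)
    (measurable_cst _)).
have mnear x : measurable_fun setT (near x).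
  exact: (measurable_fun_ifT (measurable_fun_ltr (mex x) (measurable_cst delta)) (mKx x)
    (measurable_cst _)).
have farE x : (\int[lebesgue_rV n]_y (G y * far x y)%:E <=
    (w * ((1 - eta) * t))%:E)%E.
  apply: (@le_trans _ _ (F * k `^ q^-1)%:E); last by rewrite lee_fin qE.
  apply: (hoelder_bound mG (mfar x) _ _ p0 q0) => //.
  - by rewrite qE; field; rewrite gt_eqF.
  - exact: ltW.
  - exact: powR_ge0.
  rewrite -powRrM mulVf ?gt_eqF// powRr1 ?(ltW k0)//.
  have an0 : n%:R + (1 - n%:R) * q < 0 by rewrite mE oppr_lt0.
  have := kernel_tail n0 d0 an0; rewrite mE opprK -/w -/k => <-.
  pose B (y : 'rV[R]_n) := (if (delta <= euclid y)%R
    then (euclid y `^ ((1 - n%:R) * q))%:E else 0)%E.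
  have mB : measurable_fun setT B by rewrite /B; mfun.
  rewrite -/(B _) -[leRHS](ge0_integral_rV_shift (- x) mB); last first.
    by move=> y; rewrite /B; case: ifP => // _; rewrite lee_fin powR_ge0.
  rewrite le_eqVlt; apply/orP; left; apply/eqP; apply: eq_integral => y _.
  rewrite /far /B /K; case: ifP => _; first by rewrite -powRrM.
  by rewrite powR0// gt_eqF.
have nearE y : (\int[lebesgue_rV n]_x (near x y)%:E = (w * delta)%:E)%E.
  have n10 : 0 < n%:R + (1 - n%:R) :> R by rewrite addrC subrK.
  have := kernel_head n0 d0 n10.
  rewrite (_ : n%:R + (1 - n%:R) = 1 :> R); last by ring.
  rewrite powRr1 ?(ltW d0)// divr1 => <-.
  pose B (y : 'rV[R]_n) := (if (0 < euclid y < delta)%R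
    then (euclid y `^ (1 - n%:R))%:E else 0)%E.
  have mB : measurable_fun setT B by rewrite /B; mfun.
  rewrite -/(B _) -[RHS](ge0_integral_rV_shift (- y) mB); last first.
    by move=> x; rewrite /B; case: ifP => // _; rewrite lee_fin powR_ge0.
  apply: eq_integral => x _; rewrite /near /B /K -(euclidN (y - x)) opprB.
  have [|y0] := ltP 0 (euclid (x - y)); first by case: ifP.
  have -> : euclid (x - y) = 0 by apply/eqP; rewrite eq_le y0 euclid_ge0.
  by rewrite K0; case: ifP.
pose Gs y := if s < G y then G y else 0.
have Gs0 y : 0 <= Gs y by rewrite /Gs; case: ifP.
have mGs : measurable_fun setT Gs by rewrite /Gs; mfun.
have Gle y : G y <= s + Gs y.
  by rewrite /Gs; case: ltP => [_|]; rewrite ?addr0// ler_wpDl// ltW.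
pose T x := (\int[lebesgue_rV n]_y (Gs y * near x y)%:E)%E.
have mnear2 : measurable_fun setT (fun z : 'rV[R]_n * 'rV[R]_n => near z.1 z.2).
  have msub : measurable_fun setT (fun z : 'rV[R]_n * 'rV[R]_n => z.2 - z.1).
    apply: measurable_fun_rVP => i; rewrite /comp/rV_coord.
    under eq_fun do rewrite !mxE.
    apply: measurable_funB.
      by apply: (measurableT_comp (measurable_rV_coord i)); exact: measurable_snd.
    by apply: (measurableT_comp (measurable_rV_coord i)); exact: measurable_fst.
  by rewrite /near; mfun; apply: (measurableT_comp mK).
have mT2 : measurable_fun setT
    (fun z : 'rV[R]_n * 'rV[R]_n => (Gs z.2 * near z.1 z.2)%:E).
  by mfun; apply: (measurableT_comp mGs); exact: measurable_snd.
have T20 x y : (0 <= (Gs y * near x y)%:E)%E by rewrite lee_fin mulr_ge0.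
have mT : measurable_fun setT T.
  exact: (@measurable_integral_snd _ _ _ _ _ (lebesgue_rV n) (fun x y => (Gs y * near x y)%:E)).
have T0 x : (0 <= T x)%E by apply: integral_ge0 => y _; exact: T20.
have w0 : 0 < w by [].
have mnearE x : measurable_fun setT (fun y => (near x y)%:E).
  by apply/measurable_EFinP; exact: (mnear x).
have mGfar x : measurable_fun setT (fun y => (G y * far x y)%:E).
  by apply/measurable_EFinP; exact: (measurable_funM mG (mfar x)).
have mGnear x : measurable_fun setT (fun y => (G y * near x y)%:E).
  by apply/measurable_EFinP; exact: (measurable_funM mG (mnear x)).
have mGsnear x : measurable_fun setT (fun y => (Gs y * near x y)%:E).
  by apply/measurable_EFinP; exact: (measurable_funM mGs (mnear x)).
(* Out of more than w t, the far part takes at most w (1 - eta) t and the part of [G] below [s] at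
   most s w delta, which is w eta t / 2. At least as much, w s delta, is left for [T x]. *)
have TE x : t < `|f x| -> ((w * (s * delta))%:E <= T x)%E.
  move=> tf; have h : ((w * `|f x|)%:E <= (w * ((1 - eta) * t))%:E +
      (s%:E * (w * delta)%:E + T x))%E.
    apply: le_trans (fG x) _.
    rewrite (eq_integral (fun y => (G y * far x y)%:E + (G y * near x y)%:E)%E); last first.
      move=> y _; rewrite -EFinD -mulrDr; congr (_ * _)%:E.
      by rewrite /far /near; case: leP; rewrite ?addr0 ?add0r.
    rewrite ge0_integralD//; last 2 first.
    - by move=> y _; rewrite lee_fin mulr_ge0.
    - by move=> y _; rewrite lee_fin mulr_ge0.
    apply: leeD => //.
    have -> : (w * delta)%:E = (\int[lebesgue_rV n]_y (near x y)%:E)%E.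
      rewrite -(nearE x); apply: eq_integral => y _.
      by rewrite /near /K -(euclidN (y - x)) opprB.
    rewrite -ge0_integralZl//; last 2 first.
    - by move=> y _; rewrite lee_fin.
    - by rewrite lee_fin ltW.
    rewrite -ge0_integralD//; last 2 first.
    - by move=> y _; rewrite -EFinM lee_fin mulr_ge0// ltW.
    - exact: (emeasurable_funM (measurable_cst _) (mnearE x)).
    apply: ge0_le_integral => //.
    - by move=> y _; rewrite lee_fin mulr_ge0.
    - exact: (emeasurable_funD (emeasurable_funM (measurable_cst _) (mnearE x)) (mGsnear x)).
    by move=> y _; rewrite -EFinM -EFinD lee_fin -mulrDl ler_wpM2r.
  move: h (T0 x); case: (T x) => [r| |]//; last by move=> _ _; rewrite leey.
  rewrite -EFinM -!EFinD !lee_fin => h _.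
  have := ltr_pM2l w0 t `|f x|; rewrite tf => wt.
  have e1 : s * (w * delta) = w * (s * delta) by ring.
  have e2 : w * ((1 - eta) * t) = w * t - 2 * (w * (s * delta)) by rewrite sd; field.
  rewrite e1 e2 in h; lra.
have wd0 : 0 < w * delta by rewrite mulr_gt0.
rewrite lee_pdivlMl// -(@lee_pmul2l _ (w * delta)%:E) ?lte_fin//.
(* By Tonelli, each [y] contributes [Gs y] times the mass w delta of the near kernel. Chebyshev's
   inequality for [T] at height w s delta then concludes. *)
have -> : ((w * delta)%:E * \int[lebesgue_rV n]_y (if (s < G y)%R then (G y)%:E else 0) =
    \int[lebesgue_rV n]_x T x)%E.
  rewrite tonelli_swap// -ge0_integralZl//; last 3 first.
  - by mfun.
  - by move=> y _; case: ifP => // _; rewrite lee_fin.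
  - by rewrite lee_fin ltW.
  apply: eq_integral => y _; rewrite -(nearE y) muleC.
  rewrite (_ : (if _ then _ else _) = (Gs y)%:E); last by rewrite /Gs; case: ifP.
  rewrite -ge0_integralZl//; last first.
  - by rewrite lee_fin.
  - by move=> x _; rewrite lee_fin.
  - by apply/measurable_EFinP; exact: (measurable_fun_pair1 y mnear2).
rewrite muleA -EFinM -ge0_integralZl//; last 3 first.
- by mfun; apply: (measurableT_comp (@normr_measurable R setT)).
- by move=> x _; case: ifP.
- by rewrite lee_fin mulr_ge0 ?ltW.
apply: ge0_le_integral => //.
- move=> x _; apply: mule_ge0; last by case: ifP.
  by rewrite lee_fin ltW// mulr_gt0.
- by mfun; apply: (measurableT_comp (@normr_measurable R setT)).
move=> x _; case: ifPn => [/TE|_]; last by rewrite mule0.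
by rewrite mule1 (_ : w * delta * s = w * (s * delta)); last by ring.
Qed.

(** The weak-type bound is used at every level t with its own delta, so that the height s(t) = c
    t^b, b = n/(n-p), depends on t. Multiplying by q t^(q-1), q = np/(n-p), and integrating over t,
    the levels with s(t) < G y give q/(q-b) c^(-p) (G y)^p for each [y], and q/(q-b) = p/(p-1). *)
Lemma hedberg_bound (p F eta c : R) : 1 < p < n%:R -> 0 < F -> 0 < eta < 1 ->
  (\int[lebesgue_rV n]_y (G y `^ p)%:E <= (F `^ p)%:E)%E ->
  c = eta / 2 * ((1 - eta) / (far_norm n p * F)) `^ (p / (n%:R - p)) ->
  (\int[lebesgue_rV n]_x (`|f x| `^ (n%:R * p / (n%:R - p)))%:E <=
   (p / (p - 1) * c `^ (- p) * F `^ p)%:E)%E.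
Proof.
move=> /andP[p1 pn] F0 /andP[eta0 eta1] GF; set A := far_norm n p => cE.
have p0 : 0 < p by exact: lt_trans p1.
have p10 : 0 < p - 1 by rewrite subr_gt0.
have np0 : 0 < n%:R - p by rewrite subr_gt0.
have w0 : 0 < n%:R * unit_vol n :> R by [].
set w := n%:R * unit_vol n in w0 *.
have wE0 : n%:R * unit_vol n = w by [].
have A0 : 0 < A by rewrite /A/far_norm mulr_gt0// powR_gt0// divr_gt0.
have AE0 : A = w `^ (- p^-1) * ((p - 1) / (n%:R - p)) `^ ((p - 1) / p) by [].
clearbody A w.
have E0 : 0 < 1 - eta by rewrite subr_gt0.
have c0 : 0 < c by rewrite cE mulr_gt0 ?divr_gt0// powR_gt0// divr_gt0// mulr_gt0.
pose b := n%:R / (n%:R - p).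
have b0 : 0 < b by rewrite divr_gt0.
pose q := n%:R * p / (n%:R - p).
have q0 : 0 < q by rewrite divr_gt0// mulr_gt0.
pose s (t : R) := c * t `^ b.
pose r := p / (n%:R - p).
pose a := (n%:R - p) / (p - 1).
have a0 : 0 < a by rewrite divr_gt0.
have aE : a = (n%:R - p) / (p - 1) by [].
clearbody a.
have Ab t : 0 < t -> (\int[lebesgue_rV n]_x (if (t < `|f x|)%R then 1 else 0) <=
   (s t)^-1%:E * \int[lebesgue_rV n]_y (if (s t < G y)%R then (G y)%:E else 0))%E.
  move=> t0.
  (* The value for which the bound A F delta^(-(n-p)/p) on the far part is exactly (1 - eta) t. The
     constant [c] is then forced by s(t) delta = eta t / 2. *)
  pose delta := ((A * F) / ((1 - eta) * t)) `^ (p / (n%:R - p)).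
  have AF0 : 0 < (A * F) / ((1 - eta) * t) by exact: divr_gt0 (mulr_gt0 A0 F0) (mulr_gt0 E0 t0).
  have d0 : 0 < delta by rewrite powR_gt0.
  apply: (@weak_type_bound p F eta delta t (s t)) => //.
  - by rewrite p1.
  - by rewrite eta0.
  - rewrite /s /delta cE.
    have -> : t `^ b = t * t `^ r.
      by rewrite -[X in X * _]powRr1 ?(ltW t0)// -powR_posD//; congr (_ `^ _); rewrite /b /r; field; rewrite gt_eqF.
    have e1 : ((1 - eta) / (A * F)) `^ r * t `^ r * (A * F / ((1 - eta) * t)) `^ r = 1.
      rewrite -!powRM ?mulr_ge0 ?invr_ge0 ?mulr_ge0 ?(ltW A0) ?(ltW F0) ?(ltW E0) ?(ltW t0)//.
      by rewrite (_ : _ / _ * _ * _ = 1) ?powR1//; field; rewrite !gt_eqF.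
    by rewrite -/r -[RHS]mulr1 -[X in _ = _ * X]e1; field.
  - rewrite wE0 -aE.
    have -> : delta `^ (- a) = (A * F / ((1 - eta) * t)) `^ (- (p / (p - 1))).
      by rewrite /delta -powRrM; congr (_ `^ _); rewrite aE; field; rewrite !gt_eqF.
    set X := A * F / _.
    rewrite [(w * _) `^ _]powRM ?(ltW w0) ?divr_ge0 ?powR_ge0 ?(ltW a0)//.
    rewrite [(_ / a) `^ _]powRM ?powR_ge0 ?invr_ge0 ?(ltW a0)// -powRrM.
    rewrite (_ : - (p / (p - 1)) * ((p - 1) / p) = -1); last by field; rewrite !gt_eqF.
    rewrite powR_inv1 ?(ltW AF0)//.
    have AE : A = w `^ (- p^-1) * a^-1 `^ ((p - 1) / p) by rewrite AE0 aE invf_div.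
    have wE : w = w `^ ((p - 1) / p) / w `^ (- p^-1).
      rewrite -powR_posB// (_ : _ - _ = 1) ?powRr1 ?(ltW w0)//; field; rewrite gt_eqF//.
    rewrite le_eqVlt; apply/orP; left; apply/eqP; rewrite [in RHS]wE /X AE; field.
    by rewrite !gt_eqF ?powR_gt0 ?invr_gt0.
pose si (t : R) := c^-1 * t `^ (- b).
have siE t : (s t)^-1 = si t by rewrite /s /si invfM powRN.
(* Layer-cake integrands: [H] integrates in t to |f x|^q, and [J] is the right side of the weak-type
   bound with the same weight q t^(q-1). *)
pose H (t : measurableTypeR R) (x : 'rV[R]_n) : \bar R :=
  (if (0 < t)%R && (t < `|f x|)%R then (q * t `^ (q - 1))%:E else 0)%E.
have mH : measurable_fun setT (fun z => H z.1 z.2).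
  by rewrite /H; mfun; apply: (measurableT_comp mf); exact: measurable_snd.
have H0 t x : (0 <= H t x)%E.
  by rewrite /H; case: ifP => // _; rewrite lee_fin mulr_ge0 ?powR_ge0// ltW.
pose J (t : measurableTypeR R) (y : 'rV[R]_n) : \bar R :=
  (if (0 < t)%R && (s t < G y)%R then (q * t `^ (q - 1) * si t * G y)%:E else 0)%E.
have ms : measurable_fun setT s by rewrite /s; mfun.
have mJ : measurable_fun setT (fun z => J z.1 z.2).
  rewrite /J /si; mfun; try by apply: (measurableT_comp mG); exact: measurable_snd.
  by apply: (measurableT_comp ms); exact: measurable_fst.
have J0 t x : (0 <= J t x)%E.
  rewrite /J -siE; case: ifP => // /andP[t0 _].
  by rewrite lee_fin mulr_ge0// divr_ge0// mulr_ge0 ?powR_ge0 ?(ltW c0) ?(ltW q0).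
have qE x : (\int[lebesgue_measure]_t H t x)%E = (`|f x| `^ q)%:E.
  have [f0|f0] := eqVneq (f x) 0.
    rewrite f0 normr0 powR0 ?gt_eqF// integral0_eq// => t _; rewrite /H f0 normr0.
    by case: ifP => // /andP[t0 t1]; have := lt_trans t0 t1; rewrite ltxx.
  have fx0 : 0 < `|f x| by rewrite normr_gt0.
  have -> : (`|f x| `^ q)%:E = (q%:E * (`|f x| `^ q / q)%:E)%E.
    by rewrite -EFinM mulrCA divff ?mulr1// gt_eqF.
  rewrite -integral_powR_head// -ge0_integralZl//; last 3 first.
  - by mfun.
  - by move=> t _; case: ifP => // _; rewrite lee_fin powR_ge0.
  - by rewrite lee_fin ltW.
  by apply: eq_integral => t _; rewrite /H; case: ifP; rewrite ?mule0 ?EFinM.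
have JE y : (\int[lebesgue_measure]_t J t y)%E = (p / (p - 1) * c `^ (- p) * G y `^ p)%:E.
  have [Gy0|Gy0] := eqVneq (G y) 0.
    rewrite Gy0 powR0 ?gt_eqF// mulr0 integral0_eq// => t _.
    by rewrite /J Gy0 mulr0; case: ifP.
  have Gy : 0 < G y by rewrite lt_def Gy0 G0.
  (* The level at which s(tau) = G y; below it [y] contributes, above it does not. *)
  pose tau := (G y / c) `^ b^-1.
  have Gc0 : 0 < G y / c by rewrite divr_gt0.
  have tau0 : 0 < tau by rewrite powR_gt0.
  have stau t : 0 < t -> (s t < G y) = (t < tau).
    move=> t0; rewrite /s mulrC -ltr_pdivlMr//.
    have -> : G y / c = tau `^ b by rewrite /tau -powRrM mulVf ?gt_eqF// powRr1// ltW.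
    apply/idP/idP => h; last by apply: gt0_ltr_powR; rewrite ?nnegrE ?ltW.
    rewrite ltNge; apply/negP => h1; move: h; apply/negP; rewrite -leNgt.
    by apply: ge0_ler_powR => //; rewrite ?nnegrE ltW.
  have qbE : q - b = b * (p - 1) by rewrite /q /b; field; rewrite gt_eqF.
  have qb0 : 0 < q - b by rewrite qbE mulr_gt0.
  transitivity ((q / c * G y)%:E * (tau `^ (q - b) / (q - b))%:E)%E.
    rewrite -integral_powR_head// -ge0_integralZl//; last 3 first.
    - by mfun.
    - by move=> t _; case: ifP => // _; rewrite lee_fin powR_ge0.
    - by rewrite lee_fin mulr_ge0// divr_ge0// ltW.
    apply: eq_integral => t _; rewrite /J; have [t0|] := ltP 0 t; last by rewrite mule0.
    rewrite stau//=; case: ifP => _; rewrite ?mule0// -EFinM; congr EFin.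
    rewrite (_ : q - b - 1 = (q - 1) - b); last by ring.
    rewrite [X in _ = _ * X]powR_posB// /si powRN; ring.
  rewrite -EFinM; congr EFin.
  rewrite /tau -powRrM (_ : b^-1 * (q - b) = p - 1); last first.
    by rewrite /q /b; field; rewrite !gt_eqF.
  rewrite powRM ?invr_ge0 ?(ltW c0)//.
  rewrite -(mulr_powRB1 (ltW Gy) p0) powRN -(mulr_powRB1 (ltW c0) p0).
  have -> : c^-1 `^ (p - 1) = (c `^ (p - 1))^-1.
    by rewrite -powR_inv1 ?(ltW c0)// -powRrM mulN1r powRN.
  have -> : q - b = q * (p - 1) / p by rewrite /q /b; field; rewrite !gt_eqF.
  field; rewrite !gt_eqF ?powR_gt0//.
have pp0 : 0 <= p / (p - 1) * c `^ (- p).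
  by rewrite mulr_ge0 ?powR_ge0// divr_ge0// ltW.
apply: (@le_trans _ _ ((p / (p - 1) * c `^ (- p))%:E * \int[lebesgue_rV n]_y (G y `^ p)%:E)%E);
  last by rewrite [leRHS]EFinM lee_wpmul2l// lee_fin.
rewrite -ge0_integralZl//; last 2 first.
- by mfun.
- by move=> y _; rewrite lee_fin powR_ge0.
rewrite [leLHS](eq_integral (fun x => \int[lebesgue_measure]_t H t x)%E) => [|x _]; last exact/esym/qE.
rewrite [leRHS](eq_integral (fun y => \int[lebesgue_measure]_t J t y)%E) => [|y _]; last by rewrite JE EFinM.
rewrite -(tonelli_swap _ _ mH)// -(tonelli_swap _ _ mJ)//.
apply: ge0_le_integral => //.
- by move=> t _; apply: integral_ge0 => x _; exact: H0.
- exact: measurable_integral_snd.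
- exact: measurable_integral_snd.
move=> t _; have [t0|t0] := ltP 0 t; last first.
  rewrite integral0_eq; first by apply: integral_ge0 => y _; exact: J0.
  by move=> x _; rewrite /H; case: ifP => // /andP[t1]; have := lt_le_trans t1 t0; rewrite ltxx.
have st0 : 0 < s t by rewrite mulr_gt0// powR_gt0.
have qt0 : 0 <= q * t `^ (q - 1) by rewrite mulr_ge0 ?powR_ge0// ltW.
have -> : (\int[lebesgue_rV n]_x H t x = (q * t `^ (q - 1))%:E *
    \int[lebesgue_rV n]_x (if (t < `|f x|)%R then 1 else 0))%E.
  rewrite -ge0_integralZl//; last 2 first.
  - by mfun.
  - by move=> x _; case: ifP.
  by apply: eq_integral => x _; rewrite /H t0/=; case: ifP; rewrite ?mule1 ?mule0.
have -> : (\int[lebesgue_rV n]_x J t x = (q * t `^ (q - 1))%:E * ((s t)^-1%:E *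
    \int[lebesgue_rV n]_y (if (s t < G y)%R then (G y)%:E else 0)))%E.
  rewrite muleA -EFinM -ge0_integralZl//; last 3 first.
  - by mfun.
  - by move=> y _; case: ifP => // _; rewrite lee_fin.
  - by rewrite lee_fin divr_ge0// ltW.
  by apply: eq_integral => x _; rewrite /J t0/= -siE; case: ifP => _; rewrite ?mule0// -EFinM.
by rewrite lee_wpmul2l ?lee_fin ?Ab.
Qed.
End potential.
(** * Smooth bumps *)

Section derive_dir.
Context {R : realType} {V : normedModType R}.
Implicit Types (f g : V -> R) (x v : V).

(** Through this equivalence the product and chain rules for directional derivatives follow from
    those of one real variable. *)
Lemma is_derive_at_line f x v (d : R) :
  is_derive x v f d <-> is_derive (0 : R) (1 : R) (fun s : R => f (s *: v + x)) d.
Proof.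
by have := is_derive_line f x v 0 d; rewrite scale0r add0r.
Qed.

Lemma is_derive_dirM f g x v (a b : R) : is_derive x v f a -> is_derive x v g b ->
  is_derive x v (fun y => f y * g y) (a * g x + f x * b).
Proof.
move=> /is_derive_at_line fa /is_derive_at_line gb.
apply: (is_derive_at_line _ _ _ _).2.
have := is_deriveM fa gb; rewrite !scale0r !add0r => h.
by apply: is_derive_eq h _; rewrite addrC -[g x *: a]/(g x * a) mulrC.
Qed.

Lemma is_derive_dir_comp (F : R -> R) g x v (a b : R) :
  is_derive x v g a -> is_derive (g x) (1 : R) F b ->
  is_derive x v (fun y => F (g y)) (b * a).
Proof.
move=> /is_derive_at_line ga Fb; apply: (is_derive_at_line _ _ _ _).2.
have Fb' : is_derive (g (0 *: v + x)) (1 : R) F b by rewrite scale0r add0r.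
exact: is_derive1_comp Fb' ga.
Qed.

End derive_dir.

Section Ck_closure.
Context {R : realType} {n : nat}.
Implicit Types (f g : 'rV[R]_n -> R).

Lemma Ck_intro k f (d : 'I_n -> 'rV[R]_n -> R) : continuous f ->
  (forall i x, is_derive x (delta_mx 0 i) f (d i x)) ->
  (forall i, Ck k (d i)) -> Ck k.+1 f.
Proof.
move=> cf fd Cd; split => // i; split=> [x|]; first by have [] := fd i x.
rewrite (_ : partial i f = d i)//; apply/funext => x.
by have [_] := fd i x.
Qed.

Lemma Ck_pred k f : Ck k.+1 f -> Ck k f.
Proof.
elim: k f => [|k IH] f [cf Cf]; split => // i; split; first exact: (Cf i).1.
exact/IH/(Cf i).2.
Qed.

Lemma Ck_derive k f i x : Ck k.+1 f -> is_derive x (delta_mx 0 i) f (partial i f x).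
Proof. by move=> [_ /(_ i)[df _]]; exact: derivableP. Qed.

Lemma Ck_cst k (c : R) : Ck k (fun _ : 'rV[R]_n => c).
Proof.
elim: k c => [|k IH] c; first by split => //; exact: cst_continuous.
apply: (@Ck_intro _ _ (fun _ _ => 0)).
- exact: cst_continuous.
- by move=> i; exact: IH.
Qed.

Lemma CkD k f g : Ck k f -> Ck k g -> Ck k (fun x => f x + g x).
Proof.
elim: k f g => [|k IH] f g Cf Cg.
  by split => // x; exact: cvgD (Cf.1 x) (Cg.1 x).
apply: (@Ck_intro _ _ (fun i x => partial i f x + partial i g x)).
- by move=> x; exact: cvgD (Cf.1 x) (Cg.1 x).
- by move=> i x; exact: (is_deriveD (Ck_derive i x Cf) (Ck_derive i x Cg)).
- by move=> i; apply: IH; [exact: (Cf.2 i).2|exact: (Cg.2 i).2].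
Qed.

Lemma CkM k f g : Ck k f -> Ck k g -> Ck k (fun x => f x * g x).
Proof.
elim: k f g => [|k IH] f g Cf Cg.
  by split => // x; exact: cvgM (Cf.1 x) (Cg.1 x).
apply: (@Ck_intro _ _ (fun i x => partial i f x * g x + f x * partial i g x)).
- by move=> x; exact: cvgM (Cf.1 x) (Cg.1 x).
- by move=> i x; exact: (is_derive_dirM (Ck_derive i x Cf) (Ck_derive i x Cg)).
- move=> i; apply: CkD; apply: IH.
  + exact: (Cf.2 i).2.
  + exact: Ck_pred.
  + exact: Ck_pred.
  + exact: (Cg.2 i).2.
Qed.

Lemma is_derive_coord (x : 'rV[R]_n) i j :
  is_derive x (delta_mx 0 j) (fun y : 'rV[R]_n => y 0 i) (i == j)%:R.
Proof.
apply: (is_derive_at_line _ _ _ _).2.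
rewrite (_ : (fun s : R => _) = (fun s : R => ((i == j)%:R : R) *: s + x 0 i)); last first.
  by apply/funext => s; rewrite !mxE eqxx/= mulrC.
have := @is_deriveD _ _ _ _ _ _ _ _ _
  (@is_deriveZ R R R id ((i == j)%:R) 0 1 1 _) (@is_derive_cst R R R (x 0 i) 0 1).
by move=> /(_ (is_derive_id _ _)) h; apply: is_derive_eq h _; rewrite addr0 -[_%:A]/(_ * 1) mulr1.
Qed.

Lemma Ck_sum k m (f : 'I_m -> 'rV[R]_n -> R) : (forall i, Ck k (f i)) ->
  Ck k (fun x => \sum_i f i x).
Proof.
move=> Cf; rewrite (_ : (fun x => _) = \sum_i f i); last first.
  by apply/funext => x; rewrite fct_sumE.
apply: (big_ind (Ck k)); [exact: Ck_cst|by move=> *; exact: CkD|by []].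
Qed.

Lemma Ck_coord k i : Ck k (fun x : 'rV[R]_n => x 0 i).
Proof.
have c : continuous (fun x : 'rV[R]_n => x 0 i) by exact: coord_continuous.
case: k => [|k]; first by split.
apply: (@Ck_intro _ _ (fun j _ => (i == j)%:R)).
- exact: c.
- by move=> j x; exact: is_derive_coord.
- by move=> j; exact: Ck_cst.
Qed.

(** Carrying all successive derivatives of [F 0] as data lets [Ck_comp] go by induction on [k] with
    [j] arbitrary: each partial derivative of [F j] o g is [F j.+1] o g times a partial derivative
    of g. The set [D] is needed for real powers, differentiated on t > 0 only. *)
Definition derivative_tower (D : set R) (F : nat -> R -> R) :=
  forall j (t : R), D t -> is_derive t (1 : R) (F j) (F j.+1 t).

Lemma Ck_comp k D (F : nat -> R -> R) j g : derivative_tower D F ->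
  (forall x, D (g x)) -> Cinfty g -> Ck k (fun x => F j (g x)).
Proof.
move=> sF Dg Cg; have cF i t : D t -> {for t, continuous (F i)}.
  by move=> Dt; have [/derivable1_diffP/differentiable_continuous] := sF i t Dt.
have c i : continuous (fun x => F i (g x)).
  by move=> x; apply: continuous_comp; [exact: ((Cg 0%N).1 x)|exact: cF].
elim: k j => [|k IH] j; first by split => // x; exact: c.
apply: (@Ck_intro _ _ (fun i x => F j.+1 (g x) * partial i g x)).
- by move=> x; exact: c.
- by move=> i x; exact: (is_derive_dir_comp (Ck_derive i x (Cg 1%N)) (sF j (g x) (Dg x))).
- by move=> i; apply: CkM; [exact: IH|exact: ((Cg k.+1).2 i).2].
Qed.

End Ck_closure.

(** * A smooth approximation of the positive part *)

Section flat_function.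
Context {R : realType}.
Implicit Types P : {poly R}.

(** A class closed under differentiation: the derivative of P(1/t) exp(-1/t) has the same form, with
    X^2 (P - P') in place of P. Smoothness at 0 thus reduces to a single first-order statement valid
    for every [P]. *)
Definition flat P (t : R) : R := if 0 < t then P.[t^-1] * expR (- t^-1) else 0.

Lemma flat_le0 P (t : R) : t <= 0 -> flat P t = 0.
Proof. by move=> t0; rewrite /flat ltNge t0. Qed.

Lemma flat_deriv_pos P (t : R) : 0 < t ->
  is_derive t (1 : R) (flat P) (flat ('X^2 * (P - P^`())) t).
Proof.
move=> t0.
have dV : is_derive t (1 : R) (fun x : R => x^-1) (- t ^- 2).
  have := @is_deriveV R id t 1 1 (lt0r_neq0 t0) (is_derive_id _ _).
  by rewrite -[_%:A]/(_ * 1) mulr1.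
have dP : is_derive (t^-1) (1 : R) (horner P) (P^`()).[t^-1].
  split; first exact: derivable_horner.
  by rewrite -derive1E -derivE.
have dE : is_derive t (1 : R) (fun x : R => expR (- x^-1)) (expR (- t^-1) * (t ^- 2)).
  have dN : is_derive t (1 : R) (fun x : R => - x^-1) (t ^- 2).
    by have := is_deriveN dV; rewrite opprK.
  exact: (@is_derive1_comp R expR (fun x : R => - x^-1) t _ _ (is_derive_expR _) dN).
have dPc := @is_derive1_comp R (horner P) (fun x : R => x^-1) t _ _ dP dV.
have := is_derive_dirM dPc dE => h.
apply: near_eq_is_derive (is_derive_eq h _).
  near=> s; have s0 : 0 < s by near: s; exact: lt_nbhsr.
  by rewrite /flat s0.
rewrite /flat t0 !hornerE/= !exprVn; ring.
Unshelve. all: end_near. Qed.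

(** Quadratic decay makes the derivative at 0 exist and vanish. With x = 1/s >= 1, |P(x)| is at most
    a multiple of x^(size P), while exp x >= x^m / m!; m = size P + 2 leaves the factor x^(-2) =
    s^2. *)
Lemma flat_bound P :
  exists C, 0 <= C /\ forall s, 0 < s < 1 -> `|flat P s| <= C * s ^+ 2.
Proof.
pose S := \sum_(i < size P) `|P`_i|.
pose m := (size P).+2.
exists (S * m`!%:R); split; first by rewrite mulr_ge0// sumr_ge0.
move=> s /andP[s0 s1]; rewrite /flat s0 normrM (gtr0_norm (expR_gt0 _)).
set x := s^-1; have x0 : 0 < x by rewrite invr_gt0.
have x1 : 1 <= x by rewrite invf_ge1// ltW.
have Px : `|P.[x]| <= S * x ^+ size P.
  rewrite horner_coef /S mulr_suml (le_trans (ler_norm_sum _ _ _))//.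
  apply: ler_sum => i _; rewrite normrM ler_wpM2l// ger0_norm; last first.
    by rewrite exprn_ge0// ltW.
  by rewrite ler_weXn2l// ltnW.
have ex : x ^+ m <= m`!%:R * expR x.
  have := expR_ge1Dxn (size P).+1 (ltW x0); rewrite -/m => h.
  rewrite mulrC -ler_pdivrMr ?ltr0n ?fact_gt0//.
  by apply: le_trans h; rewrite lerDr.
have S0 : 0 <= S by rewrite sumr_ge0.
rewrite (@le_trans _ _ (S * x ^+ size P * expR (- x)))// ?ler_wpM2r ?expR_ge0//.
rewrite -!mulrA ler_wpM2l//.
rewrite expRN ler_pdivrMr ?expR_gt0//.
rewrite -(@ler_pM2r _ (x ^+ 2)) ?exprn_gt0// -exprD addn2.
rewrite (_ : m`!%:R * s ^+ 2 * expR x * x ^+ 2 = m`!%:R * expR x)//.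
by rewrite /x exprVn; field; rewrite gt_eqF.
Qed.

Lemma flat_deriv P (t : R) :
  is_derive t (1 : R) (flat P) (flat ('X^2 * (P - P^`())) t).
Proof.
have [t0|t0|t0] := ltgtP 0 t; first exact: flat_deriv_pos.
  rewrite [X in is_derive _ _ _ X]/flat ltNge (ltW t0)/=.
  apply: (near_eq_is_derive _ (is_derive_cst 0 t 1)).
  near=> s; have s0 : s < 0 by near: s; exact: lt_nbhsl.
  by rewrite /flat ltNge (ltW s0).
rewrite -t0 [X in is_derive _ _ _ X]/flat ltxx.
have q0 : (fun h : R => h^-1 *: ((flat P \o shift 0) (h *: 1) - flat P 0)) @ 0^' --> (0 : R).
  have [C [C0 PC]] := flat_bound P.
  apply/cvgr0Pnorm_lt => e e0; near=> h.
  have h0 : h != 0 by near: h; exact: nbhs_dnbhs_neq.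
  have hC : `|h| < e / (C + 1).
    near: h; apply: nbhs_dnbhs; apply/nbhs_ballP; exists (e / (C + 1)) => /=.
      by rewrite divr_gt0// ltr_wpDl.
    by move=> h; rewrite -ball_normE /ball_/= sub0r normrN.
  have h1 : `|h| < 1.
    near: h; apply: nbhs_dnbhs; apply/nbhs_ballP; exists 1 => //=.
    by move=> h; rewrite -ball_normE /ball_/= sub0r normrN.
  rewrite /= addr0 -[h *: 1]/(h * 1) mulr1 {2}/flat ltxx subr0 normrZ.
  have [hp|hn] := ltP 0 h; last first.
    by rewrite (flat_le0 P hn) normr0 mulr0.
  rewrite (@le_lt_trans _ _ (`|h^-1| * (C * h ^+ 2)))//.
    rewrite ler_wpM2l// PC// hp/=; move: h1; rewrite gtr0_norm//.
  rewrite gtr0_norm ?invr_gt0// mulrCA expr2 mulKf//.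
  move: hC; rewrite gtr0_norm// ltr_pdivlMr ?ltr_wpDl// => hC.
  by apply: le_lt_trans hC; rewrite mulrC ler_wpM2l// ?lerDl// ltW.
split; first by apply/cvg_ex; exists 0.
by apply/cvg_lim.
Unshelve. all: end_near. Qed.

Fixpoint ramp_poly (j : nat) : {poly R} :=
  if j is j'.+1 then 'X^2 * (ramp_poly j' - (ramp_poly j')^`()) else 1 + 'X.

(* The smooth approximation [t * exp (- 1/t)] of the positive part of [t]; its
   derivative on [t > 0] is [(1 + 1/t) * exp (- 1/t)], in [0, 1]. *)
Definition ramp (j : nat) (t : R) : R :=
  if j is j'.+1 then flat (ramp_poly j') t else t * flat 1 t.

Lemma ramp_tower : derivative_tower setT ramp.
Proof.
case=> [|j] t _; last exact: flat_deriv.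
have h := is_derive_dirM (is_derive_id t (1 : R)) (flat_deriv 1 t).
apply: is_derive_eq h _; rewrite /= /flat; case: ifP => t0; last by rewrite !mulr0 addr0.
rewrite !(derivC, subr0, hornerE)/=; field.
by rewrite gt_eqF.
Qed.

Lemma ramp_le0 t : t <= 0 -> ramp 0 t = 0.
Proof. by move=> t0; rewrite /= flat_le0// mulr0. Qed.

(** Because exp(-1/t) >= 1 - 1/t. This defect of at most 1 is the cost of smoothing the truncation,
    and the source of the [- 1] in the estimates of the bumps. *)
Lemma ramp_ge t : t - 1 <= ramp 0 t.
Proof.
rewrite /= /flat; case: ltP => t0; last by rewrite mulr0 subr_le0 (le_trans t0).
rewrite hornerC mul1r -(@ler_pM2l _ t^-1) ?invr_gt0// mulKf ?gt_eqF//.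
rewrite mulrBr mulVf ?gt_eqF// mulr1.
exact: expR_ge1Dx.
Qed.

Lemma ramp_deriv_ge0_le1 t : 0 <= ramp 1 t <= 1.
Proof.
rewrite /= /flat; case: ltP => t0; last by rewrite lexx ler01.
have v0 : 0 < t^-1 by rewrite invr_gt0.
rewrite !hornerE mulr_ge0 ?expR_ge0//=; last by rewrite ltW// addr_gt0.
rewrite expRN ler_pdivrMr ?expR_gt0// mul1r; exact: expR_ge1Dx.
Qed.

Lemma ramp_deriv_le0 t : t <= 0 -> ramp 1 t = 0.
Proof. exact: flat_le0. Qed.

End flat_function.
Definition powR_tower (R : realType) (b : R) (j : nat) (t : R) : R :=
  (\prod_(i < j) (b - i%:R)) * t `^ (b - j%:R).

Lemma powR_towerP (R : realType) (b : R) :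
  derivative_tower [set t | 0 < t] (powR_tower b).
Proof.
move=> j t /= t0; rewrite /powR_tower.
have h := @is_deriveZ R R R _ (\prod_(i < j) (b - i%:R)) t 1 _
  (is_derive1_powR (b - j%:R) t0).
apply: is_derive_eq h _; rewrite big_ord_recr/= -mulrA.
rewrite -[_ *: _]/(_ * _); congr (_ * (_ * _ `^ _)).
by rewrite -addrA -opprD natr1.
Qed.

(** * Radial test functions *)

Section quad.
Context {R : realType} {n : nat}.
Variables (x0 : 'rV[R]_n) (rho : R).
Hypothesis rho0 : 0 < rho.

Definition quad (x : 'rV[R]_n) : R := euclid (x - x0) ^+ 2 + rho ^+ 2.

Lemma quad_gt0 x : 0 < quad x.
Proof. by rewrite ltr_wpDl ?exprn_ge0 ?exprn_gt0 ?euclid_ge0. Qed.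

Lemma is_derive_quad x i : is_derive x (delta_mx 0 i) quad (2 * (x - x0) 0 i).
Proof.
rewrite (_ : quad = fun x : 'rV[R]_n => \sum_i (x 0 i - x0 0 i) * (x 0 i - x0 0 i)
  + rho ^+ 2); last first.
  apply/funext => y; rewrite /quad sqr_euclid; congr (_ + _).
  by apply: eq_bigr => j _; rewrite !mxE expr2.
have dj j : is_derive x (delta_mx 0 i) (fun y : 'rV[R]_n => (y 0 j - x0 0 j))
    ((j == i)%:R + 0).
  exact: (is_deriveD (is_derive_coord x j i) (is_derive_cst (- x0 0 j) x _)).
have h := is_deriveD (is_derive_sum (fun j => is_derive_dirM (dj j) (dj j)))
  (is_derive_cst (rho ^+ 2) x (delta_mx 0 i)).
rewrite fct_sumE in h; apply: is_derive_eq h _.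
rewrite addr0 (bigD1 i)//= big1 ?addr0 => [|j /negbTE ->]; last first.
  by rewrite addr0 mul0r mulr0 addr0.
by rewrite eqxx !mxE mul1r mulr1 mulr2n mulrDl mul1r.
Qed.

Lemma Cinfty_quad : Cinfty quad.
Proof.
move=> k; rewrite (_ : quad = fun x : 'rV[R]_n =>
    \sum_i (x 0 i + - x0 0 i) * (x 0 i + - x0 0 i) + rho ^+ 2); last first.
  apply/funext => y; rewrite /quad sqr_euclid; congr (_ + _).
  by apply: eq_bigr => j _; rewrite !mxE expr2.
apply: CkD; last exact: Ck_cst.
by apply: Ck_sum => i; apply: CkM; apply: CkD; (exact: Ck_coord || exact: Ck_cst).
Qed.

(** One formula serves both regimes: c = 1, b = -a/2 for p < n and c = -C, b = d/2 for p > n. In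
    both cases c b <= 0, so c Q^b is nonincreasing in |x - x0|; taking for [K] its value at distance
    [rad] makes the bump vanish beyond. *)
Definition bump (c b K : R) (x : 'rV[R]_n) : R :=
  ramp 0 (c * quad x `^ b - K).

Lemma Cinfty_bump_arg (c b K : R) : Cinfty (fun x => c * quad x `^ b + - K).
Proof.
move=> k; apply: CkD; last exact: Ck_cst.
apply: CkM; first exact: Ck_cst.
have := @Ck_comp _ _ k _ (powR_tower b) 0 quad (powR_towerP b) quad_gt0 Cinfty_quad.
rewrite /powR_tower big_ord0 subr0.
by under eq_fun do rewrite mul1r.
Qed.

Lemma Cinfty_bump c b K : Cinfty (bump c b K).
Proof.
move=> k.
exact: (@Ck_comp _ _ k _ _ 0 _ ramp_tower (fun=> I) (@Cinfty_bump_arg c b K)).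
Qed.

Lemma grad_bump c b K x : grad (bump c b K) x =
  (ramp 1 (c * quad x `^ b - K) * (2 * c * b * quad x `^ (b - 1))) *: (x - x0).
Proof.
apply/rowP => i; rewrite [LHS]mxE [RHS]mxE /partial.
have dp := is_derive_dir_comp (is_derive_quad x i) (is_derive1_powR b (quad_gt0 x)).
have h := is_derive_dir_comp (is_deriveD
  (is_derive_dirM (is_derive_cst c x (delta_mx 0 i)) dp) (is_derive_cst (- K) x _))
  (ramp_tower 0 I).
have [_ ->] := h; rewrite mul0r add0r addr0 -!mulrA; congr (_ * _).
by rewrite -[cst c x]/c; ring.
Qed.

Lemma euclid_grad_bump c b K x : euclid (grad (bump c b K) x) <=
  2 * `|c * b| * quad x `^ (b - 1) * euclid (x - x0).
Proof.
rewrite grad_bump euclidZ ler_wpM2r ?euclid_ge0//.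
have /andP[r0 r1] := ramp_deriv_ge0_le1 (c * quad x `^ b - K).
rewrite normrM (ger0_norm r0) (le_trans (ler_wpM2r _ r1))// mul1r.
by rewrite !normrM (ger0_norm (powR_ge0 _ _)) (ger0_norm (ler0n _ 2)) !mulrA.
Qed.

Variables (c b rad : R).
Hypotheses (cb0 : c * b <= 0) (rad0 : 0 < rad).
Let K := c * (rad ^+ 2 + rho ^+ 2) `^ b.

Lemma bump_arg_le0 x : rad <= euclid (x - x0) -> c * quad x `^ b - K <= 0.
Proof.
move=> rx; rewrite subr_le0 /K.
have Q0 : 0 < rad ^+ 2 + rho ^+ 2 by rewrite addr_gt0// exprn_gt0.
have QQ : rad ^+ 2 + rho ^+ 2 <= quad x.
  by rewrite lerD2r lerXn2r// nnegrE ?euclid_ge0// ltW.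
have [c0|c0|->] := ltgtP c 0; last by rewrite !mul0r.
- have b0 : 0 <= b by move: cb0; rewrite nmulr_rle0.
  by rewrite ler_wnM2l ?(ltW c0)// ge0_ler_powR// nnegrE ltW// quad_gt0.
- have b0 : b <= 0 by move: cb0; rewrite pmulr_rle0.
  rewrite ler_wpM2l ?(ltW c0)//.
  rewrite -[b]opprK !(powRN _ (- b)) lef_pV2 ?posrE ?powR_gt0 ?quad_gt0//.
  by rewrite ge0_ler_powR ?oppr_ge0// nnegrE ltW// quad_gt0.
Qed.

Lemma bump_eq0 x : rad <= euclid (x - x0) -> bump c b K x = 0.
Proof. by move=> rx; rewrite /bump ramp_le0// bump_arg_le0. Qed.

Lemma grad_bump_eq0 x : rad <= euclid (x - x0) -> grad (bump c b K) x = 0.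
Proof.
by move=> rx; rewrite grad_bump ramp_deriv_le0 ?bump_arg_le0// mul0r scale0r.
Qed.

Lemma test_function_bump (Omega : set 'rV[R]_n) :
  [set x | euclid (x - x0) <= rad] `<=` Omega -> test_function Omega (bump c b K).
Proof.
move=> BO; set B := [set x | euclid (x - x0) <= rad].
have ce : continuous (fun x : 'rV[R]_n => euclid (x - x0)).
  move=> x; apply: (@continuous_comp _ _ _ (fun y : 'rV[R]_n => y - x0) (@euclid R n : 'rV[R]_n -> R^o) x).
    exact: cvgB cvg_id (cvg_cst _).
  exact: continuous_euclid.
have cB : closed B.
  apply: (@closed_comp _ _ (fun x : 'rV[R]_n => euclid (x - x0)) [set t | t <= rad]).
    by move=> x _; exact: ce.
  exact: closed_le.
have SB : closure [set x | bump c b K x != 0] `<=` B.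
  rewrite closureE => x; apply; split => // y /= by0.
  by rewrite /B /= leNgt; apply: contra by0 => /ltW/bump_eq0/eqP.
split; [exact: Cinfty_bump| |by move=> x /SB/BO].
apply: (subclosed_compact _ _ SB); first exact: closed_closure.
apply: bounded_closed_compact => //.
exists (rad + `|x0|); split; first by rewrite num_real.
move=> M hM x /= Bx; rewrite -(subrK x0 x) (le_trans (ler_normD _ _))//.
apply: le_trans (ltW hM); rewrite lerD2r.
apply: le_trans Bx; rewrite -[`|x - x0|]/(mx_norm (x - x0)).
have [->|/mx_norm_neq0[[i j] ->]] := eqVneq (mx_norm (x - x0)) 0.
  exact: euclid_ge0.
by rewrite (ord1 i) euclid_coord.
Qed.

End quad.
Lemma ge0_le_integral_shift (R : realType) n (w : 'rV[R]_n)
    (f g : 'rV[R]_n -> \bar R) : measurable_fun setT f -> measurable_fun setT g ->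
  (forall y, (0 <= f y)%E) -> (forall y, (f y <= g (y + w)%R)%E) ->
  (\int[lebesgue_rV n]_y f y <= \int[lebesgue_rV n]_y g y)%E.
Proof.
move=> mf mg f0 fg; have g0 y : (0 <= g y)%E.
  by rewrite -(subrK w y) (le_trans (f0 _) (fg _)).
rewrite -(ge0_integral_rV_shift w mg g0); apply: ge0_le_integral.
- exact: measurableT.
- by move=> y _; exact: f0.
- exact: mf.
- exact: measurableT_comp mg (measurable_rV_shift w).
- by move=> y _; exact: fg.
Qed.

(** * Energies and lower bounds of the bumps *)

Section bump_estimates.
Context {R : realType} {n : nat}.
Hypothesis n0 : (0 < n)%N.
Variables (Omega : set 'rV[R]_n) (x0 : 'rV[R]_n) (rad : R).
Hypotheses (rad0 : 0 < rad) (BO : [set x | euclid (x - x0) <= rad] `<=` Omega).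

Local Notation nk := (n%:R * unit_vol n : R).

(** With z = y - x0, the gradient is at most a |z| Q^(-a/2-1), hence at most a |z|^(-a-1) and, for
    |z| < rho, at most a rho^(-a-1). Since (a+1) p = n + a, the outer region contributes the term
    1/a and the inner ball the term 1/n. On that ball Q <= 2 rho^2, which gives the factor
    2^(-a/2). *)
Lemma bump_subcritical (p a rho : R) : 1 < p < n%:R -> a = (n%:R - p) / (p - 1) ->
  0 < rho ->
  exists phi, [/\ test_function Omega phi,
    (\int[lebesgue_rV n]_y (euclid (grad phi y) `^ p)%:E <=
      (a `^ p * nk * rho `^ (- a) * (a^-1 + n%:R^-1))%:E)%E &
    forall y, euclid (y - x0) < rho ->
      2 `^ (- (a / 2)) * rho `^ (- a) - rad `^ (- a) - 1 <= phi y].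
Proof.
move=> /andP[p1 pn] aE rho0.
have a0 : 0 < a by rewrite aE divr_gt0 ?subr_gt0.
pose K := 1 * (rad ^+ 2 + rho ^+ 2) `^ (- (a / 2)).
have cb : 1 * - (a / 2) <= 0 by rewrite mul1r oppr_le0 divr_ge0// ltW.
pose phi := bump x0 rho 1 (- (a / 2)) K.
have Tphi : test_function Omega phi := test_function_bump rho0 cb rad0 BO.
have p0 : 0 < p by rewrite (lt_trans _ p1).
pose s := - ((a + 1) * p).
have nsE : n%:R + s = - a.
  rewrite /s aE; field; by rewrite subr_eq0 gt_eqF.
exists phi; split => //; last first.
  move=> y yr; rewrite (le_trans _ (ramp_ge _))// lerD2r lerB//.
    rewrite mul1r (_ : 2 `^ _ * _ = (2 * rho ^+ 2) `^ (- (a / 2))); last first.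
      rewrite powRM ?exprn_ge0 ?(ltW rho0)//; congr (_ * _).
      by rewrite -powR_mulrn ?(ltW rho0)// -powRrM; congr (_ `^ _); field.
    rewrite !(powRN _ (a / 2)) lef_pV2 ?posrE ?powR_gt0 ?quad_gt0//; last first.
      by rewrite mulr_gt0// exprn_gt0.
    rewrite ge0_ler_powR ?nnegrE ?(ltW (quad_gt0 _ _ _))//.
    - by rewrite divr_ge0// ltW.
    - by rewrite mulr_ge0// exprn_ge0// ltW.
    - rewrite mulr2n mulrDl mul1r lerD2r lerXn2r ?nnegrE ?euclid_ge0// ltW//.
  rewrite /K mul1r (_ : rad `^ _ = (rad ^+ 2) `^ (- (a / 2))); last first.
    by rewrite -powR_mulrn ?(ltW rad0)// -powRrM; congr (_ `^ _); field.
  have h0 : 0 < rad ^+ 2 + rho ^+ 2 by rewrite addr_gt0// exprn_gt0.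
  rewrite !(powRN _ (a / 2)) lef_pV2 ?posrE ?powR_gt0 ?exprn_gt0//.
  rewrite ge0_ler_powR ?nnegrE ?(ltW h0) ?exprn_ge0 ?(ltW rad0)//.
  - by rewrite divr_ge0// ltW.
  - by rewrite lerDl exprn_ge0// ltW.
pose g (y : 'rV[R]_n) : \bar R := (((a `^ p)%:E * (((rho `^ s)%:E * (if (0 < euclid y < rho)%R then 1 else 0))
   + (if (rho <= euclid y)%R then (euclid y `^ s)%:E else 0)))%E).
have mg1 : measurable_fun setT (fun y : 'rV[R]_n => (if (0 < euclid y < rho)%R then 1 else 0 : \bar R)%E).
  by mfun.
have mg2 : measurable_fun setT (fun y : 'rV[R]_n => (if (rho <= euclid y)%R then (euclid y `^ s)%:E else 0 : \bar R)%E).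
  by mfun.
have g10 (y : 'rV[R]_n) : (0 <= (if (0 < euclid y < rho)%R then 1 else 0 : \bar R))%E by case: ifP.
have g20 (y : 'rV[R]_n) : (0 <= (if (rho <= euclid y)%R then (euclid y `^ s)%:E else 0 : \bar R))%E.
  by case: ifP => // _; rewrite lee_fin powR_ge0.
have mg1' : measurable_fun setT (fun y : 'rV[R]_n => ((rho `^ s)%:E * (if (0 < euclid y < rho)%R then 1 else 0))%E).
  exact: measurable_funeM.
have g10' (y : 'rV[R]_n) : (0 <= (rho `^ s)%:E * (if (0 < euclid y < rho)%R then 1 else 0 : \bar R))%E.
  by rewrite mule_ge0// lee_fin powR_ge0.
have mg : measurable_fun setT g.
  by apply: measurable_funeM; exact: emeasurable_funD.
have g0 y : (0 <= g y)%E.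
  by rewrite mule_ge0 ?lee_fin ?powR_ge0// adde_ge0.
have mphi : measurable_fun setT (fun y => (euclid (grad phi y) `^ p)%:E).
  by case: Tphi => /(_ 1%N) C1 _ _; move: (measurable_euclid_grad C1) => m; mfun.
have phi_ge0 y : (0 <= (euclid (grad phi y) `^ p)%:E)%E by rewrite lee_fin powR_ge0.
apply: (@le_trans _ _ (\int[lebesgue_rV n]_y g y)%E).
  apply: (ge0_le_integral_shift mphi mg phi_ge0 (w := - x0)) => y.
  set z := y - x0.
  have Q0 := quad_gt0 x0 rho0 y.
  have gb := euclid_grad_bump x0 rho0 1 (- (a / 2)) K y.
  have gb' : euclid (grad phi y) <= a * (quad x0 rho y `^ (- (a / 2) - 1) * euclid z).
    apply: le_trans gb _; rewrite mul1r normrN ger0_norm ?divr_ge0 ?(ltW a0)//.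
    by rewrite mulrA le_eqVlt; apply/orP; left; apply/eqP; congr (_ * _ * _); field.
  (* Used with t = |z| outside the ball of radius [rho] and t = [rho] inside. *)
  have key t : 0 < t -> t ^+ 2 <= quad x0 rho y -> euclid z <= t ->
      euclid (grad phi y) `^ p <= a `^ p * t `^ s.
    move=> t0 tQ zt.
    have -> : a `^ p * t `^ s = (a * (t `^ (- a - 2) * t)) `^ p.
      rewrite powRM ?(ltW a0) ?mulr_ge0 ?powR_ge0 ?(ltW t0)//; congr (_ * _).
      rewrite -{3}[t]powRr1 ?(ltW t0)// -powR_posD// -powRrM /s; congr (_ `^ _).
      by ring.
    rewrite ge0_ler_powR ?(ltW p0) ?nnegrE ?euclid_ge0//.
      by rewrite mulr_ge0 ?(ltW a0)// mulr_ge0 ?powR_ge0// ltW.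
    apply: le_trans gb' _; rewrite ler_wpM2l ?(ltW a0)// ler_pM ?powR_ge0 ?euclid_ge0//.
    have -> : t `^ (- a - 2) = (t ^+ 2) `^ (- (a / 2 + 1)).
      by rewrite -powR_mulrn ?(ltW t0)// -powRrM; congr (_ `^ _); field.
    rewrite -opprD !(powRN _ (a / 2 + 1)) lef_pV2 ?posrE ?powR_gt0 ?exprn_gt0//.
    rewrite ge0_ler_powR ?nnegrE ?exprn_ge0 ?(ltW t0) ?(ltW Q0)//.
    by rewrite addr_ge0// divr_ge0// ltW.
  rewrite /g -/z; have [rz|rz] := leP rho (euclid z).
    rewrite andbF mule0 add0e -EFinM lee_fin key ?(lt_le_trans rho0)//.
    by rewrite /quad lerDl exprn_ge0// ltW.
  have [z0|z0] := ltP 0 (euclid z).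
    rewrite /= mule1 adde0 -EFinM lee_fin key ?(ltW rz)//.
    by rewrite /quad lerDr exprn_ge0// euclid_ge0.
  rewrite /= mule0 add0e mule0 lee_fin.
  have e0 : euclid (grad phi y) = 0.
    have ez : euclid z = 0 by apply/eqP; rewrite eq_le z0 euclid_ge0.
    apply/eqP; rewrite eq_le euclid_ge0 andbT; apply: le_trans gb' _.
    by rewrite ez !mulr0.
  by rewrite e0 powR0// gt_eqF.
rewrite /g ge0_integralZl; last 4 first.
- exact: measurableT.
- by apply: emeasurable_funD.
- by move=> y _; rewrite adde_ge0.
- by rewrite lee_fin powR_ge0.
rewrite (ge0_integralD _ measurableT (fun y _ => g10' y) mg1' (fun y _ => g20 y) mg2).
rewrite (_ : (\int[lebesgue_rV n]_y ((rho `^ s)%:E * _))%E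
    = (rho `^ s * (unit_vol n * rho ^+ n))%:E); last first.
  rewrite (ge0_integralZl _ measurableT mg1 (fun y _ => g10 y)) ?lee_fin ?powR_ge0//.
  by rewrite volume_ball.
rewrite kernel_tail//; last by rewrite nsE oppr_lt0.
rewrite -EFinD -EFinM lee_fin nsE opprK.
rewrite le_eqVlt; apply/orP; left; apply/eqP.
rewrite (_ : rho `^ s * (unit_vol n * rho ^+ n) = unit_vol n * rho `^ (- a)); last first.
  by rewrite mulrCA -powR_mulrn ?(ltW rho0)// -powR_posD// addrC nsE.
move: (a `^ p) (rho `^ (- a)) => A B.
have nn0 : n%:R != 0 :> R by rewrite pnatr_eq0 -lt0n.
have an0 : a != 0 by rewrite gt_eqF.
have arith (m U c : R) : m != 0 -> c != 0 ->
    A * (U * B + m * U * (B / c)) = A * (m * U) * B * (c^-1 + m^-1).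
  by move=> m0 c0; field; rewrite ?m0 ?c0.
exact: arith.
Qed.

(** For d <= 2 the power Q^(d/2-1) is nonincreasing in Q >= |z|^2, where z = y - x0, so the gradient
    is at most C d |z|^(d-1), and n + (d-1) p = d. A lower bound at the centre is enough since the
    limiting norm is the sup norm. The amplitude [C] is left free, to make the loss 1 of the ramp
    relatively small. *)
Lemma bump_supercritical (p d rho C : R) : n%:R < p -> d = (p - n%:R) / (p - 1) ->
  d <= 2 -> 0 < C -> 0 < rho ->
  exists phi, [/\ test_function Omega phi,
    (\int[lebesgue_rV n]_y (euclid (grad phi y) `^ p)%:E <=
      ((C * d) `^ p * nk * rad `^ d / d)%:E)%E &
    C * (rad `^ d - rho `^ d) - 1 <= phi x0].
Proof.
move=> np dE d2 C0 rho0.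
have p1 : 1 < p by rewrite (le_lt_trans _ np)// ler1n.
have d0 : 0 < d by rewrite dE divr_gt0 ?subr_gt0.
pose K := - C * (rad ^+ 2 + rho ^+ 2) `^ (d / 2).
have cb : - C * (d / 2) <= 0 by rewrite mulNr oppr_le0 mulr_ge0 ?divr_ge0// ltW.
pose phi := bump x0 rho (- C) (d / 2) K.
have Tphi : test_function Omega phi := test_function_bump rho0 cb rad0 BO.
have p0 : 0 < p by rewrite (lt_trans _ p1).
pose s := (d - 1) * p.
have nsE : n%:R + s = d.
  rewrite /s dE; field; by rewrite subr_eq0 gt_eqF.
exists phi; split => //; last first.
  rewrite (le_trans _ (ramp_ge _))// lerD2r.
  rewrite (_ : - C * _ - K = C * ((rad ^+ 2 + rho ^+ 2) `^ (d / 2)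
    - quad x0 rho x0 `^ (d / 2))); last by rewrite /K; ring.
  rewrite ler_wpM2l ?(ltW C0)// lerB//.
    rewrite (_ : rad `^ _ = (rad ^+ 2) `^ (d / 2)); last first.
      by rewrite -powR_mulrn ?(ltW rad0)// -powRrM; congr (_ `^ _); field.
    rewrite ge0_ler_powR ?nnegrE ?addr_ge0 ?exprn_ge0 ?(ltW rad0) ?(ltW rho0)//.
    - by rewrite divr_ge0// ltW.
    - by rewrite lerDl exprn_ge0// ltW.
  rewrite /quad subrr euclid0 expr0n/= add0r -powR_mulrn ?(ltW rho0)// -powRrM.
  by rewrite (_ : _ * (d / 2) = d)//; field.
pose g (y : 'rV[R]_n) : \bar R := ((((C * d) `^ p)%:E *
   (if (0 < euclid y < rad)%R then (euclid y `^ s)%:E else 0))%E).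
have mg2 : measurable_fun setT (fun y : 'rV[R]_n => (if (0 < euclid y < rad)%R then (euclid y `^ s)%:E else 0 : \bar R)%E).
  by mfun.
have g20 (y : 'rV[R]_n) : (0 <= (if (0 < euclid y < rad)%R then (euclid y `^ s)%:E else 0 : \bar R))%E.
  by case: ifP => // _; rewrite lee_fin powR_ge0.
have mg : measurable_fun setT g by exact: measurable_funeM.
have g0 y : (0 <= g y)%E by rewrite mule_ge0 ?lee_fin ?powR_ge0.
have mphi : measurable_fun setT (fun y => (euclid (grad phi y) `^ p)%:E).
  by case: Tphi => /(_ 1%N) C1 _ _; move: (measurable_euclid_grad C1) => m; mfun.
have phi_ge0 y : (0 <= (euclid (grad phi y) `^ p)%:E)%E by rewrite lee_fin powR_ge0.
apply: (@le_trans _ _ (\int[lebesgue_rV n]_y g y)%E).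
  apply: (ge0_le_integral_shift mphi mg phi_ge0 (w := - x0)) => y.
  set z := y - x0.
  have Q0 := quad_gt0 x0 rho0 y.
  have gb := euclid_grad_bump x0 rho0 (- C) (d / 2) K y.
  have gb' : euclid (grad phi y) <= (C * d) * (quad x0 rho y `^ (d / 2 - 1) * euclid z).
    apply: le_trans gb _.
    rewrite mulNr normrN ger0_norm ?mulr_ge0 ?divr_ge0 ?(ltW d0) ?(ltW C0)//.
    by rewrite mulrA le_eqVlt; apply/orP; left; apply/eqP; congr (_ * _ * _); field.
  have e0 : euclid (grad phi y) = 0 -> ((euclid (grad phi y) `^ p)%:E <= g z)%E.
    by move=> ->; rewrite powR0 ?gt_eqF.
  have [rz|rz] := leP rad (euclid z).
    by apply: e0; rewrite grad_bump_eq0// euclid0.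
  have [z0|z0] := ltP 0 (euclid z); last first.
    have ez : euclid z = 0 by apply/eqP; rewrite eq_le z0 euclid_ge0.
    apply: e0; apply/eqP; rewrite eq_le euclid_ge0 andbT; apply: le_trans gb' _.
    by rewrite ez !mulr0.
  rewrite /g z0 rz/= -EFinM lee_fin.
  have Cd0 : 0 <= C * d by rewrite mulr_ge0 ?(ltW C0) ?(ltW d0).
  have -> : (C * d) `^ p * euclid z `^ s
      = (C * d * (euclid z `^ (d - 2) * euclid z)) `^ p.
    rewrite [RHS]powRM ?mulr_ge0 ?powR_ge0 ?(ltW z0) ?(ltW d0) ?(ltW C0)//; congr (_ * _).
    rewrite -{3}[euclid z]powRr1 ?(ltW z0)// -powR_posD// -powRrM /s; congr (_ `^ _).
    by ring.
  rewrite ge0_ler_powR ?(ltW p0) ?nnegrE ?euclid_ge0//.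
    by rewrite mulr_ge0// mulr_ge0 ?powR_ge0// ltW.
  apply: le_trans gb' _; rewrite ler_wpM2l// ler_pM ?powR_ge0 ?euclid_ge0//.
  have -> : euclid z `^ (d - 2) = (euclid z ^+ 2) `^ (- (1 - d / 2)).
    by rewrite -powR_mulrn ?(ltW z0)// -powRrM; congr (_ `^ _); field.
  rewrite -opprB !(powRN _ (1 - d / 2)) lef_pV2 ?posrE ?powR_gt0 ?exprn_gt0//.
  rewrite ge0_ler_powR ?nnegrE ?exprn_ge0 ?(ltW z0) ?(ltW Q0)//.
    by rewrite subr_ge0 ler_pdivrMr// mul1r.
  by rewrite /quad lerDl exprn_ge0// ltW.
rewrite /g ge0_integralZl//; last by rewrite lee_fin powR_ge0.
rewrite kernel_head//; last by rewrite nsE.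
by rewrite -EFinM lee_fin nsE !mulrA.
Qed.

End bump_estimates.
(** * Test functions and the quotients defining lambda *)

Section integration_rV.
Context {R : realType} {n : nat}.
Hypothesis n0 : (0 < n)%N.
Local Notation mu := (lebesgue_rV n).
Implicit Types f g h : 'rV[R]_n -> R.

Lemma measurable_centered_ball (D : R) : measurable [set y : 'rV[R]_n | euclid y < D].
Proof.
have h := measurable_euclid (n := n) measurableT (measurable_itv `]-oo, D[).
rewrite setTI in h; rewrite [X in measurable X](_ : _ = euclid @^-1` `]-oo, D[)//.
Qed.

Lemma volume_centered_ball (D : R) : 0 < D ->
  mu [set y | euclid y < D] = (unit_vol n * D ^+ n)%:E.
Proof.
move=> D0; rewrite -volume_ball// -[LHS]mul1e -integral_cst; last first.
  exact: measurable_centered_ball.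
rewrite -integral_if [LHS]integral_punctured//.
- by apply: eq_integral => y _; case: ltP; case: ltP => //.
- by mfun.
- by move=> y; case: ifP.
Qed.

Lemma bounded_support_integral_le f (B D s : R) : measurable_fun setT f ->
  0 < D -> 0 < s -> (forall y, D <= euclid y -> f y = 0) -> (forall y, `|f y| <= B) ->
  (\int[mu]_y (`|f y| `^ s)%:E <= (B `^ s * (unit_vol n * D ^+ n))%:E)%E.
Proof.
move=> mf D0 s0 f0 fB.
apply: (@le_trans _ _ (\int[mu]_(y in [set y | (euclid y < D)%R]) (B `^ s)%:E)%E).
  rewrite -integral_if; apply: ge0_le_integral => //.
  - by mfun.
  - by mfun.
  move=> y _; case: ltP => yD; last by rewrite f0// normr0 powR0 ?gt_eqF.
  rewrite lee_fin ge0_ler_powR ?nnegrE ?(ltW s0)//.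
  exact: le_trans (fB y).
rewrite integral_cst; last exact: measurable_centered_ball.
by rewrite [X in (_ * X <= _)%E](volume_centered_ball D0) -EFinM.
Qed.

Lemma bounded_support_integrable f (B D : R) : measurable_fun setT f -> 0 < D ->
  (forall y, D <= euclid y -> f y = 0) -> (forall y, `|f y| <= B) ->
  mu.-integrable setT (EFin \o f).
Proof.
move=> mf D0 f0 fB; apply/integrableP; split; first exact/measurable_EFinP.
have := bounded_support_integral_le mf D0 ltr01 f0 fB.
under eq_integral do rewrite powRr1//.
by move=> /le_lt_trans; apply; rewrite ltry.
Qed.

Lemma integral_rV_shift f (w : 'rV[R]_n) : measurable_fun setT f ->
  (\int[mu]_y (f (y + w)%R)%:E = \int[mu]_y (f y)%:E)%E.
Proof.
move=> mf; have mF : measurable_fun setT (EFin \o f) by exact/measurable_EFinP.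
rewrite [LHS]integralE [RHS]integralE.
congr (_ - _)%E.
  have hp := ge0_integral_rV_shift w (measurable_funepos mF) (funepos_ge0 _).
  apply: (etrans _ hp); apply: eq_integral => y _; by rewrite !funeposE.
have hn := ge0_integral_rV_shift w (measurable_funeneg mF) (funeneg_ge0 _).
by apply: (etrans _ hn); apply: eq_integral => y _; rewrite !funenegE.
Qed.

Lemma difference_bound h (B t : R) (i : 'I_n) x : Ck 1 h -> 0 < t ->
  (forall y, `|partial i h y| <= B) ->
  `|h (t *: delta_mx 0 i + x) - h x| <= B * t.
Proof.
move=> Ch t0 hB; pose e : 'rV[R]_n := delta_mx 0 i.
have d s : is_derive s (1 : R) (fun s : R => h (s *: e + x)) (partial i h (s *: e + x)).
  by apply: (is_derive_line h x e s _).1; exact: (Ck_derive i _ Ch).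
have c : {within `[0, t], continuous (fun s : R => h (s *: e + x))}.
  by apply: continuous_subspaceT; apply: continuous_line; exact: Ck_continuous Ch.
have [s _ hs] := MVT t0 (fun s _ => d s) c.
have -> : h x = h (0 *: e + x) by rewrite scale0r add0r.
by rewrite hs subr0 normrM (gtr0_norm t0) ler_wpM2r// ltW.
Qed.

(* Integrating the difference quotients of [h] gives 0 by translation invariance;
   their limit is handled by dominated convergence. *)
Lemma integral_partial0 h (B D : R) (i : 'I_n) : Ck 1 h -> 0 < D ->
  (forall y, D <= euclid y -> h y = 0) -> (forall y, `|h y| <= B) ->
  (forall y, `|partial i h y| <= B) ->
  (\int[mu]_y (partial i h y)%:E = 0)%E.
Proof.
move=> Ch D0 h0 hB pB; pose e : 'rV[R]_n := delta_mx 0 i.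
have mh : measurable_fun setT h by apply: continuous_measurable_rV; exact: Ck_continuous Ch.
pose t k : R := k.+1%:R^-1.
have t0 k : 0 < t k by rewrite invr_gt0.
have t1 k : t k <= 1 by rewrite invf_le1// ler1n.
pose F k (y : 'rV[R]_n) := (((t k)^-1 * (h (y + t k *: e) - h y))%:E : \bar R).
have ee : euclid e <= 1.
  have := sqr_euclid e; rewrite (bigD1 i)//= big1 => [|j /negbTE ji]; last first.
    by rewrite mxE ji andbF expr0n.
  rewrite addr0 mxE !eqxx/= expr1n => e1.
  by rewrite -(@ler_pXn2r _ 2)// ?nnegrE ?euclid_ge0// e1 expr1n.
have mhk k : measurable_fun setT (fun y : 'rV[R]_n => h (y + t k *: e)).
  exact: measurableT_comp mh (measurable_rV_shift _).
have F0 k : (\int[mu]_y F k y = 0)%E.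
  have ih : mu.-integrable setT (EFin \o h) := bounded_support_integrable mh D0 h0 hB.
  have ihk : mu.-integrable setT (EFin \o (fun y : 'rV[R]_n => h (y + t k *: e))).
    apply: (@bounded_support_integrable _ B (D + 1)) => //; first by rewrite addr_gt0.
    move=> y yD; apply: h0; have := ler_euclidD (y + t k *: e) (- (t k *: e)).
    rewrite addrK euclidN euclidZ gtr0_norm// => q.
    have : t k * euclid e <= 1 by rewrite mulr_ile1 ?euclid_ge0 ?t1 ?ee ?(ltW (t0 k)).
    lra.
  rewrite /F.
  transitivity ((t k)^-1%:E * (\int[mu]_y (h (y + t k *: e) - h y)%:E))%E.
    rewrite -integralZl//; last first.
      by have := integrableB measurableT ihk ih.
  rewrite (_ : \int[mu]_y _ = 0)%E ?mule0//.
  under eq_integral do rewrite EFinB.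
  rewrite (integralB_EFin measurableT ihk ih) integral_rV_shift//.
  by rewrite subee// integrable_fin_num.
have cF y : F k y @[k --> \oo] --> (partial i h y)%:E.
  apply: cvg_EFin; first by near=> k.
  have [dh dE] := Ck_derive i y Ch.
  have q : (fun s => s^-1 *: ((h \o shift y) (s *: e) - h y)) s @[s --> 0^'] -->
      partial i h y.
    by rewrite -dE /derive; exact: (cvg_trans dh).
  have qt := (cvgr_dnbhsP _ _ _).1 q t (conj (fun k => lt0r_neq0 (t0 k)) cvg_harmonic).
  apply: cvg_trans qt; apply: near_eq_cvg; near=> k.
  by rewrite /F /= [t k *: e + y]addrC.
(* The shifts have length at most 1, so all difference quotients vanish outside the ball of radius D
   + 1, and the mean value theorem bounds them by [B]. *)
pose G (y : 'rV[R]_n) : \bar R := (if (euclid y < D + 1)%R then B else 0)%:E.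
have mG : measurable_fun setT (fun y : 'rV[R]_n => if euclid y < D + 1 then B else 0).
  by mfun.
have B0 : 0 <= B := le_trans (normr_ge0 _) (hB 0).
have iG : mu.-integrable setT G.
  apply: (@bounded_support_integrable _ B (D + 1) mG); first by rewrite addr_gt0.
    by move=> y; case: ltP => // _ _.
  by move=> y; case: ltP => _; rewrite ?normr0// ger0_norm.
have FG k y : setT y -> (`|F k y| <= G y)%E.
  move=> _; rewrite /F /G abse_EFin lee_fin; case: ltP => yD.
    rewrite normrM gtr0_norm ?invr_gt0// ler_pdivrMl// mulrC [y + _]addrC.
    exact: difference_bound.
  have hy : h y = 0 by apply: h0; rewrite (le_trans _ yD)// lerDl.
  rewrite hy h0 ?subr0 ?mulr0 ?normr0//.
  have := ler_euclidD (y + t k *: e) (- (t k *: e)).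
  rewrite addrK euclidN euclidZ gtr0_norm// => q.
  have : t k * euclid e <= 1 by rewrite mulr_ile1 ?euclid_ge0 ?t1 ?ee ?(ltW (t0 k)).
  lra.
have mF k : measurable_fun setT (F k : 'rV[R]_n -> \bar R).
  apply/measurable_EFinP; apply: measurable_funM => //.
  exact: measurable_funB.
have := @dominated_cvg _ _ _ mu setT measurableT F (fun y => (partial i h y)%:E) G
  mF (fun y _ => cF y) (fun y _ => isT) iG FG.
under eq_fun do rewrite F0.
by move=> c; have := cvg_unique _ c (cvg_cst _); apply.
Unshelve. all: end_near. Qed.

End integration_rV.
Lemma powR_le_inv (R : realType) (p x y : R) : 0 < p -> 0 <= x -> 0 <= y ->
  x `^ p <= y `^ p -> x <= y.
Proof.
move=> p0 x0 y0 xy; rewrite leNgt; apply: contraTN xy => yx.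
by rewrite -ltNge gt0_ltr_powR// nnegrE.
Qed.

Lemma euclid_le_coord (R : realType) n (v : 'rV[R]_n) (B : R) :
  (forall i, `|v 0 i| <= B) -> euclid v <= n%:R * B.
Proof.
case: n v => [|n] v vB.
  by rewrite mul0r le_eqVlt; apply/orP; left; rewrite euclid_eq0; apply/eqP/rowP => -[].
have B0 : 0 <= B := le_trans (normr_ge0 _) (vB ord0).
rewrite -(@ler_pXn2r _ 2)// ?nnegrE ?euclid_ge0 ?mulr_ge0// sqr_euclid.
apply: (@le_trans _ _ (\sum_(i < n.+1) B ^+ 2)).
  by apply: ler_sum => i _; rewrite -real_normK ?num_real// lerXn2r// nnegrE.
rewrite sumr_const card_ord -[X in X <= _]mulr_natl exprMn ler_wpM2r ?exprn_ge0//.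
by rewrite expr2 ler_peMr// ler1n.
Qed.

(** * Boundedness, and Lebesgue norms as real numbers *)

Lemma bounded_set_euclid (R : realType) n (A : set 'rV[R]_n) : bounded_set A ->
  exists D, 0 < D /\ forall x, A x -> euclid x < D.
Proof.
move=> [M [_ hM]]; exists (n%:R * (`|M| + 1) + 1); split.
  by rewrite ltr_wpDl// mulr_ge0// addr_ge0.
move=> x Ax; rewrite ltr_pwDr//; apply: euclid_le_coord => i.
apply: (le_trans _ (hM (`|M| + 1) _ x Ax)); last first.
  by rewrite (le_lt_trans (ler_norm _))// ltrDl.
rewrite -[`|x|]/(mx_norm x) mx_normE.
rewrite [leLHS](_ : _ = (`|x 0 i|%:nng)%:num)// num_le; apply/bigmax_geP; right.
by exists (0, i).
Qed.

Lemma compact_support_bounded (R : realType) n (f : 'rV[R]_n -> R) (K : set 'rV[R]_n) :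
  continuous f -> compact K -> (forall x, ~ K x -> f x = 0) ->
  exists B : R, forall x, `|f x| <= B.
Proof.
move=> cf cK f0.
have cfK : compact ((f : 'rV[R]_n -> R^o) @` K).
  by apply: continuous_compact => //; exact: continuous_subspaceT.
have [M [_ hM]] := compact_bounded cfK; exists (`|M| + 1) => x.
have [Kx|nKx] := pselect (K x); last by rewrite f0// normr0 addr_ge0.
apply: (hM (`|M| + 1) _ (f x)); last by exists x.
by rewrite (le_lt_trans (ler_norm _))// ltrDl.
Qed.

(** Test functions vanish outside [Omega], so the norm is taken over the whole space. As a real
    number it is meaningful only for a finite integral, since [fine] sends +oo to 0; hence the
    finiteness hypotheses below. *)
HB.lock Definition Lp {R : realType} {n : nat} (s : R) (f : 'rV[R]_n -> R) : R :=
  fine (\int[lebesgue_rV n]_y (`|f y| `^ s)%:E)%E `^ s^-1.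

Section lebesgue_norm.
Context {R : realType} {n : nat}.
Local Notation mu := (lebesgue_rV n).
Implicit Types (f g : 'rV[R]_n -> R).

Lemma Lp_ge0 s f : 0 <= Lp s f. Proof. by rewrite Lp.unlock powR_ge0. Qed.

Lemma LnormE s f : ('N[mu]_(s%:E)[EFin \o f] =
  (\int[mu]_y (`|f y| `^ s)%:E) `^ s^-1)%E.
Proof. by rewrite unlock. Qed.

Lemma Lnorm_Lp s f : (\int[mu]_y (`|f y| `^ s)%:E < +oo)%E ->
  ('N[mu]_(s%:E)[EFin \o f] = (Lp s f)%:E)%E.
Proof.
move=> foo; rewrite LnormE Lp.unlock -poweR_EFin fineK// ge0_fin_numE//.
by apply: integral_ge0 => y _; rewrite lee_fin powR_ge0.
Qed.

Lemma integral_Lp s f : s != 0 -> (\int[mu]_y (`|f y| `^ s)%:E < +oo)%E ->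
  (\int[mu]_y (`|f y| `^ s)%:E = (Lp s f `^ s)%:E)%E.
Proof.
move=> s0 foo; have I0 : (0 <= \int[mu]_y (`|f y| `^ s)%:E)%E.
  by apply: integral_ge0 => y _; rewrite lee_fin powR_ge0.
rewrite Lp.unlock -powRrM mulVf// powRr1 ?fine_ge0// fineK// ge0_fin_numE//.
Qed.

Lemma Lp_le s f A : 0 < s -> 0 <= A ->
  (\int[mu]_y (`|f y| `^ s)%:E <= (A `^ s)%:E)%E -> Lp s f <= A.
Proof.
move=> s0 A0 fA; have foo := le_lt_trans fA (ltry _).
have sn : s != 0 by rewrite gt_eqF.
move: fA; rewrite (integral_Lp sn foo) lee_fin => h.
by apply: powR_le_inv h => //; exact: Lp_ge0.
Qed.

Lemma integral_le_Lp s f A : 0 < s -> (\int[mu]_y (`|f y| `^ s)%:E < +oo)%E ->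
  Lp s f <= A -> (\int[mu]_y (`|f y| `^ s)%:E <= (A `^ s)%:E)%E.
Proof.
move=> s0 foo fA; rewrite integral_Lp ?gt_eqF// lee_fin ge0_ler_powR ?(ltW s0)//.
  by rewrite nnegrE Lp_ge0.
by rewrite nnegrE (le_trans _ fA)// Lp_ge0.
Qed.

Lemma LpZ s (c : R) f : 0 < s -> 0 <= c -> measurable_fun setT f ->
  (\int[mu]_y (`|f y| `^ s)%:E < +oo)%E ->
  Lp s (fun x => c * f x) = c * Lp s f.
Proof.
move=> s0 c0 mf foo; rewrite Lp.unlock.
rewrite (_ : \int[mu]_y _ = (c `^ s)%:E * \int[mu]_y (`|f y| `^ s)%:E)%E; last first.
  rewrite -ge0_integralZl//.
  - by apply: eq_integral => y _; rewrite normrM (ger0_norm c0) powRM// EFinM.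
  - by mfun.
  - by rewrite lee_fin powR_ge0.
rewrite (integral_Lp (lt0r_neq0 s0) foo) -EFinM /= !powRM ?powR_ge0//.
by rewrite -!powRrM mulfV ?gt_eqF// ?powRr1 ?Lp_ge0// c0.
Qed.

Lemma Lnorm_le s f g : 0 < s -> measurable_fun setT f -> measurable_fun setT g ->
  (forall x, `|f x| <= `|g x|) ->
  ('N[mu]_(s%:E)[EFin \o f] <= 'N[mu]_(s%:E)[EFin \o g])%E.
Proof.
move=> s0 mf mg fg; rewrite !LnormE; apply: gt0_ler_poweR.
- by rewrite invr_ge0 ltW.
- by rewrite in_itv/= leey andbT integral_ge0// => x _; rewrite lee_fin powR_ge0.
- by rewrite in_itv/= leey andbT integral_ge0// => x _; rewrite lee_fin powR_ge0.
apply: ge0_le_integral => //.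
- by mfun.
- by mfun.
- by move=> x _; rewrite lee_fin ge0_ler_powR// ?nnegrE// ltW.
Qed.

End lebesgue_norm.

(** * From test functions to the Sobolev space *)

Section test_functions.
Context {R : realType} {n : nat}.
Hypothesis n0 : (0 < n)%N.
Variables (Omega : set 'rV[R]_n) (D : R).
Hypotheses (oO : open Omega) (D0 : 0 < D).
Hypothesis OD : forall x, Omega x -> euclid x < D.
Local Notation mu := (lebesgue_rV n).
Implicit Types (phi psi : 'rV[R]_n -> R).

Lemma test_off_support phi x : ~ closure [set y | phi y != 0] x -> phi x = 0.
Proof.
by move=> nx; apply/eqP/negPn/negP => px; apply: nx; exact: subset_closure.
Qed.

Lemma test_partial_off_support phi i x : ~ closure [set y | phi y != 0] x ->
  partial i phi x = 0.
Proof.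
move=> nx; have nS : \forall y \near x, cst 0 y = phi y.
  have oS : nbhs x (~` closure [set y | phi y != 0]).
    by apply: open_nbhs_nbhs; split => //; exact/closed_openC/closed_closure.
  apply: filterS oS => y ny; exact/esym/test_off_support.
have [_ h] := near_eq_is_derive nS (is_derive_cst (0 : R) x (delta_mx 0 i)).
exact: h.
Qed.

Lemma test_off phi x : test_function Omega phi -> ~ Omega x -> phi x = 0.
Proof. by move=> [_ _ sO] nx; apply: test_off_support => /sO. Qed.

Lemma test_partial_off phi i x : test_function Omega phi -> ~ Omega x ->
  partial i phi x = 0.
Proof. by move=> [_ _ sO] nx; apply: test_partial_off_support => /sO. Qed.

Lemma test_grad_off phi x : test_function Omega phi -> ~ Omega x -> grad phi x = 0.
Proof. by move=> Tphi nx; apply/rowP => i; rewrite !mxE (test_partial_off i Tphi nx). Qed.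

Lemma test_continuous phi : test_function Omega phi -> continuous phi.
Proof. by move=> [/(_ 0%N)[]]. Qed.

Lemma test_C1 phi : test_function Omega phi -> Ck 1 phi.
Proof. by move=> [/(_ 1%N)]. Qed.

Lemma test_partial_continuous phi i : test_function Omega phi -> continuous (partial i phi).
Proof. by move=> /test_C1[_ /(_ i)[_ []]]. Qed.

Lemma test_measurable phi : test_function Omega phi -> measurable_fun setT phi.
Proof. by move=> /test_continuous/continuous_measurable_rV. Qed.

Lemma test_grad_measurable phi : test_function Omega phi ->
  measurable_fun setT (fun y => euclid (grad phi y)).
Proof. by move=> /test_C1/measurable_euclid_grad. Qed.

Lemma outside_domain x : D <= euclid x -> ~ Omega x.
Proof. by move=> Dx /OD; rewrite ltNge Dx. Qed.

Lemma test_bounded phi : test_function Omega phi ->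
  exists B : R, [/\ 0 < B, forall x, `|phi x| <= B, forall i x, `|partial i phi x| <= B
    & forall x, `|euclid (grad phi x)| <= n%:R * B].
Proof.
move=> Tphi; have [_ cS _] := Tphi.
have [B0 hB0] := compact_support_bounded (test_continuous Tphi) cS
  (@test_off_support phi).
have /choice[B hB] : forall i : 'I_n, exists B : R, forall x : 'rV[R]_n, `|partial i phi x| <= B.
  move=> i; exact: (compact_support_bounded (@test_partial_continuous _ i Tphi) cS
    (@test_partial_off_support phi i)).
have Bi0 i : 0 <= B i := le_trans (normr_ge0 _) (hB i 0).
have B00 : 0 <= B0 := le_trans (normr_ge0 _) (hB0 0).
pose C := B0 + \sum_i B i + 1.
have S0 : 0 <= \sum_i B i by exact: sumr_ge0.
have hp i x : `|partial i phi x| <= C.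
  apply: (le_trans (hB i x)); rewrite /C (bigD1 i)//=.
  have : 0 <= \sum_(j < n | j != i) B j by exact: sumr_ge0.
  lra.
exists C; split => //.
- by rewrite /C ltr_wpDl// addr_ge0.
- by move=> x; apply: (le_trans (hB0 x)); rewrite /C; lra.
- move=> x; rewrite ger0_norm ?euclid_ge0//; apply: euclid_le_coord => i.
  by rewrite mxE.
Qed.

Lemma test_integral_finite s phi : 0 < s -> test_function Omega phi ->
  (\int[mu]_y (`|phi y| `^ s)%:E < +oo)%E.
Proof.
move=> s0 Tphi; have [B [_ hB _ _]] := test_bounded Tphi.
apply: le_lt_trans (ltry _).
apply: (bounded_support_integral_le n0 (test_measurable Tphi) D0 s0 _ hB) => y Dy.
exact: test_off Tphi (outside_domain Dy).
Qed.

Lemma test_grad_integral_finite s phi : 0 < s -> test_function Omega phi ->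
  (\int[mu]_y (`|euclid (grad phi y)| `^ s)%:E < +oo)%E.
Proof.
move=> s0 Tphi; have [B [_ _ _ hB]] := test_bounded Tphi.
apply: le_lt_trans (ltry _).
apply: (bounded_support_integral_le n0 (test_grad_measurable Tphi) D0 s0 _ hB) => y Dy.
by rewrite (test_grad_off Tphi (outside_domain Dy)) euclid0.
Qed.

Lemma normL_test s phi : 0 < s -> test_function Omega phi ->
  normL Omega s phi = (Lp s phi)%:E.
Proof.
move=> s0 Tphi; rewrite /normL (_ : phi \_ Omega = phi).
  by rewrite Lnorm_Lp//; exact: test_integral_finite.
apply/funext => x; rewrite patchE; case: ifPn => //; rewrite notin_setE => nx.
by rewrite (test_off Tphi nx).
Qed.

Lemma normL_test_grad s phi : 0 < s -> test_function Omega phi ->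
  normL Omega s (euclid \o grad phi) = (Lp s (fun x => euclid (grad phi x)))%:E.
Proof.
move=> s0 Tphi; rewrite /normL (_ : _ \_ Omega = (fun x => euclid (grad phi x))).
  by rewrite Lnorm_Lp//; exact: test_grad_integral_finite.
apply/funext => x; rewrite patchE; case: ifPn => //; rewrite notin_setE => nx.
by rewrite (test_grad_off Tphi nx) euclid0.
Qed.

(** Integration by parts, as [integral_partial0] for the product of two test functions. *)
Lemma test_weak_gradient phi : test_function Omega phi ->
  weak_gradient Omega phi (grad phi).
Proof.
move=> Tphi psi Tpsi i.
have [B [B0 hB pB _]] := test_bounded Tphi; have [C [C0 hC pC _]] := test_bounded Tpsi.
have outphi y : D <= euclid y -> phi y = 0.
  by move=> Dy; exact: test_off Tphi (outside_domain Dy).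
have outpsi y : D <= euclid y -> psi y = 0.
  by move=> Dy; exact: test_off Tpsi (outside_domain Dy).
have mphi := test_measurable Tphi; have mpsi := test_measurable Tpsi.
have mdphi : measurable_fun setT (partial i phi).
  exact: continuous_measurable_rV (@test_partial_continuous _ i Tphi).
have mdpsi : measurable_fun setT (partial i psi).
  exact: continuous_measurable_rV (@test_partial_continuous _ i Tpsi).
have i1 : mu.-integrable setT (EFin \o (fun y => partial i phi y * psi y)).
  apply: (@bounded_support_integrable _ _ n0 _ (B * C) D) => //.
  - exact: measurable_funM.
  - by move=> y Dy; rewrite outpsi// mulr0.
  - by move=> y; rewrite normrM ler_pM.
have i2 : mu.-integrable setT (EFin \o (fun y => phi y * partial i psi y)).
  apply: (@bounded_support_integrable _ _ n0 _ (B * C) D) => //.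
  - exact: measurable_funM.
  - by move=> y Dy; rewrite outphi// mul0r.
  - by move=> y; rewrite normrM ler_pM.
pose h y := phi y * psi y.
have Ch : Ck 1 h by exact: CkM (test_C1 Tphi) (test_C1 Tpsi).
have dh y : partial i h y = partial i phi y * psi y + phi y * partial i psi y.
  have [_ q] := is_derive_dirM (Ck_derive i y (test_C1 Tphi))
    (Ck_derive i y (test_C1 Tpsi)).
  exact: q.
have BC0 : 0 <= B * C by rewrite mulr_ge0// ltW.
have I0 := @integral_partial0 _ _ n0 h (B * C + B * C) D i Ch D0 _ _ _.
rewrite [LHS]Rintegral_mkcond [X in - X]Rintegral_mkcond.
rewrite (_ : _ \_ Omega = (fun y => phi y * partial i psi y)); last first.
  apply/funext => x; rewrite patchE; case: ifPn => //; rewrite notin_setE => nx.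
  by rewrite (test_off Tphi nx) mul0r.
rewrite [X in - (\int[_]_x X x)](_ : _ = (fun y => partial i phi y * psi y)); last first.
  apply/funext => x; rewrite patchE; case: ifPn => [_|]; first by rewrite mxE.
  by rewrite notin_setE => nx; rewrite (test_off Tpsi nx) mulr0.
apply/eqP; rewrite -addr_eq0 addrC -RintegralD//; apply/eqP.
rewrite /Rintegral; under eq_integral do rewrite -dh.
rewrite I0//.
- by move=> y Dy; rewrite /h outphi// mul0r.
- by move=> y; rewrite normrM (@le_trans _ _ (B * C))// ?ler_pM// lerDl.
- move=> y; rewrite dh (le_trans (ler_normD _ _))// !normrM.
  by apply: lerD; apply: ler_pM.
Qed.

Lemma W01_test p phi : 0 < p -> test_function Omega phi ->
  W01 Omega p phi (grad phi).
Proof.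
move=> p0 Tphi; have mphi := test_measurable Tphi; split.
  split.
  - exact: measurable_funTS.
  - move=> i; under eq_fun do rewrite mxE.
    apply: measurable_funTS.
    exact: continuous_measurable_rV (@test_partial_continuous _ i Tphi).
  - by rewrite normL_test// ltry.
  - by rewrite normL_test_grad// ltry.
  - exact: test_weak_gradient.
have N0 f : (forall x, f x = 0) -> normL Omega p f = 0%E.
  move=> f0; rewrite /normL (_ : EFin \o _ = cst 0%E); last first.
    by apply/funext => x /=; rewrite patchE; case: ifP; rewrite ?f0.
  by rewrite Lnorm0// eqe gt_eqF.
exists (fun _ => phi); split => //.
- by rewrite N0; [exact: cvg_cst|move=> x; rewrite subrr].
- by rewrite N0; [exact: cvg_cst|move=> x; rewrite subrr euclid0].
Qed.

Lemma test_scale (c : R) phi : c != 0 -> test_function Omega phi ->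
  test_function Omega (fun x => c * phi x).
Proof.
move=> c0 [Cphi cS sO]; rewrite /test_function.
rewrite (_ : [set x | c * phi x != 0] = [set x | phi x != 0]); last first.
  by apply/seteqP; split => x /=; rewrite mulf_eq0 negb_or c0.
by split => // k; apply: CkM => //; exact: Ck_cst.
Qed.

Lemma grad_scale (c : R) phi x : Ck 1 phi ->
  grad (fun x => c * phi x) x = c *: grad phi x.
Proof.
move=> Cphi; apply/rowP => i; rewrite !mxE /partial.
have [_ h] := is_derive_dirM (is_derive_cst c x (delta_mx 0 i)) (Ck_derive i x Cphi).
by apply: (etrans h); rewrite mul0r add0r.
Qed.

Lemma lambda_elt_ge0 p q t :
  (exists u Du, [/\ W01 Omega p u Du, normL Omega q u = 1%E &
        t = fine (normL Omega p (euclid \o Du)) `^ p]) -> 0 <= t.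
Proof. by move=> [u [Du [_ _ ->]]]; exact: powR_ge0. Qed.

Lemma lambda_member p q phi : 0 < p -> 0 < q -> test_function Omega phi ->
  0 < Lp q phi ->
  exists u Du, [/\ W01 Omega p u Du, normL Omega q u = 1%E &
    Lp p (fun x => euclid (grad phi x)) `^ p / Lp q phi `^ p
    = fine (normL Omega p (euclid \o Du)) `^ p].
Proof.
move=> p0 q0 Tphi Np.
pose c := (Lp q phi)^-1; have c0 : 0 < c by rewrite invr_gt0.
have Tc : test_function Omega (fun x => c * phi x).
  by apply: test_scale => //; rewrite gt_eqF.
exists (fun x => c * phi x), (grad (fun x => c * phi x)); split.
- exact: W01_test.
- rewrite normL_test// LpZ// ?ltW//.
  + by rewrite /c mulVf// gt_eqF.
  + exact: test_measurable.
  + exact: test_integral_finite.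
rewrite normL_test_grad//= (_ : (fun x => euclid (grad (fun y => c * phi y) x)) = (fun x => c * euclid (grad phi x))).
  rewrite LpZ ?(ltW c0)//; [|exact: test_grad_measurable|exact: test_grad_integral_finite].
  rewrite powRM ?(ltW c0) ?Lp_ge0// mulrC; congr (_ * _).
  rewrite -powRN -mulN1r powRrM.
  by rewrite powR_inv1 ?Lp_ge0.
apply/funext => x; rewrite grad_scale; last exact: test_C1 Tphi.
by rewrite euclidZ gtr0_norm.
Qed.

Lemma lambda_upper p q phi : 0 < p -> 0 < q -> test_function Omega phi ->
  lambda Omega p q * Lp q phi `^ p <= Lp p (fun x => euclid (grad phi x)) `^ p.
Proof.
move=> p0 q0 Tphi; have [N0|N0] := eqVneq (Lp q phi) 0.
  by rewrite N0 powR0 ?gt_eqF// mulr0 powR_ge0.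
have Np : 0 < Lp q phi by rewrite lt_def N0 Lp_ge0.
rewrite -(ler_pdivlMr _ _ (powR_gt0 _ Np)); apply: ge_inf.
  by exists 0 => t; exact: lambda_elt_ge0.
exact: lambda_member.
Qed.

Lemma measurable_euclid_restrict (v : 'rV[R]_n -> 'rV[R]_n) :
  (forall i, measurable_fun Omega (fun x => v x 0 i)) ->
  measurable_fun setT ((euclid \o v) \_ Omega).
Proof.
move=> mv; have mO : measurable Omega by exact: open_measurable_rV.
pose w x : 'rV[R]_n := \row_i ((fun x => v x 0 i) \_ Omega) x.
rewrite (_ : _ \_ Omega = euclid \o w); last first.
  apply/funext => x; rewrite patchE/=; case: ifPn => xO.
    by congr euclid; apply/rowP => i; rewrite mxE patchE xO.
  rewrite -[LHS](@euclid0 R n); congr euclid; apply/rowP => i.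
  by rewrite !mxE patchE (negbTE xO).
apply: (measurableT_comp measurable_euclid); apply: measurable_fun_rVP => i.
rewrite (_ : _ \o _ = (fun x => v x 0 i) \_ Omega); last first.
  by apply/funext => x; rewrite /rV_coord/= mxE.
exact: (measurable_restrictT _ mO).1 (mv i).
Qed.

Lemma minr_truncate (x y M : R) : 0 < M ->
  Num.min `|x| M <= `|y| + Num.min `|x - y| M.
Proof.
move=> M0; rewrite ge_min; have [xyM|Mxy] := leP `|x - y| M.
  by rewrite -{1}(subrK y x) [x - y + y]addrC ler_normD.
by rewrite lerDr normr_ge0 orbT.
Qed.

(** Extends an inequality from test functions to [W01]. The approximants converge to [u] in L^p
    only, with q >= p, but min(|w|, M)^q <= M^(q-p) |w|^p for w = u - phi k. The level [M] goes to
    infinity in [lambda_lower]. *)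
Lemma truncated_Lnorm_le p q m u Du (M : R) : 1 <= p <= q -> 0 <= m -> 0 < M ->
  (forall phi, test_function Omega phi ->
    m * Lp q phi <= Lp p (fun x => euclid (grad phi x))) ->
  W01 Omega p u Du ->
  (m%:E * 'N[mu]_(q%:E)[EFin \o (fun x => Num.min `|(u \_ Omega) x| M)%R]
   <= normL Omega p (euclid \o Du))%E.
Proof.
move=> /andP[p1 pq] m0 M0 hm [[mu_ mDu _ _ _] [phi [Tphi cu cDu]]].
have mO : measurable Omega by exact: open_measurable_rV.
have p0 : 0 < p by rewrite (lt_le_trans _ p1).
have q0 : 0 < q by rewrite (lt_le_trans p0).
have q1 : 1 <= q by rewrite (le_trans p1).
set U := u \_ Omega.
have mU : measurable_fun setT U by apply: (measurable_restrictT _ mO).1.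
have mV : measurable_fun setT ((euclid \o Du) \_ Omega).
  exact: measurable_euclid_restrict.
have mtest k : measurable_fun setT (phi k) := test_measurable (Tphi k).
have mg k : measurable_fun setT ((fun x => u x - phi k x) \_ Omega).
  apply: (measurable_restrictT _ mO).1; apply: measurable_funB => //.
  exact: measurable_funTS.
have mDg k : measurable_fun setT ((fun x => euclid (Du x - grad (phi k) x)) \_ Omega).
  apply: measurable_euclid_restrict => i; under eq_fun do rewrite !mxE.
  apply: measurable_funB => //; apply: measurable_funTS.
  exact: continuous_measurable_rV (@test_partial_continuous _ i (Tphi k)).
pose h k x := Num.min `|((fun x => u x - phi k x) \_ Omega) x| M.
have mh k : measurable_fun setT (h k).
  by apply: measurable_minr => //; exact: measurableT_comp.
have hM k x : 0 <= h k x <= M.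
  by rewrite /h ge_min lexx orbT le_min normr_ge0 ltW.
(* The truncation is what lets the [L^p] convergence of [phi k] control [L^q] norms. *)
have htrunc k : ('N[mu]_(q%:E)[EFin \o h k] <=
    (M `^ ((q - p) / q))%:E * normL Omega p (fun x => u x - phi k x)%R `^ (p / q))%E.
  rewrite /normL; set g := (fun x => _) \_ Omega.
  have mgk : measurable_fun setT g := mg k.
  have I0 : (0 <= \int[mu]_y (`|g y| `^ p)%:E)%E.
    by apply: integral_ge0 => y _; rewrite lee_fin powR_ge0.
  rewrite [X in (X `^ (p / q))%E]LnormE -poweRrM mulrA mulVf ?gt_eqF// mul1r.
  rewrite powRrM -poweR_EFin -poweRM ?lee_fin ?powR_ge0// LnormE.
  apply: gt0_ler_poweR.
  - by rewrite invr_ge0 ltW.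
  - by rewrite in_itv/= leey andbT integral_ge0// => x _; rewrite lee_fin powR_ge0.
  - by rewrite in_itv/= leey andbT mule_ge0// lee_fin powR_ge0.
  rewrite -ge0_integralZl//; last 2 first.
  - by mfun.
  - by rewrite lee_fin powR_ge0.
  apply: ge0_le_integral => //.
  - by move: (mh k) => mhk; mfun.
  - by apply: measurable_funeM; mfun.
  move=> x _; rewrite -EFinM lee_fin.
  have /andP[h0 hxM] := hM k x; rewrite ger0_norm//.
  have [hz|hp] := leP (h k x) 0.
    have -> : h k x = 0 by apply/eqP; rewrite eq_le hz h0.
    by rewrite powR0 ?gt_eqF// mulr_ge0 ?powR_ge0.
  rewrite -{1}(subrK p q) powR_posD// ler_pM ?powR_ge0//.
    by rewrite ge0_ler_powR ?subr_ge0 ?nnegrE// ltW.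
  by rewrite ge0_ler_powR ?nnegrE// ?(ltW p0)// /h ge_min lexx.
have hU k : ('N[mu]_(q%:E)[EFin \o (fun x => Num.min `|U x| M)%R] <=
    (Lp q (phi k))%:E + 'N[mu]_(q%:E)[EFin \o h k])%E.
  have <- : ('N[mu]_(q%:E)[EFin \o phi k] = (Lp q (phi k))%:E)%E.
    by rewrite Lnorm_Lp//; exact: test_integral_finite.
  have mabs : measurable_fun setT (fun x => `|phi k x|) by exact: measurableT_comp.
  have mUM : measurable_fun setT (fun x => Num.min `|U x| M).
    by apply: measurable_minr => //; exact: measurableT_comp.
  have mk := minkowski_EFin mu mabs (mh k) q1.
  have le1 : ('N[mu]_(q%:E)[EFin \o (fun x => Num.min `|U x| M)%R] <=
      'N[mu]_(q%:E)[EFin \o ((fun x => `|phi k x|) \+ h k)%R])%E.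
    apply: Lnorm_le => //; first exact: measurable_funD.
    move=> x; have /andP[h0 _] := hM k x.
    rewrite ger0_norm ?le_min ?normr_ge0 ?(ltW M0)//.
    rewrite (ger0_norm (_ : 0 <= (_ \+ _) x)) ?addr_ge0//=.
    rewrite /h /U !patchE; case: ifPn => [_|xO]; first exact: minr_truncate.
    by rewrite normr0 -[leLHS]add0r lerD.
  apply: (le_trans le1); apply: (le_trans mk); apply: leeD => //.
  by apply: Lnorm_le => // x; rewrite normr_id.
have hD k : ((Lp p (fun x => euclid (grad (phi k) x)))%:E <=
    normL Omega p (euclid \o Du) + normL Omega p (fun x => euclid (Du x - grad (phi k) x)%R))%E.
  rewrite -Lnorm_Lp; last exact: test_grad_integral_finite.
  have mk := minkowski_EFin mu mV (mDg k) p1.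
  apply: le_trans mk; apply: Lnorm_le => //.
  - exact: test_grad_measurable.
  - exact: measurable_funD.
  move=> x; rewrite ger0_norm ?euclid_ge0//= !patchE; case: ifPn => [_|].
    rewrite ger0_norm ?addr_ge0 ?euclid_ge0// -[euclid (Du x - _)]euclidN opprB.
    by rewrite -{1}(subrK (Du x) (grad (phi k) x)) addrC ler_euclidD.
  by rewrite notin_setE => nx; rewrite (test_grad_off (Tphi k) nx) euclid0.
pose C := m * M `^ ((q - p) / q); have C0 : 0 <= C by rewrite mulr_ge0 ?powR_ge0.
apply/lee_addgt0Pr => e e0.
(* Each of the two errors is at most e/2: [d] for the gradients and C d^(p/q) for the truncated
   functions. C + 1 avoids dividing by 0. *)
pose d := Num.min (e / 2) ((e / 2 / (C + 1)) `^ (q / p)).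
have d0 : 0 < d.
  by rewrite lt_min divr_gt0//= powR_gt0// divr_gt0 ?divr_gt0// ltr_wpDl.
have [k [k1 k2]] : exists k, (normL Omega p (fun x => u x - phi k x)%R < d%:E)%E /\
    (normL Omega p (fun x => euclid (Du x - grad (phi k) x)%R) < d%:E)%E.
  have d0' : (0%E < d%:E)%E by rewrite lte_fin.
  have nb : nbhs (0%E : \bar R) [set y | (y < d%:E)%E].
    by apply: open_nbhs_nbhs; split => //; exact: open_ereal_lt_ereal.
  have [K1 _ h1] := cu _ nb; have [K2 _ h2] := cDu _ nb.
  exists (maxn K1 K2); split; first exact: (h1 (maxn K1 K2) (leq_maxl _ _)).
  exact: (h2 (maxn K1 K2) (leq_maxr _ _)).
have hk : ('N[mu]_(q%:E)[EFin \o h k] <= (M `^ ((q - p) / q) * d `^ (p / q))%:E)%E.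
  apply: (le_trans (htrunc k)); rewrite EFinM lee_wpmul2l ?lee_fin ?powR_ge0//.
  rewrite -poweR_EFin; apply: gt0_ler_poweR; last exact: ltW.
  - by rewrite divr_ge0 ?ltW.
  - by rewrite in_itv/= leey andbT; exact: Lnorm_ge0.
  - by rewrite in_itv/= leey andbT lee_fin ltW.
have dpq : C * d `^ (p / q) <= e / 2.
  have : d `^ (p / q) <= e / 2 / (C + 1).
    have e2 : 0 <= e / 2 / (C + 1) by rewrite divr_ge0 ?divr_ge0 ?addr_ge0 ?(ltW e0).
    have <- : ((e / 2 / (C + 1)) `^ (q / p)) `^ (p / q) = e / 2 / (C + 1).
      rewrite -powRrM (_ : q / p * (p / q) = 1) ?powRr1//.
      by field; rewrite !gt_eqF.
    rewrite ge0_ler_powR ?nnegrE ?powR_ge0 ?(ltW d0)//.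
      by rewrite divr_ge0 ?ltW.
    by rewrite /d ge_min lexx orbT.
  move=> dle; apply: (le_trans (ler_wpM2l C0 dle)).
  by rewrite mulrCA ler_piMr ?divr_ge0 ?(ltW e0)// ler_pdivrMr ?mul1r ?lerDl// ltr_wpDl.
have de : d <= e / 2 by rewrite /d ge_min lexx.
apply: (@le_trans _ _ (m%:E * ((Lp q (phi k))%:E + (M `^ ((q - p) / q) * d `^ (p / q))%:E))%E).
  by rewrite lee_wpmul2l ?lee_fin// (le_trans (hU k))// leeD2l.
rewrite -EFinD -EFinM mulrDr mulrA -/C EFinD.
apply: (@le_trans _ _ ((normL Omega p (euclid \o Du) + d%:E) + (e / 2)%:E)%E).
  apply: leeD; last by rewrite lee_fin.
  have := hm _ (Tphi k); rewrite -lee_fin => /le_trans; apply.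
  by apply: (le_trans (hD k)); rewrite leeD2l// ltW.
by rewrite -addeA leeD2l// -EFinD lee_fin; lra.
Qed.

(** The test function of positive norm makes the set defining [lambda] nonempty, without which its
    [inf] would be the default value 0. *)
Lemma lambda_lower p q m : 1 <= p <= q -> 0 <= m ->
  (exists2 phi, test_function Omega phi & 0 < Lp q phi) ->
  (forall phi, test_function Omega phi ->
    m * Lp q phi `^ p <= Lp p (fun x => euclid (grad phi x)) `^ p) ->
  m <= lambda Omega p q.
Proof.
move=> /[dup] ppq /andP[p1 pq] m0 [phi0 Tphi0 Lphi0] hm.
have p0 : 0 < p by rewrite (lt_le_trans _ p1).
have q0 : 0 < q by rewrite (lt_le_trans p0).
apply: lb_le_inf; first by eexists; exact: (lambda_member p0 q0 Tphi0 Lphi0).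
move=> t [u [Du [Wu Nu ->]]].
have [[_ _ _ NDu _] _] := Wu.
set A := fine _; have AE : (normL Omega p (euclid \o Du) = A%:E)%E.
  by rewrite fineK// ge0_fin_numE// Lnorm_ge0.
have A0 : 0 <= A by rewrite fine_ge0// Lnorm_ge0.
pose r := m `^ p^-1; have r0 : 0 <= r by exact: powR_ge0.
have rE : m = r `^ p by rewrite /r -powRrM mulVf ?gt_eqF// powRr1.
clearbody r.
have hr phi : test_function Omega phi -> r * Lp q phi <= Lp p (fun x => euclid (grad phi x)).
  move=> Tphi; have := hm _ Tphi; rewrite rE -(powRM p r0 (Lp_ge0 q phi)) => h.
  by apply: powR_le_inv h; rewrite ?mulr_ge0 ?Lp_ge0.
rewrite rE ge0_ler_powR ?nnegrE ?(ltW p0)//.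
have [->//|rn0] := eqVneq r 0; have rp : 0 < r by rewrite lt_def rn0.
pose U := u \_ Omega.
have mO : measurable Omega by exact: open_measurable_rV.
have mU : measurable_fun setT U by have [[mu_ _ _ _ _] _] := Wu; apply: (measurable_restrictT _ mO).1.
(* The truncations at height k + 1 increase to |u|, so by monotone convergence the normalization of
   [u] in L^q is recovered from the uniform bound [Fle]. *)
pose F k x := ((Num.min `|U x| k.+1%:R) `^ q)%:E : \bar R.
have m0k k x : 0 <= Num.min `|U x| k.+1%:R by rewrite le_min normr_ge0/=.
have Fle k : (\int[mu]_x F k x <= ((A / r) `^ q)%:E)%E.
  have := truncated_Lnorm_le ppq r0 (ltr0Sn R k) hr Wu; rewrite AE.
  rewrite -lee_pdivlMl// -EFinM mulrC => h.
  have -> : (\int[mu]_x F k x = 'N[mu]_(q%:E)[EFin \o (fun x => Num.min `|U x| k.+1%:R)%R] `^ q)%E.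
    rewrite LnormE -poweRrM mulVf ?gt_eqF// poweRe1; last first.
      by apply: integral_ge0 => x _; rewrite lee_fin powR_ge0.
    by apply: eq_integral => x _; rewrite /F (ger0_norm (m0k k x)).
  rewrite -poweR_EFin; apply: gt0_ler_poweR => //.
  - exact: ltW.
  - by rewrite in_itv/= leey andbT; exact: Lnorm_ge0.
  - by rewrite in_itv/= leey andbT lee_fin divr_ge0.
have mF k : measurable_fun setT (F k).
  have mm : measurable_fun setT (fun x => Num.min `|U x| k.+1%:R).
    by apply: measurable_minr => //; exact: measurableT_comp.
  by rewrite /F; mfun.
have cF x : F ^~ x @ \oo --> (`|U x| `^ q)%:E.
  apply: cvg_near_cst; near=> k; rewrite /F min_l//.
  have /le_trans : `|U x| <= k%:R by near: k; exact: nbhs_infty_ger.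
  by apply; rewrite ler_nat.
have F0 k x : setT x -> (0 <= F k x)%E by rewrite lee_fin powR_ge0.
have ndF x : setT x -> {homo F ^~ x : a b / (a <= b)%N >-> (a <= b)%E}.
  move=> _ a b ab; rewrite lee_fin ge0_ler_powR ?nnegrE ?(ltW q0)//.
  by rewrite le_min !ge_min lexx/= ler_nat ltnS ab orbT.
have c := @cvg_monotone_convergence _ _ _ mu setT measurableT F mF F0 ndF.
have limE : (\int[mu]_x (limn (F ^~ x)) = 1)%E.
  transitivity (\int[mu]_x (`|U x| `^ q)%:E)%E.
    by apply: eq_integral => x _; apply/cvg_lim.
  have := Nu; rewrite /normL LnormE => h.
  have : ((1 : \bar R) `^ q = \int[mu]_x (`|U x| `^ q)%:E)%E.
    rewrite -h -poweRrM mulVf ?gt_eqF// poweRe1//.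
    by apply: integral_ge0 => x _; rewrite lee_fin powR_ge0.
  by rewrite poweR1r.
rewrite limE in c.
have : (1 <= ((A / r) `^ q)%:E)%E.
  rewrite -(cvg_lim _ c)//; apply: lime_le; first by apply/cvg_ex; eexists; exact: c.
  by apply: nearW => k; exact: Fle.
rewrite lee_fin => h1; rewrite -[r]mul1r -ler_pdivlMr//.
by apply: (powR_le_inv q0); rewrite ?powR1 ?divr_ge0.
Unshelve. all: end_near. Qed.

End test_functions.

(** * Limits of real powers *)

Section limits_powR.
Context {R : realType} {T : Type} {F : set_system T} {FF : Filter F}.
Implicit Types f g : T -> R.

Let powR_expR (a b : R) : 0 < a -> a `^ b = expR (b * ln a).
Proof. by move=> a0; rewrite /powR gt_eqF. Qed.

Lemma cvg_powR2 f g (l k : R) : 0 < l -> f x @[x --> F] --> l ->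
  g x @[x --> F] --> k -> f x `^ g x @[x --> F] --> l `^ k.
Proof.
move=> l0 fl gk; rewrite powR_expR//.
have c : expR (g x * ln (f x)) @[x --> F] --> expR (k * ln l).
  apply: (@cvg_comp _ _ _ (fun x => g x * ln (f x)) expR); last exact: continuous_expR.
  apply: cvgM => //; apply: (@cvg_comp _ _ _ f (@ln R)); first exact: fl.
  exact: continuous_ln.
apply: cvg_trans c; apply: near_eq_cvg.
by apply: filterS (cvgr_gt _ fl _ l0) => x fx; rewrite powR_expR.
Qed.

Lemma cvg_powR_exp f (a l : R) : 0 < a -> f x @[x --> F] --> l ->
  a `^ f x @[x --> F] --> a `^ l.
Proof. by move=> a0; exact: (cvg_powR2 a0 (cvg_cst a)). Qed.

Lemma cvg_powR_base f (b l : R) : 0 < l -> f x @[x --> F] --> l ->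
  f x `^ b @[x --> F] --> l `^ b.
Proof. by move=> l0 fl; exact: (cvg_powR2 l0 fl (cvg_cst b)). Qed.

(** With y = sqrt x, the inequality - ln y <= 1/y - 1 gives - x ln x = - 2 y^2 ln y <= 2 y, so x ln
    x lies between - 2 sqrt x and 0 for 0 < x < 1. *)
Lemma cvg_xlnx f : (\forall x \near F, 0 < f x) -> f x @[x --> F] --> (0 : R) ->
  f x * ln (f x) @[x --> F] --> (0 : R).
Proof.
move=> fpos f0.
have s0 : - (2 * Num.sqrt (f x)) @[x --> F] --> (0 : R).
  rewrite -oppr0 -[X in - X](mulr0 (2 : R)) -[X in 2 * X](@sqrtr0 R).
  apply: cvgN; apply: cvgM; first exact: cvg_cst.
  by apply: (@cvg_comp _ _ _ f Num.sqrt); [exact: f0|exact: sqrt_continuous].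
apply: (squeeze_cvgr _ s0 (cvg_cst 0)).
apply: filterS (filterI fpos (cvgr_lt _ f0 _ (ltr01 : (0 : R) < 1))) => x [x0 x1].
apply/andP; split; last by rewrite mulr_ge0_le0 ?(ltW x0)// ln_le0// ltW.
set y := Num.sqrt (f x); have y0 : 0 < y by rewrite sqrtr_gt0.
have fy : f x = y * y by rewrite -expr2 sqr_sqrtr// ltW.
rewrite fy lnM ?posrE//.
have e1 : 1 + (y^-1 - 1) = y^-1 by rewrite addrC subrK.
have := @le_ln1Dx R (y^-1 - 1); rewrite e1 lnV ?posrE// => h.
have {}h : - ln y <= y^-1 - 1 by apply: h; rewrite ltrBrDl subrr invr_gt0.
have h2 : y * y * - ln y <= y.
  apply: (le_trans (ler_wpM2l (ltW (mulr_gt0 y0 y0)) h)).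
  rewrite mulrBr mulr1 mulfK ?gt_eqF// gerBl mulr_ge0 ?ltW//.
lra.
Qed.

(** This removes, in the lower bound for p < n, the powers whose base tends to 0. *)
Lemma cvg_powR_self f g (k : R) : (\forall x \near F, 0 < f x) ->
  f x @[x --> F] --> (0 : R) -> g x @[x --> F] --> k ->
  f x `^ (g x * f x) @[x --> F] --> (1 : R).
Proof.
move=> fpos f0 gk.
have c : expR (g x * (f x * ln (f x))) @[x --> F] --> expR (k * 0).
  have c0 : g x * (f x * ln (f x)) @[x --> F] --> k * 0.
    by apply: cvgM => //; exact: cvg_xlnx.
  apply: (cvg_comp _ expR c0); exact: continuous_expR.
rewrite mulr0 expR0 in c; apply: cvg_trans c; apply: near_eq_cvg.
by apply: filterS fpos => x fx; rewrite powR_expR// mulrA.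
Qed.

End limits_powR.

(** * Variational characterization of Lambda *)

Section limit_of_lambda.
Context {R : realType} {n : nat}.
Hypothesis n0 : (0 < n)%N.
Variables (Omega : set 'rV[R]_n) (D : R).
Hypotheses (oO : open Omega) (D0 : 0 < D).
Hypothesis OD : forall x, Omega x -> euclid x < D.
Local Notation mu := (lebesgue_rV n).
Local Notation V := (unit_vol n * D ^+ n : R).
Local Notation energy p phi := (Lp p (fun x => euclid (grad phi x)) `^ p).
Implicit Types (phi : 'rV[R]_n -> R).

Let V0 : 0 < V. Proof. by rewrite mulr_gt0 ?unit_vol_gt0// exprn_gt0. Qed.

(* The limit is [inf_phi energy p phi / Ninf phi ^ p], by comparison of the
   quotients defining [lambda p q] with those for [Ninf]. *)
Lemma lambda_cvg (F : set_system R) {FF : ProperFilter F} p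
    (Ninf : ('rV[R]_n -> R) -> R) (c : R -> R) : 1 <= p ->
  (\forall q \near F, p <= q /\ 0 < c q) -> c q @[q --> F] --> (1 : R) ->
  (\forall q \near F, forall phi, test_function Omega phi -> Lp q phi <= c q * Ninf phi) ->
  (forall phi s, test_function Omega phi -> 0 <= s -> s < Ninf phi ->
    \forall q \near F, s < Lp q phi) ->
  (exists2 phi, test_function Omega phi & 0 < Ninf phi) ->
  (forall phi, 0 <= Ninf phi) ->
  exists L, [/\ lambda Omega p q @[q --> F] --> L, 0 <= L,
    forall phi, test_function Omega phi -> L * Ninf phi `^ p <= energy p phi &
    forall m, (forall phi, test_function Omega phi -> m * Ninf phi `^ p <= energy p phi) ->
      m <= L].
Proof.
move=> p1 npq c1 hup hlow [phi0 Tphi0 N0] Nge0.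
have p0 : 0 < p by rewrite (lt_le_trans _ p1).
pose S := [set t : R | exists phi, [/\ test_function Omega phi, 0 < Ninf phi &
  t = energy p phi / Ninf phi `^ p]].
have S0 : S !=set0 by eexists; exists phi0; split.
have Sge0 : lbound S 0 by move=> t [phi [_ _ ->]]; rewrite divr_ge0 ?powR_ge0.
have infS : has_inf S by split => //; exists 0.
pose L := inf S; have L0 : 0 <= L by exact: lb_le_inf.
have hL phi : test_function Omega phi -> L * Ninf phi `^ p <= energy p phi.
  move=> Tphi; have [Nz|Nz] := eqVneq (Ninf phi) 0.
    by rewrite Nz powR0 ?gt_eqF// mulr0 powR_ge0.
  have Np : 0 < Ninf phi by rewrite lt_def Nz Nge0.
  rewrite -(ler_pdivlMr _ _ (powR_gt0 _ Np)); apply: ge_inf; first by exists 0.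
  by exists phi; split.
exists L; split => //; last first.
  move=> m hm; apply: lb_le_inf => // t [phi [Tphi Np ->]].
  by rewrite (ler_pdivlMr _ _ (powR_gt0 _ Np)) hm.
apply/cvgrPdist_le => e e0.
have [t [phi [Tphi Np tE]] tL] := inf_adherent e0 infS.
rewrite tE in tL.
have Le : 0 < L + e by rewrite ltr_wpDl.
(* The quotient of [phi] would be exactly L + e if its norm were [s]. Being smaller than L + e, it
   forces s < [Ninf phi]; then s < [Lp q phi] eventually, which puts the quotient for q, and so
   [lambda], below L + e. *)
pose s := (energy p phi / (L + e)) `^ p^-1.
have sE : (L + e) * s `^ p = energy p phi.
  rewrite /s -powRrM mulVf ?gt_eqF// powRr1 ?divr_ge0 ?powR_ge0// ?(ltW Le)//.
  by rewrite mulrC divfK// gt_eqF.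
have sN : s < Ninf phi.
  rewrite ltNge; apply: contraTN tL => Ns; rewrite -leNgt.
  rewrite (ler_pdivlMr _ _ (powR_gt0 _ Np)) -sE ler_wpM2l ?(ltW Le)//.
  by rewrite ge0_ler_powR ?nnegrE ?(ltW p0) ?(ltW Np)// powR_ge0.
have s0 : 0 <= s by exact: powR_ge0.
clearbody s.
have sl := hlow phi s Tphi s0 sN.
have n0q := hlow phi0 0 Tphi0 (lexx 0) N0.
have cL : L * c q `^ (- p) @[q --> F] --> L.
  have := cvgM (cvg_cst L) (@cvg_powR_base _ _ _ _ c (- p) _ ltr01 c1).
  by rewrite powR1 mulr1; exact.
have ncL : \forall q \near F, L - e <= L * c q `^ (- p).
  have Lle : L - e < L by rewrite ltrBlDr ltrDl.
  by apply: filterS (cvgr_gt _ cL _ Lle) => q /ltW.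
(* Since [Lp q] is at most [c q] times [Ninf], the inequality with constant [L] for [Ninf] gives one
   with constant L (c q)^(-p) for [Lp q]. *)
have low : \forall q \near F, L - e <= lambda Omega p q.
  apply: filterS (filterI (filterI npq hup) (filterI ncL n0q)) => q [[[pq cq] hq] [ncq phi0q]].
  have q0 : 0 < q by rewrite (lt_le_trans p0).
  apply: (le_trans ncq); apply: (lambda_lower n0 oO D0 OD).
  - by rewrite p1 pq.
  - by rewrite mulr_ge0 ?powR_ge0.
  - by exists phi0.
  move=> psi Tpsi; apply: le_trans (hL psi Tpsi).
  rewrite -mulrA ler_wpM2l// powRN ler_pdivrMl ?powR_gt0// -powRM ?(ltW cq) ?Nge0//.
  have := hq psi Tpsi => hqp.
  by rewrite ge0_ler_powR ?nnegrE ?(ltW p0) ?mulr_ge0 ?(ltW cq) ?Nge0// Lp_ge0.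
have upp : \forall q \near F, lambda Omega p q <= L + e.
  apply: filterS (filterI npq sl) => q [[pq cq] sq].
  have q0 : 0 < q by rewrite (lt_le_trans p0).
  have Lq0 : 0 < Lp q phi by exact: le_lt_trans sq.
  have := lambda_upper n0 D0 OD p0 q0 Tphi; rewrite -sE => h.
  rewrite -(ler_pM2r (powR_gt0 p Lq0)); apply: (le_trans h); rewrite ler_wpM2l ?(ltW Le)//.
  by rewrite ge0_ler_powR ?nnegrE ?(ltW p0) ?(ltW Lq0) ?(ltW sq).
apply: filterS (filterI low upp) => q [h1 h2].
by rewrite distrC ler_distl h1.
Qed.

(** Hoelder's inequality for |f|^q and the indicator of the ball of radius [D], with exponents r/q
    and r/(r-q). *)
Lemma Lp_monotone (f : 'rV[R]_n -> R) q r : measurable_fun setT f ->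
  (forall y, D <= euclid y -> f y = 0) -> 0 < q -> q < r ->
  (\int[mu]_y (`|f y| `^ r)%:E < +oo)%E ->
  Lp q f <= V `^ (q^-1 - r^-1) * Lp r f.
Proof.
move=> mf f0 q0 qr foo; have r0 : 0 < r by rewrite (lt_trans q0).
have rq0 : 0 < r - q by rewrite subr_gt0.
apply: Lp_le => //; first by rewrite mulr_ge0 ?powR_ge0 ?Lp_ge0.
pose ind (y : 'rV[R]_n) : R := if euclid y < D then 1 else 0.
have mind : measurable_fun setT ind by rewrite /ind; mfun.
have ind0 y : 0 <= ind y by rewrite /ind; case: ifP.
have ma : measurable_fun setT (fun y => `|f y| `^ q) by mfun.
have h := @hoelder_bound _ _ _ mu (fun y => `|f y| `^ q) ind (r / q) (r / (r - q))
  (Lp r f `^ q) (V `^ (1 - q / r)) ma mind (fun y => powR_ge0 _ _) ind0.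
rewrite powRM ?powR_ge0 ?Lp_ge0// -powRrM.
have -> : (q^-1 - r^-1) * q = 1 - q / r by field; rewrite !gt_eqF.
rewrite mulrC; apply: le_trans (h _ _ _ _ _ _ _).
- rewrite le_eqVlt; apply/orP; left; apply/eqP; apply: eq_integral => y _.
  rewrite /ind; case: ltP => Dy; first by rewrite mulr1.
  by rewrite f0// normr0 powR0 ?gt_eqF// mul0r.
- by rewrite divr_gt0.
- by rewrite divr_gt0.
- by field; rewrite !gt_eqF.
- exact: powR_ge0.
- exact: powR_ge0.
- rewrite -powRrM (_ : q * (r / q) = r); last by field; rewrite gt_eqF.
  rewrite -(integral_Lp (lt0r_neq0 r0) foo) le_eqVlt; apply/orP; left; apply/eqP.
  apply: eq_integral => y _; rewrite -powRrM (_ : q * (r / q) = r)//.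
  by field; rewrite gt_eqF.
- rewrite -powRrM (_ : (1 - q / r) * (r / (r - q)) = 1); last by field; rewrite !gt_eqF.
  rewrite powRr1 ?(ltW V0)//.
  have := bounded_support_integral_le (f := ind) n0 mind D0 (_ : 0 < r / (r - q)) (B := 1).
  rewrite powR1 mul1r => h1; apply: le_trans (h1 _ _ _).
  + rewrite le_eqVlt; apply/orP; left; apply/eqP; apply: eq_integral => y _.
    by rewrite ger0_norm.
  + by rewrite divr_gt0.
  + by move=> y; rewrite /ind; case: ltP.
  + by move=> y; rewrite /ind; case: ifP; rewrite ?normr1 ?normr0.
Qed.

Lemma Lp_lower (f : 'rV[R]_n -> R) (s a d : R) (x : 'rV[R]_n) : measurable_fun setT f -> 0 < s ->
  (\int[mu]_y (`|f y| `^ s)%:E < +oo)%E -> 0 <= a -> 0 < d ->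
  (forall y, euclid (y - x) < d -> a <= `|f y|) ->
  a * (unit_vol n * d ^+ n) `^ s^-1 <= Lp s f.
Proof.
move=> mf s0 foo a0 d0 fa.
have v0 : 0 <= unit_vol n * d ^+ n by rewrite mulr_ge0 ?unit_vol_ge0// exprn_ge0// ltW.
apply: (powR_le_inv s0); rewrite ?mulr_ge0 ?powR_ge0 ?Lp_ge0//.
rewrite powRM ?powR_ge0// -[X in _ * X <= _]powRrM mulVf ?gt_eqF// [X in _ * X <= _]powRr1//.
rewrite -lee_fin -(integral_Lp (lt0r_neq0 s0) foo).
pose g (y : 'rV[R]_n) : \bar R := (if (euclid y < d)%R then (a `^ s)%:E else 0)%E.
have mg : measurable_fun setT g by rewrite /g; mfun.
have g0 y : (0 <= g y)%E by rewrite /g; case: ifP => // _; rewrite lee_fin powR_ge0.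
rewrite (_ : (_ * _)%:E = \int[mu]_y g y)%E; last first.
  rewrite /g integral_if integral_cst; last exact: measurable_centered_ball.
  by rewrite [X in (_ * X)%E](volume_centered_ball n0 d0) -EFinM.
apply: (ge0_le_integral_shift mg _ g0 (w := x)); first by mfun.
move=> y; rewrite /g; case: ltP => yd; last by rewrite lee_fin powR_ge0.
by rewrite lee_fin ge0_ler_powR ?nnegrE ?(ltW s0)// fa// addrK.
Qed.

Lemma ball_lower phi x a : continuous phi -> a < `|phi x| ->
  exists d, 0 < d /\ forall y, euclid (y - x) < d -> a <= `|phi y|.
Proof.
move=> cphi ax.
have cn : {for x, continuous (fun y => `|phi y|)}.
  by apply: continuous_comp; [exact: cphi|exact: norm_continuous].
have /nbhs_ballP[d /= d0 hd] : nbhs x [set y | a < `|phi y|].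
  exact: (cvgr_gt _ cn a ax).
exists d; split => // y yd; apply: ltW; apply: hd.
apply/rV_ballE; split => // i; apply: le_lt_trans yd.
by rewrite distrC; have := euclid_coord (y - x) i; rewrite !mxE.
Qed.

End limit_of_lambda.
Lemma open_contains_ball (R : realType) n (Omega : set 'rV[R]_n) : open Omega ->
  Omega !=set0 -> exists x0 rad, 0 < rad /\ [set x | euclid (x - x0) <= rad] `<=` Omega.
Proof.
move=> oO [x0 Ox0].
have /nbhs_ballP[e /= e0 he] : nbhs x0 Omega by exact: open_nbhs_nbhs.
exists x0, (e / 2); split; first by rewrite divr_gt0.
move=> x /= xe; apply: he; apply/rV_ballE; split => // i.
apply: (@le_lt_trans _ _ (e / 2)); last by rewrite ltr_pdivrMr// ltr_pMr// ltr1n.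
by apply: le_trans xe; rewrite distrC; have := euclid_coord (x - x0) i; rewrite !mxE.
Qed.

Lemma exists_test_function (R : realType) n (Omega : set 'rV[R]_n) : (0 < n)%N ->
  open Omega -> Omega !=set0 -> exists phi x, test_function Omega phi /\ 0 < phi x.
Proof.
move=> n0 oO /(open_contains_ball oO)[x0 [rad [rad0 BO]]].
have n1 : (1 : R) <= n%:R by rewrite ler1n.
(* [bump_supercritical] is used with p = n + 1 and rho = rad/2; the amplitude is chosen so that the
   value at the centre is at least 2 - 1. *)
pose d : R := (n%:R + 1 - n%:R) / (n%:R + 1 - 1).
have dE : d = n%:R^-1 by rewrite /d; field; rewrite gt_eqF// (lt_le_trans ltr01).
have d0 : 0 < d by rewrite dE invr_gt0 (lt_le_trans ltr01).
have d2 : d <= 2 by rewrite dE (@le_trans _ _ 1)// ?invf_le1 ?ler1n// (lt_le_trans ltr01).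
have r2 : 0 < rad / 2 by rewrite divr_gt0.
have rr : 0 < rad `^ d - (rad / 2) `^ d.
  rewrite subr_gt0 gt0_ltr_powR ?nnegrE ?(ltW r2) ?(ltW rad0)//.
  by rewrite ltr_pdivrMr// ltr_pMr// ltr1n.
have C0 : 0 < 2 / (rad `^ d - (rad / 2) `^ d) by rewrite divr_gt0.
have np : n%:R < n%:R + 1 :> R by rewrite ltrDl.
have [phi [Tphi _ hphi]] := bump_supercritical n0 rad0 BO np erefl d2 C0 r2.
exists phi, x0; split => //; apply: lt_le_trans hphi.
by rewrite divfK ?gt_eqF// subr_gt0 ltr1n.
Qed.

Section Lambda_variational.
Context {R : realType} {n : nat}.
Hypothesis n0 : (0 < n)%N.
Variables (Omega : set 'rV[R]_n) (D : R).
Hypotheses (oO : open Omega) (Ox : Omega !=set0) (D0 : 0 < D).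
Hypothesis OD : forall x, Omega x -> euclid x < D.
Local Notation mu := (lebesgue_rV n).
Local Notation V := (unit_vol n * D ^+ n : R).
Local Notation energy p phi := (Lp p (fun x => euclid (grad phi x)) `^ p).
Implicit Types (phi : 'rV[R]_n -> R).

Let V0 : 0 < V. Proof. by rewrite mulr_gt0 ?unit_vol_gt0// exprn_gt0. Qed.

Let off phi y : test_function Omega phi -> D <= euclid y -> phi y = 0.
Proof. by move=> Tphi Dy; apply: (test_off Tphi); exact: outside_domain OD _ Dy. Qed.

Lemma test_Lp_gt0 phi x s : test_function Omega phi -> 0 < `|phi x| -> 0 < s -> 0 < Lp s phi.
Proof.
move=> Tphi phix s0.
have a0 : 0 < `|phi x| / 2 by rewrite divr_gt0.
have alt : `|phi x| / 2 < `|phi x| by rewrite ltr_pdivrMr// ltr_pMr// ltr1n.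
have [d [d0 hd]] := ball_lower (test_continuous Tphi) alt.
apply: lt_le_trans (Lp_lower n0 (test_measurable Tphi) s0
  (test_integral_finite n0 D0 OD s0 Tphi) (ltW a0) d0 hd).
by rewrite mulr_gt0// powR_gt0// mulr_gt0 ?unit_vol_gt0// exprn_gt0.
Qed.

(** [lambda_cvg] as q tends to r from below. [Lp_monotone] compares [Lp q] with [Lp r] from above,
    and the boundedness of each test function gives the converse in the limit. *)
Lemma Lambda_subcritical p : 1 < p < n%:R -> let r := n%:R * p / (n%:R - p) in
  [/\ 0 <= Lambda Omega p,
    forall phi, test_function Omega phi -> Lambda Omega p * Lp r phi `^ p <= energy p phi &
    forall m, (forall phi, test_function Omega phi -> m * Lp r phi `^ p <= energy p phi) ->
      m <= Lambda Omega p].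
Proof.
move=> /andP[p1 pn] r; have p0 : 0 < p by rewrite (lt_trans _ p1).
have np0 : 0 < n%:R - p by rewrite subr_gt0.
have pr : p < r by rewrite /r ltr_pdivlMr// mulrC ltr_pM2r// ltrBlDr ltrDl.
have r0 : 0 < r by rewrite (lt_trans p0).
pose c (q : R) := V `^ (q^-1 - r^-1).
have near_r : \forall q \near r^'-, p < q < r.
  near=> q; apply/andP; split; near: q; [exact: nbhs_left_gt|exact: nbhs_left_lt].
have cid : (q : R) @[q --> r^'-] --> r by apply: cvg_at_left_filter; exact: cvg_id.
have c1 : c q @[q --> r^'-] --> (1 : R).
  rewrite -(powRr0 V); apply: cvg_powR_exp => //; rewrite -(subrr r^-1).
  by apply: cvgB; [apply: cvgV => //; rewrite gt_eqF|exact: cvg_cst].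
have H1 : \forall q \near r^'-, p <= q /\ 0 < c q.
  by apply: filterS near_r => q /andP[pq _]; rewrite (ltW pq) powR_gt0.
have H2 : \forall q \near r^'-, forall phi, test_function Omega phi -> Lp q phi <= c q * Lp r phi.
  apply: filterS near_r => q /andP[pq qr] phi Tphi; apply: Lp_monotone => //.
  - exact: test_measurable Tphi.
  - by move=> y; exact: off.
  - exact: lt_trans p0 pq.
  - exact: (test_integral_finite n0 D0 OD r0 Tphi).
have H3 phi s : test_function Omega phi -> 0 <= s -> s < Lp r phi ->
    \forall q \near r^'-, s < Lp q phi.
  move=> Tphi s0 sr.
  pose s1 := (s + Lp r phi) / 2.
  have ss1 : s < s1 by rewrite /s1; lra.
  have s1r : s1 < Lp r phi by rewrite /s1; lra.
  have s10 : 0 < s1 by exact: le_lt_trans ss1.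
  have [B [B0 hB _ _]] := test_bounded Tphi.
  (* As |phi| <= B, the integral of |phi|^r is at most B^(r-q) times that of |phi|^q. If [Lp q phi]
     were at most [s1], it would be at most this quantity, whose limit s1^r is smaller than
     [Lp r phi] to the power r. The midpoint [s1] is positive even when s = 0, as continuity of the
     power requires. *)
  have lim : B `^ (r - q) * s1 `^ q @[q --> r^'-] --> B `^ (r - r) * s1 `^ r.
    apply: cvgM; apply: cvg_powR_exp => //.
    by apply: cvgB => //; exact: cvg_cst.
  rewrite subrr powRr0 mul1r in lim.
  have ltr : s1 `^ r < Lp r phi `^ r by rewrite gt0_ltr_powR ?nnegrE ?(ltW s10)// Lp_ge0.
  apply: filterS (filterI (cvgr_lt _ lim _ ltr) near_r) => q [hq /andP[pq qr]].
  have q0 : 0 < q by exact: lt_trans pq.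
  apply: (lt_trans ss1); rewrite ltNge; apply: contraTN hq => qs1; rewrite -leNgt.
  have fq := test_integral_finite n0 D0 OD q0 Tphi.
  have fr := test_integral_finite n0 D0 OD r0 Tphi.
  rewrite -lee_fin -(integral_Lp (lt0r_neq0 r0) fr).
  apply: (@le_trans _ _ (\int[mu]_y ((B `^ (r - q))%:E * (`|phi y| `^ q)%:E))%E).
    have mphi := test_measurable Tphi.
    apply: ge0_le_integral => //.
    - by mfun.
    - by apply: measurable_funeM; mfun.
    move=> y _; rewrite -EFinM lee_fin.
    have [->|phiy] := eqVneq (phi y) 0.
      by rewrite normr0 powR0 ?gt_eqF// mulr_ge0 ?powR_ge0.
    rewrite -{1}(subrK q r) powR_posD ?normr_gt0// ler_wpM2r ?powR_ge0//.
    by rewrite ge0_ler_powR ?subr_ge0 ?nnegrE ?(ltW qr) ?(ltW B0).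
  rewrite ge0_integralZl//; last 2 first.
  - by have mphi := test_measurable Tphi; mfun.
  - by rewrite lee_fin powR_ge0.
  rewrite EFinM lee_wpmul2l ?lee_fin ?powR_ge0//.
  exact: integral_le_Lp.
have [phi0 [x0 [Tphi0 phi00]]] := exists_test_function n0 oO Ox.
have H4 : exists2 phi, test_function Omega phi & 0 < Lp r phi.
  by exists phi0 => //; apply: (@test_Lp_gt0 _ x0) => //; rewrite normr_gt0 gt_eqF.
have [L [cL L0 hL hm]] := lambda_cvg n0 oO D0 OD (ltW p1) H1 c1 H2 H3 H4 (Lp_ge0 r).
have -> : Lambda Omega p = L.
  by rewrite /Lambda /critical_exponent pn; exact: cvg_lim cL.
by split.
Unshelve. all: end_near. Qed.

Lemma sup_norm_ge0 phi : 0 <= sup (range (fun x => `|phi x|)).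
Proof.
(* [lambda_cvg] asks for nonnegativity on all functions; for unbounded ones [sup] takes its default
   value 0. *)
have [hs|/sup_out ->//] := pselect (has_sup (range (fun x => `|phi x|))).
by apply: (le_trans (normr_ge0 (phi 0))); apply: ub_le_sup; [exact: hs.2|exists 0].
Qed.

(** [lambda_cvg] as q tends to infinity, with the sup norm as limit. The conclusions are stated
    point by point, which is how Morrey's inequality and the bumps enter. The case p = n is
    included, for the continuity claim. *)
Lemma Lambda_supercritical p : 1 <= p -> n%:R <= p ->
  [/\ 0 <= Lambda Omega p,
    forall phi x, test_function Omega phi ->
      Lambda Omega p * `|phi x| `^ p <= energy p phi &
    forall m, 0 <= m ->
      (forall phi x, test_function Omega phi -> m * `|phi x| `^ p <= energy p phi) ->
      m <= Lambda Omega p].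
Proof.
move=> p1 np; have p0 : 0 < p by rewrite (lt_le_trans _ p1).
pose c (q : R) := V `^ (q^-1).
pose N phi : R := sup (range (fun x => `|phi x|)).
have phiN phi x : test_function Omega phi -> `|phi x| <= N phi.
  move=> Tphi; have [B [_ hB _ _]] := test_bounded Tphi.
  by apply: ub_le_sup; [exists B => _ [y _ <-]; exact: hB|exists x].
have NltP phi s : test_function Omega phi -> s < N phi -> exists x, s < `|phi x|.
  move=> Tphi sN; have [B [_ hB _ _]] := test_bounded Tphi.
  have hs : has_sup (range (fun x => `|phi x|)).
    by split; [exists `|phi 0|, 0|exists B => _ [y _ <-]; exact: hB].
  have e0 : 0 < N phi - s by rewrite subr_gt0.
  have [_ [x _ <-]] := sup_adherent e0 hs.
  by rewrite -/(N phi) opprB addrC subrK => h; exists x.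
have near_q : \forall q \near +oo, p <= q.
  by apply: nbhs_pinfty_ge; exact: num_real.
have c1 : c q @[q --> +oo] --> (1 : R).
  rewrite -(powRr0 V); apply: cvg_powR_exp => //.
  apply: cvg_trans (cvgr_powRN (ltr01 : 0 < (1 : R))); apply: near_eq_cvg.
  by apply: filterS near_q => q pq; rewrite powR_inv1// ltW// (lt_le_trans p0).
have H1 : \forall q \near +oo, p <= q /\ 0 < c q.
  by apply: filterS near_q => q pq; rewrite pq powR_gt0.
have H2 : \forall q \near +oo, forall phi, test_function Omega phi -> Lp q phi <= c q * N phi.
  apply: filterS near_q => q pq phi Tphi; have q0 : 0 < q by rewrite (lt_le_trans p0).
  apply: Lp_le => //; first by rewrite mulr_ge0 ?powR_ge0 ?sup_norm_ge0.
  rewrite powRM ?powR_ge0 ?sup_norm_ge0// -powRrM mulVf ?gt_eqF// powRr1 ?(ltW V0)//.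
  rewrite mulrC; apply: bounded_support_integral_le => //.
  - exact: test_measurable Tphi.
  - by move=> y; exact: off.
  - by move=> y; exact: phiN.
have H3 phi s : test_function Omega phi -> 0 <= s -> s < N phi ->
    \forall q \near +oo, s < Lp q phi.
  move=> Tphi s0 /(NltP _ _ Tphi)[x sx].
  pose s1 := (s + `|phi x|) / 2.
  have ss1 : s < s1 by rewrite /s1; lra.
  have s1x : s1 < `|phi x| by rewrite /s1; lra.
  have s10 : 0 < s1 by exact: le_lt_trans ss1.
  have [d [d0 hd]] := ball_lower (test_continuous Tphi) s1x.
  have W0 : 0 < unit_vol n * d ^+ n by rewrite mulr_gt0 ?unit_vol_gt0// exprn_gt0.
  (* On the ball of radius [d] about [x], |phi| is at least [s1], so [Lp q phi] is at least [s1]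
     times the q-th root of its volume. *)
  have lim : s1 * (unit_vol n * d ^+ n) `^ q^-1 @[q --> +oo] --> s1 * 1.
    apply: cvgM; first exact: cvg_cst.
    rewrite -(powRr0 (unit_vol n * d ^+ n)); apply: cvg_powR_exp => //.
    apply: cvg_trans (cvgr_powRN (ltr01 : 0 < (1 : R))); apply: near_eq_cvg.
    by apply: filterS near_q => q pq; rewrite powR_inv1// ltW// (lt_le_trans p0).
  rewrite mulr1 in lim.
  apply: filterS (filterI near_q (cvgr_gt _ lim _ ss1)) => q [pq hq].
  have q0 : 0 < q by rewrite (lt_le_trans p0).
  apply: (lt_le_trans hq); apply: (@Lp_lower _ _ n0 phi q s1 d x) => //.
  - exact: test_measurable Tphi.
  - exact: (test_integral_finite n0 D0 OD q0 Tphi).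
  - exact: ltW.
have [phi0 [x0 [Tphi0 phi00]]] := exists_test_function n0 oO Ox.
have H4 : exists2 phi, test_function Omega phi & 0 < N phi.
  exists phi0 => //; apply: lt_le_trans (phiN phi0 x0 Tphi0).
  by rewrite normr_gt0 gt_eqF.
have [L [cL L0 hL hm]] := lambda_cvg n0 oO D0 OD p1 H1 c1 H2 H3 H4 (@sup_norm_ge0).
have -> : Lambda Omega p = L.
  by rewrite /Lambda /critical_exponent ltNge np; exact: cvg_lim cL.
split => //.
- move=> phi x Tphi; apply: le_trans (hL phi Tphi); rewrite ler_wpM2l//.
  by rewrite ge0_ler_powR ?nnegrE ?(ltW p0) ?sup_norm_ge0 ?phiN.
- move=> m m0 hx; apply: hm => phi Tphi.
  have [->|mn] := eqVneq m 0; first by rewrite mul0r powR_ge0.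
  have mp : 0 < m by rewrite lt_def mn.
  have E0 : 0 <= energy p phi / m by rewrite divr_ge0 ?powR_ge0.
  have NE : N phi <= (energy p phi / m) `^ p^-1.
    apply: ge_sup; first by exists `|phi 0|, 0.
    move=> _ [x _ <-]; apply: (powR_le_inv p0); rewrite ?powR_ge0//.
    by rewrite -powRrM mulVf ?gt_eqF// powRr1// ler_pdivlMr// mulrC hx.
  have : N phi `^ p <= energy p phi / m.
    rewrite -[leRHS](powRr1 E0) -(mulVf (lt0r_neq0 p0)) [leRHS]powRrM.
    by rewrite ge0_ler_powR ?nnegrE ?(ltW p0) ?sup_norm_ge0 ?powR_ge0.
  by rewrite ler_pdivlMr// mulrC.
Qed.

End Lambda_variational.
Lemma powR_inv (R : realType) (x b : R) : 0 <= x -> x^-1 `^ b = (x `^ b)^-1.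
Proof. by move=> x0; rewrite -powRN -mulN1r powRrM powR_inv1. Qed.

(** * Explicit upper and lower bounds for Lambda *)

Section Lambda_bounds.
Context {R : realType} {n : nat}.
Hypothesis n1 : (1 < n)%N.
Variables (Omega : set 'rV[R]_n) (D : R).
Hypotheses (oO : open Omega) (Ox : Omega !=set0) (D0 : 0 < D).
Hypothesis OD : forall x, Omega x -> euclid x < D.
Local Notation mu := (lebesgue_rV n).
Local Notation energy p phi := (Lp p (fun x => euclid (grad phi x)) `^ p).
Local Notation K := (n%:R * unit_vol n : R).
Implicit Types (phi : 'rV[R]_n -> R).

Let n0 : (0 < n)%N. Proof. exact: ltnW. Qed.
Let nR : (1 : R) < n%:R. Proof. by rewrite ltr1n. Qed.
Let nR0 : (0 : R) < n%:R. Proof. by rewrite ltr0n. Qed.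
Let k0 : 0 < unit_vol n :> R. Proof. exact: unit_vol_gt0. Qed.
Let K0 : 0 < K. Proof. by rewrite mulr_gt0. Qed.

Lemma energyE phi p : test_function Omega phi -> 0 < p ->
  (\int[mu]_y (euclid (grad phi y) `^ p)%:E)%E = (energy p phi)%:E.
Proof.
move=> Tphi p0; rewrite -integral_Lp ?gt_eqF//; last first.
  exact: (test_grad_integral_finite n0 D0 OD p0 Tphi).
by apply: eq_integral => y _; rewrite ger0_norm ?euclid_ge0.
Qed.

Lemma test_potential_bound phi x : test_function Omega phi ->
  ((K * `|phi x|)%:E <= \int[mu]_y
    (euclid (grad phi y) * euclid (y - x) `^ (1 - n%:R))%:E)%E.
Proof.
move=> Tphi; apply: (potential_bound x n1 (test_C1 Tphi) (M := D)) => y Dy.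
by apply: (test_off Tphi); exact: outside_domain OD _ Dy.
Qed.

(** Two points of [Omega] are less than 2 D apart, so [morrey_bound] applies with that radius at
    every point of [Omega]; outside, test functions vanish. *)
Lemma Lambda_supercritical_lower p : n%:R < p ->
  K * ((p - n%:R) / (p - 1)) `^ (p - 1) * (2 * D) `^ (n%:R - p) <= Lambda Omega p.
Proof.
move=> np; have p1 : 1 < p by rewrite (lt_trans nR).
have p0 : 0 < p by rewrite (lt_trans _ p1).
have [_ _] := Lambda_supercritical n0 oO Ox D0 OD (ltW p1) (ltW np); apply.
  by rewrite mulr_ge0 ?powR_ge0// mulr_ge0 ?powR_ge0// ltW.
move=> phi x Tphi.
have [xO|xO] := pselect (Omega x); last first.
  by rewrite (test_off Tphi xO) normr0 powR0 ?gt_eqF// mulr0 powR_ge0.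
have pn0 : 0 < p - n%:R by rewrite subr_gt0.
have p10 : 0 < p - 1 by rewrite subr_gt0.
have D20 : 0 < 2 * D by rewrite mulr_gt0.
have GD y : euclid (grad phi y) != 0 -> euclid (y - x) < 2 * D.
  move=> Gy; have yO : Omega y.
    by apply: contrapT => yO; move: Gy; rewrite (test_grad_off Tphi yO) euclid0 eqxx.
  have := ler_euclidD y (- x); rewrite euclidN => hh.
  by have := OD xO; have := OD yO; lra.
have h1 := morrey_bound n1 (test_grad_measurable Tphi)
  (fun y => euclid_ge0 (grad phi y)) (fun x => test_potential_bound x Tphi) np D20 GD.
rewrite energyE// -EFinM lee_fin in h1.
set d := (p - n%:R) / (p - 1).
have dE : (p - 1) / (p - n%:R) = d^-1 by rewrite /d invfM invrK mulrC.
have d0 : 0 < d by rewrite divr_gt0.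
rewrite dE in h1.
rewrite -[n%:R - p]opprB powRN.
rewrite -(ler_pM2l (_ : 0 < (d^-1) `^ (p - 1) * (2 * D) `^ (p - n%:R))); last first.
  by rewrite mulr_gt0// powR_gt0// invr_gt0.
apply: le_trans h1.
rewrite powR_inv ?(ltW d0)//.
rewrite le_eqVlt; apply/orP; left; apply/eqP.
have u0 : d `^ (p - 1) != 0 by rewrite gt_eqF// powR_gt0.
have v0 : (2 * D) `^ (p - n%:R) != 0 by rewrite gt_eqF// powR_gt0.
move: (d `^ _) ((2 * D) `^ _) u0 v0 => u v u0 v0.
by field; rewrite u0 v0.
Qed.

(** [hedberg_bound] raised to the power p/r = (n-p)/n, with r = np/(n-p). The powers of [F], F^(p
    (n-p)/n) directly and F^(p p/n) through [c], combine to F^p, as homogeneity requires. *)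
Lemma Lambda_subcritical_lower p eta : 1 < p < n%:R -> 0 < eta < 1 ->
  ((p - 1) / p) `^ ((n%:R - p) / n%:R) * (eta / 2) `^ (p * ((n%:R - p) / n%:R)) *
    ((1 - eta) / far_norm n p) `^ (p * (p / n%:R)) <= Lambda Omega p.
Proof.
move=> /[dup] ppn /andP[p1 pn] /[dup] eta01 /andP[eta0 eta1].
have p0 : 0 < p by rewrite (lt_trans _ p1).
have pn0 : 0 < n%:R - p by rewrite subr_gt0.
have p10 : 0 < p - 1 by rewrite subr_gt0.
have [_ _] := Lambda_subcritical n0 oO Ox D0 OD ppn; apply.
move=> phi Tphi.
set r := n%:R * p / (n%:R - p); have r0 : 0 < r by rewrite divr_gt0// mulr_gt0.
set t := (n%:R - p) / n%:R; have t0 : 0 < t by rewrite divr_gt0.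
have A0 : 0 < far_norm n p :> R by rewrite mulr_gt0// powR_gt0// divr_gt0.
set A := far_norm n p in A0 *.
have e1 : 0 < 1 - eta by rewrite subr_gt0.
set m := (X in X * _ <= _).
have m0 : 0 < m by rewrite !mulr_gt0// powR_gt0// divr_gt0.
(* [hedberg_bound] needs a positive [F]. An arbitrary upper bound of the norm is allowed here so
   that a gradient of norm 0 can be reached by letting [F] tend to 0. *)
have main F : 0 < F -> Lp p (fun x => euclid (grad phi x)) <= F -> m * Lp r phi `^ p <= F `^ p.
  move=> F0 EF; pose c := eta / 2 * ((1 - eta) / (A * F)) `^ (p / (n%:R - p)).
  have AF0 : 0 < (1 - eta) / (A * F) by rewrite divr_gt0// mulr_gt0.
  have eF : (\int[mu]_y (euclid (grad phi y) `^ p)%:E <= (F `^ p)%:E)%E.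
    by rewrite energyE// lee_fin ge0_ler_powR ?nnegrE ?(ltW p0) ?(ltW F0) ?Lp_ge0.
  have h := hedberg_bound n1 (test_measurable Tphi) (test_grad_measurable Tphi)
    (fun y => euclid_ge0 (grad phi y)) (fun x => test_potential_bound x Tphi)
    ppn F0 eta01 eF (erefl c).
  rewrite (integral_Lp (lt0r_neq0 r0)) ?lee_fin in h; last first.
    exact: (test_integral_finite n0 D0 OD r0 Tphi).
  have rt : r * t = p by rewrite /r /t; field; rewrite !gt_eqF.
  have h2 : Lp r phi `^ p <= (p / (p - 1) * c `^ (- p) * F `^ p) `^ t.
    rewrite -{1}rt powRrM ge0_ler_powR ?nnegrE ?powR_ge0 ?(ltW t0)//.
    by rewrite mulr_ge0 ?powR_ge0// mulr_ge0 ?powR_ge0// divr_ge0 ?ltW.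
  apply: (le_trans (ler_wpM2l (ltW m0) h2)).
  have c0 : 0 <= c by rewrite mulr_ge0 ?powR_ge0// divr_ge0 ?ltW.
  have pp0 : 0 <= p / (p - 1) by rewrite divr_ge0 ?ltW.
  have e20 : 0 <= eta / 2 by rewrite divr_ge0 ?ltW.
  have X1 : 0 <= c `^ (- p) by exact: powR_ge0.
  have X2 : 0 <= F `^ p by exact: powR_ge0.
  rewrite (powRM t (mulr_ge0 pp0 X1) X2) (powRM t pp0 X1) -!powRrM.
  have -> : c `^ (- p * t) = (eta / 2) `^ (- (p * t)) *
      ((1 - eta) / A) `^ (- (p * (p / n%:R))) * F `^ (p * (p / n%:R)).
    rewrite /c (powRM _ e20 (powR_ge0 _ _)) -powRrM mulNr -mulrA; congr (_ * _).
    have -> : p / (n%:R - p) * - (p * t) = - (p * (p / n%:R)).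
      by rewrite /t; field; rewrite !gt_eqF.
    rewrite (_ : (1 - eta) / (A * F) = (1 - eta) / A * F^-1); last by rewrite invfM mulrA.
    rewrite powRM; [|by rewrite divr_ge0 ?ltW|by rewrite invr_ge0 ltW].
    by congr (_ * _); rewrite powR_inv ?(ltW F0)// powRN invrK.
  have -> : (p / (p - 1)) `^ t = (((p - 1) / p) `^ t)^-1.
    by rewrite -[p / (p - 1)]invf_div powR_inv// divr_ge0 ?(ltW p0) ?(ltW p10).
  rewrite !(powRN _ (p * _)).
  have -> : F `^ p = F `^ (p * (p / n%:R)) * F `^ (p * t).
    rewrite -powR_posD//; congr (_ `^ _); rewrite /t; field; by rewrite gt_eqF.
  have u0 : ((p - 1) / p) `^ t != 0 by rewrite gt_eqF// powR_gt0// divr_gt0.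
  have v0 : (eta / 2) `^ (p * t) != 0 by rewrite gt_eqF// powR_gt0// divr_gt0.
  have w0 : ((1 - eta) / A) `^ (p * (p / n%:R)) != 0 by rewrite gt_eqF// powR_gt0// divr_gt0.
  rewrite le_eqVlt; apply/orP; left; apply/eqP; rewrite /m.
  move: u0 v0 w0 (F `^ _) (F `^ _).
  move: (((p - 1) / p) `^ t) ((eta / 2) `^ (p * t)) => u v.
  move: (((1 - eta) / A) `^ _) => w u0 v0 w0 x y.
  by field; rewrite u0 v0 w0.
have [E0|E0] := eqVneq (Lp p (fun x => euclid (grad phi x))) 0; last first.
  by apply: main => //; rewrite lt_def E0 Lp_ge0.
rewrite E0 powR0 ?gt_eqF//; apply/ler_addgt0Pr => e e0; rewrite add0r.
have -> : e = (e `^ p^-1) `^ p by rewrite -powRrM mulVf ?gt_eqF// powRr1// ltW.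
by apply: main; rewrite ?E0 ?powR_ge0 ?powR_gt0.
Qed.

Variables (x0 : 'rV[R]_n) (rad : R).
Hypotheses (rad0 : 0 < rad) (BO : [set x | euclid (x - x0) <= rad] `<=` Omega).

Lemma Lambda_supercritical_upper p d : n%:R < p -> d = (p - n%:R) / (p - 1) ->
  2 * d < 1 ->
  Lambda Omega p <= K * d `^ (p - 1) * rad `^ (n%:R - p) * (1 - 2 * d) `^ (- p).
Proof.
move=> np dE d2; have p1 : 1 < p by rewrite (lt_trans nR).
have p0 : 0 < p by rewrite (lt_trans _ p1).
have p10 : 0 < p - 1 by rewrite subr_gt0.
have d0 : 0 < d by rewrite dE divr_gt0// subr_gt0.
have [L0 hL _] := Lambda_supercritical n0 oO Ox D0 OD (ltW p1) (ltW np).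
have Rd0 : 0 < rad `^ d by rewrite powR_gt0.
(* [C] and [rho] are chosen so that C rad^d = 1/d and C rho^d = 1. The value at the centre is then
   at least 1/d - 1 - 1 = (1 - 2 d)/d: regularization and smoothing each cost 1 against 1/d, which
   is large as d tends to 0. *)
pose C := (d * rad `^ d)^-1; have C0 : 0 < C by rewrite invr_gt0 mulr_gt0.
pose rho := (d * rad `^ d) `^ d^-1; have rho0 : 0 < rho by rewrite powR_gt0// mulr_gt0.
have rhoE : rho `^ d = d * rad `^ d.
  by rewrite /rho -powRrM mulVf ?gt_eqF// powRr1// mulr_ge0 ?ltW.
have d_le2 : d <= 2 by lra.
have [phi [Tphi E hphi]] := bump_supercritical n0 rad0 BO np dE d_le2 C0 rho0.
rewrite energyE// lee_fin in E.
have g0 : 0 < (1 - 2 * d) / d by rewrite divr_gt0// subr_gt0.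
have gphi : (1 - 2 * d) / d <= `|phi x0|.
  apply: le_trans (ler_norm _); apply: le_trans hphi.
  rewrite rhoE le_eqVlt; apply/orP; left; apply/eqP; rewrite /C.
  by field; rewrite !gt_eqF.
have h : Lambda Omega p * ((1 - 2 * d) / d) `^ p <= (C * d) `^ p * K * rad `^ d / d.
  apply: le_trans E; apply: le_trans (hL phi x0 Tphi); rewrite ler_wpM2l//.
  by rewrite ge0_ler_powR ?nnegrE ?(ltW p0) ?(ltW g0).
rewrite -ler_pdivlMr ?powR_gt0// in h; apply: (le_trans h).
have -> : C * d = (rad `^ d)^-1 by rewrite /C; field; rewrite !gt_eqF.
have d12 : 0 < 1 - 2 * d by rewrite subr_gt0.
rewrite powRM ?invr_ge0 ?(ltW d0) ?(ltW d12)//.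
have -> : (rad `^ d)^-1 `^ p = rad `^ (n%:R - p) / rad `^ d.
  rewrite -powRN -powRrM -powR_posD//; congr (_ `^ _).
  by rewrite dE; field; rewrite gt_eqF.
rewrite powR_inv ?(ltW d0)// powRN.
have -> : d `^ p = d `^ (p - 1) * d by rewrite [RHS]mulrC mulr_powRB1 ?(ltW d0)//.
have q0 : (1 - 2 * d) `^ p != 0 by rewrite gt_eqF// powR_gt0.
have s0 : d `^ (p - 1) != 0 by rewrite gt_eqF// powR_gt0.
rewrite le_eqVlt; apply/orP; left; apply/eqP.
have arith (x y q s c k : R) : x != 0 -> q != 0 -> s != 0 -> c != 0 ->
    y / x * k * x / c / (q / (s * c)) = k * s * y / q.
  by move=> x1 q1 s1 c1; field; rewrite ?x1 ?q1 ?s1 ?c1.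
by apply: arith => //; rewrite gt_eqF.
Qed.

Lemma Lambda_subcritical_upper p a : 1 < p < n%:R -> a = (n%:R - p) / (p - 1) ->
  a < 2 `^ (- (a / 2)) ->
  Lambda Omega p <= K * a `^ (p - 1) * (1 + a / n%:R) *
    unit_vol n `^ (- ((n%:R - p) / n%:R)) * (2 `^ (- (a / 2)) - a) `^ (- p).
Proof.
move=> /[dup] ppn /andP[p1 pn] aE a2.
have p0 : 0 < p by rewrite (lt_trans _ p1).
have pn0 : 0 < n%:R - p by rewrite subr_gt0.
have p10 : 0 < p - 1 by rewrite subr_gt0.
have a0 : 0 < a by rewrite aE divr_gt0.
have [L0 hL _] := Lambda_subcritical n0 oO Ox D0 OD ppn.
set r := n%:R * p / (n%:R - p) in hL; have r0 : 0 < r by rewrite divr_gt0// mulr_gt0.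
set t := (n%:R - p) / n%:R.
(* [M] is the total loss, from truncation at radius [rad] and from smoothing. The choice of [rho]
   makes it exactly a times rho^(-a), hence relatively small as a tends to 0. *)
pose M := rad `^ (- a) + 1; have M0 : 0 < M by rewrite ltr_wpDl// powR_ge0.
pose rho := (a / M) `^ a^-1; have rho0 : 0 < rho by rewrite powR_gt0// divr_gt0.
pose T := rho `^ (- a); have T0 : 0 < T by rewrite powR_gt0.
have TE : M = a * T.
  rewrite /T /rho -powRrM (_ : a^-1 * - a = - 1); last by field; rewrite gt_eqF.
  by rewrite powR_inv1 ?divr_ge0 ?(ltW a0) ?(ltW M0)// invf_div mulrC divfK// gt_eqF.
clearbody rho.
have [phi [Tphi E hphi]] := bump_subcritical n0 rad0 BO ppn aE rho0.
rewrite energyE// lee_fin -/T in E.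
set b := 2 `^ (- (a / 2)) - a; have b0 : 0 < b by rewrite subr_gt0.
have low : T * b * (unit_vol n * rho ^+ n) `^ r^-1 <= Lp r phi.
  apply: (@Lp_lower _ _ n0 phi r (T * b) rho x0) => //.
  - exact: test_measurable Tphi.
  - exact: (test_integral_finite n0 D0 OD r0 Tphi).
  - by rewrite mulr_ge0 ?ltW.
  move=> y yr; apply: le_trans (ler_norm _); apply: le_trans (hphi y yr).
  by rewrite -/T -addrA -opprD -/M TE /b mulrBr mulrC [a * T]mulrC.
have v0 : 0 < unit_vol n * rho ^+ n by rewrite mulr_gt0// exprn_gt0.
have h : Lambda Omega p * (T * b * (unit_vol n * rho ^+ n) `^ r^-1) `^ p <=
    a `^ p * K * T * (a^-1 + n%:R^-1).
  apply: le_trans E; apply: le_trans (hL phi Tphi); rewrite ler_wpM2l//.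
  by rewrite ge0_ler_powR ?nnegrE ?(ltW p0) ?Lp_ge0// mulr_ge0 ?powR_ge0// mulr_ge0 ?ltW.
have Tb0 : 0 <= T * b by rewrite mulr_ge0 ?ltW.
rewrite powRM ?powR_ge0// -[X in _ * (_ * X)]powRrM in h.
have rp : r^-1 * p = t by rewrite /r /t; field; rewrite !gt_eqF.
rewrite rp powRM ?(ltW T0) ?(ltW b0)// in h.
rewrite (powRM t (ltW k0)) ?exprn_ge0 ?(ltW rho0)// in h.
(* Since n - p = a (p - 1), both sides of [h] carry one factor [T]: the quotient is scale invariant
   and [rho] drops out. *)
have Trho : T `^ p * (rho ^+ n) `^ t = T.
  rewrite /T -powR_mulrn ?(ltW rho0)// -!powRrM -powR_posD//; congr (_ `^ _).
  by rewrite /t aE; field; rewrite !gt_eqF.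
have h2 : Lambda Omega p * (b `^ p * unit_vol n `^ t) <= a `^ p * K * (a^-1 + n%:R^-1).
  rewrite -(ler_pM2r T0).
  have -> : a `^ p * K * (a^-1 + n%:R^-1) * T = a `^ p * K * T * (a^-1 + n%:R^-1).
    exact: mulrAC.
  apply: le_trans h; rewrite le_eqVlt; apply/orP; left; apply/eqP.
  rewrite -[X in _ * X = _]Trho; move: (T `^ p) (b `^ p) ((rho ^+ n) `^ t) => x y z.
  by move: (unit_vol n `^ t) (Lambda Omega p) => u v; ring.
rewrite -ler_pdivlMr in h2; last by rewrite mulr_gt0// powR_gt0.
apply: (le_trans h2); rewrite !powRN.
have -> : a `^ p = a `^ (p - 1) * a by rewrite [RHS]mulrC mulr_powRB1 ?(ltW a0)//.
have x1 : b `^ p != 0 by rewrite gt_eqF// powR_gt0.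
have x2 : unit_vol n `^ t != 0 :> R by rewrite gt_eqF// powR_gt0.
rewrite le_eqVlt; apply/orP; left; apply/eqP.
have arith (x y s u m c : R) : x != 0 -> y != 0 -> m != 0 -> c != 0 ->
  s * c * (m * u) * (c^-1 + m^-1) / (x * y) = m * u * s * (1 + c / m) * y^-1 * x^-1.
  by move=> x3 y3 m3 c3; field; rewrite ?x3 ?y3 ?m3 ?c3.
by apply: arith => //; rewrite gt_eqF.
Qed.

End Lambda_bounds.
Lemma powR_div (R : realType) (x y b : R) : 0 <= x -> 0 <= y ->
  (x / y) `^ b = x `^ b * y `^ (- b).
Proof. by move=> x0 y0; rewrite powRM ?invr_ge0// powR_inv// powRN. Qed.

(** * Asymptotics at the critical exponent *)

Section asymptotics.
Context {R : realType} {n : nat}.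
Hypothesis n1 : (1 < n)%N.
Variables (Omega : set 'rV[R]_n) (D : R).
Hypotheses (oO : open Omega) (Ox : Omega !=set0) (D0 : 0 < D).
Hypothesis OD : forall x, Omega x -> euclid x < D.
Variables (x0 : 'rV[R]_n) (rad : R).
Hypotheses (rad0 : 0 < rad) (BO : [set x | euclid (x - x0) <= rad] `<=` Omega).
Local Notation K := (n%:R * unit_vol n : R).
Local Notation ell := (K * (n%:R - 1) `^ (- (n%:R - 1))).

Let n0 : (0 < n)%N. Proof. exact: ltnW. Qed.
Let nR : (1 : R) < n%:R. Proof. by rewrite ltr1n. Qed.
Let nR0 : (0 : R) < n%:R. Proof. by rewrite ltr0n. Qed.
Let nR1 : (0 : R) < n%:R - 1. Proof. by rewrite subr_gt0. Qed.
Let k0 : 0 < unit_vol n :> R. Proof. exact: unit_vol_gt0. Qed.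
Let K0 : 0 < K. Proof. by rewrite mulr_gt0. Qed.

(** * Limits of the explicit bounds, along any filter tending to n *)

Section filter.
Variables (F : set_system R) (FF : Filter F).
Hypothesis P : p @[p --> F] --> (n%:R : R).

Let P1 : p - 1 @[p --> F] --> (n%:R - 1 : R).
Proof. by apply: cvgB => //; exact: cvg_cst. Qed.

Let P1V : (p - 1)^-1 @[p --> F] --> ((n%:R - 1)^-1 : R).
Proof. by apply: cvgV => //; rewrite gt_eqF. Qed.

Let PV : p^-1 @[p --> F] --> (n%:R^-1 : R).
Proof. by apply: cvgV => //; rewrite gt_eqF. Qed.

Let PN : - p @[p --> F] --> (- n%:R : R).
Proof. exact: cvgN. Qed.

Let H : n%:R - p @[p --> F] --> (0 : R).
Proof. by rewrite -[X in _ --> X](subrr (n%:R : R)); apply: cvgB => //; exact: cvg_cst. Qed.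

Let H' : p - n%:R @[p --> F] --> (0 : R).
Proof. by rewrite -[X in _ --> X](subrr (n%:R : R)); apply: cvgB => //; exact: cvg_cst. Qed.

Let Pn : p / n%:R @[p --> F] --> (1 : R).
Proof.
by have := cvgM P (cvg_cst (n%:R^-1 : R)); rewrite (mulfV (lt0r_neq0 nR0)); exact.
Qed.

Let Ht : (n%:R - p) / n%:R @[p --> F] --> (0 : R).
Proof. by rewrite -[X in _ --> X](mul0r (n%:R^-1 : R)); apply: cvgM => //; exact: cvg_cst. Qed.

Let Pp : (p - 1) `^ (- (p - 1)) @[p --> F] --> ((n%:R - 1) `^ (- (n%:R - 1)) : R).
Proof. by apply: cvg_powR2 => //; exact: cvgN. Qed.

Let A0 : (n%:R - p) / (p - 1) @[p --> F] --> (0 : R).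
Proof. by rewrite -[X in _ --> X](mul0r ((n%:R - 1)^-1 : R)); exact: cvgM. Qed.

Let d0 : (p - n%:R) / (p - 1) @[p --> F] --> (0 : R).
Proof. by rewrite -[X in _ --> X](mul0r ((n%:R - 1)^-1 : R)); exact: cvgM. Qed.

Let d20 : 2 * ((p - n%:R) / (p - 1)) @[p --> F] --> (0 : R).
Proof. by rewrite -[X in _ --> X](mulr0 (2 : R)); apply: cvgM => //; exact: cvg_cst. Qed.

Let a2 : 2 `^ (- ((n%:R - p) / (p - 1) / 2)) - (n%:R - p) / (p - 1) @[p --> F] --> (1 : R).
Proof.
have e0 : - ((n%:R - p) / (p - 1) / 2) @[p --> F] --> (0 : R).
  rewrite -[X in _ --> X]oppr0; apply: cvgN; rewrite -[X in _ --> X](mul0r (2^-1 : R)).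
  by apply: cvgM => //; exact: cvg_cst.
have := cvgB (cvg_powR_exp (ltr0Sn R 1) e0) A0.
by rewrite powRr0 subr0; exact.
Qed.

Lemma cvg_supercritical_upper :
  K * (p - 1) `^ (- (p - 1)) * rad `^ (n%:R - p) *
    (1 - 2 * ((p - n%:R) / (p - 1))) `^ (- p) @[p --> F] --> ell.
Proof.
have -> : ell = ell * 1 * 1 by rewrite !mulr1.
apply: cvgM.
  apply: cvgM; last by rewrite -[X in _ --> X](powRr0 rad); exact: cvg_powR_exp.
  by apply: cvgM => //; exact: cvg_cst.
rewrite [X in _ --> X](_ : 1 = (1 : R) `^ (- n%:R)); last by rewrite powR1.
apply: cvg_powR2 => //.
by rewrite -[X in _ --> X]subr0; apply: cvgB => //; exact: cvg_cst.
Qed.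

Lemma cvg_supercritical_lower :
  K * (p - 1) `^ (- (p - 1)) * (2 * D) `^ (n%:R - p) @[p --> F] --> ell.
Proof.
have -> : ell = ell * 1 by rewrite mulr1.
apply: cvgM.
  by apply: cvgM => //; exact: cvg_cst.
by rewrite -[X in _ --> X](powRr0 (2 * D)); apply: cvg_powR_exp => //; rewrite mulr_gt0.
Qed.

Lemma cvg_subcritical_upper :
  K * (p - 1) `^ (- (p - 1)) * (1 + (n%:R - p) / (p - 1) / n%:R) *
    unit_vol n `^ (- ((n%:R - p) / n%:R)) *
    (2 `^ (- ((n%:R - p) / (p - 1) / 2)) - (n%:R - p) / (p - 1)) `^ (- p)
    @[p --> F] --> ell.
Proof.
have -> : ell = ell * 1 * 1 * 1 by rewrite !mulr1.
apply: cvgM; last first.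
  rewrite [X in _ --> X](_ : 1 = (1 : R) `^ (- n%:R)); last by rewrite powR1.
  exact: cvg_powR2.
apply: cvgM.
  apply: cvgM; first by apply: cvgM => //; exact: cvg_cst.
  rewrite -[X in _ --> X]addr0; apply: cvgD; first exact: cvg_cst.
  by rewrite -[X in _ --> X](mul0r (n%:R^-1 : R)); apply: cvgM => //; exact: cvg_cst.
rewrite -[X in _ --> X](powRr0 (unit_vol n : R)); apply: cvg_powR_exp => //.
by rewrite -[X in _ --> X]oppr0; exact: cvgN.
Qed.

(** The bound of [Lambda_subcritical_lower] for eta = n - p, divided by (n-p)^(p-1). The division
    leaves n - p with exponent (p-1) p/n - (p-1) = - ((p-1)/n) (n-p), so every power with vanishing
    base has as exponent a bounded multiple of its base, and [cvg_powR_self] applies. *)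
Lemma cvg_subcritical_lower : (\forall p \near F, p < n%:R) ->
  ((p - 1) / p) `^ ((n%:R - p) / n%:R) *
  ((n%:R - p) / 2) `^ (2 * (p / n%:R) * ((n%:R - p) / 2)) *
  ((1 - (n%:R - p)) `^ (p * (p / n%:R)) * K `^ (p / n%:R) *
   (p - 1) `^ (- ((p - 1) * (p / n%:R))) * (n%:R - p) `^ (- ((p - 1) / n%:R) * (n%:R - p)))
  @[p --> F] --> ell.
Proof.
move=> pn; have -> : ell = ((n%:R - 1) / n%:R) `^ 0 * 1 *
    (1 `^ (n%:R * 1) * K `^ 1 * (n%:R - 1) `^ (- ((n%:R - 1) * 1)) * 1).
  by rewrite powRr0 powR1 !mulr1 !mul1r powRr1// ltW.
have pos : \forall p \near F, 0 < n%:R - p by apply: filterS pn => p; rewrite subr_gt0.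
apply: cvgM; first apply: cvgM.
- by apply: cvg_powR2 => //; [rewrite divr_gt0|exact: cvgM].
- apply: (@cvg_powR_self _ _ _ _ (fun p => (n%:R - p) / 2) (fun p => 2 * (p / n%:R)) (2 * 1)).
  + by apply: filterS pos => p pp; rewrite divr_gt0.
  + by rewrite -[X in _ --> X](mul0r (2^-1 : R)); apply: cvgM => //; exact: cvg_cst.
  + by apply: cvgM => //; exact: cvg_cst.
apply: cvgM; last first.
  apply: (@cvg_powR_self _ _ _ _ (fun p => n%:R - p) (fun p => - ((p - 1) / n%:R))
    (- ((n%:R - 1) / n%:R))) => //.
  by apply: cvgN; apply: cvgM => //; exact: cvg_cst.
apply: cvgM; last by apply: cvg_powR2 => //; apply: cvgN; exact: cvgM.
apply: cvgM; last exact: cvg_powR_exp.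
apply: cvg_powR2 => //; last exact: cvgM.
by rewrite -[X in _ --> X]subr0; apply: cvgB => //; exact: cvg_cst.
Qed.

Lemma near_supercritical : \forall p \near F, 2 * ((p - n%:R) / (p - 1)) < 1.
Proof. exact: (cvgr_lt _ d20 _ ltr01). Qed.

Lemma near_subcritical : \forall p \near F, [/\ 1 < p, n%:R - p < 1 &
  (n%:R - p) / (p - 1) < 2 `^ (- ((n%:R - p) / (p - 1) / 2))].
Proof.
have h1 := @cvgr_gt _ _ _ FF _ _ P _ nR; have h2 := @cvgr_lt _ _ _ FF _ _ H _ ltr01.
have h3 := @cvgr_gt _ _ _ FF _ _ a2 _ ltr01.
apply: filterS (filterI h1 (filterI h2 h3)) => p [p1 [p2 p3]].
by split => //; rewrite -subr_gt0.
Qed.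

(** As n >= 2, p - 1 exceeds 1/2 near n, and the power is then at most the square root of |p -
    n|. *)
Lemma cvg_distance_powR : `|p - n%:R| `^ (p - 1) @[p --> F] --> (0 : R).
Proof.
have c : Num.sqrt `|p - n%:R| @[p --> F] --> (0 : R).
  rewrite -[X in _ --> X](@sqrtr0 R) -[X in Num.sqrt X](@normr0 _ R).
  apply: (@cvg_comp _ _ _ (fun p : R => `|p - n%:R|) Num.sqrt); last exact: sqrt_continuous.
  exact: (cvg_norm H').
apply: (squeeze_cvgr _ (cvg_cst 0) c).
have h1 : \forall p \near F, 2^-1 < p - 1.
  apply: (cvgr_gt _ P1); rewrite ltrBrDl (@lt_le_trans _ _ 2)//; last by rewrite ler_nat.
  lra.
have h2 : \forall p \near F, `|p - n%:R| < 1.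
  by apply: (cvgr_lt _ (cvg_norm H')); rewrite normr0.
apply: filterS (filterI h1 h2) => p [p1 p2].
rewrite powR_ge0/= -powR12_sqrt//; have [->|z] := eqVneq `|p - n%:R| 0.
  by rewrite !powR0// ?invr_neq0// gt_eqF// (lt_trans _ p1)// invr_gt0.
apply: ger_powR; last exact: ltW.
by rewrite lt_def z normr_ge0 ltW.
Qed.

End filter.

Lemma cvg_Lambda_left :
  Lambda Omega p / `|p - n%:R| `^ (p - 1) @[p --> n%:R^'-] --> ell.
Proof.
have P : p @[p --> (n%:R : R)^'-] --> (n%:R : R).
  by apply: cvg_at_left_filter; exact: cvg_id.
have pn : \forall p \near (n%:R : R)^'-, p < n%:R by exact: nbhs_left_lt.
apply: (squeeze_cvgr _ (cvg_subcritical_lower _ P pn) (cvg_subcritical_upper _ P)).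
apply: filterS (filterI pn (near_subcritical _ P)) => p [{}pn [p1 eta1 pa]].
have p0 : 0 < p by rewrite (lt_trans _ p1).
have e0 : 0 < n%:R - p by rewrite subr_gt0.
have p10 : 0 < p - 1 by rewrite subr_gt0.
have ppn : 1 < p < n%:R by rewrite p1.
have -> : `|p - n%:R| = n%:R - p by rewrite distrC gtr0_norm.
have q0 : 0 < (n%:R - p) `^ (p - 1) by rewrite powR_gt0.
apply/andP; split; last first.
  rewrite ler_pdivrMr//.
  apply: le_trans (Lambda_subcritical_upper n1 oO Ox D0 OD rad0 BO ppn erefl pa) _.
  rewrite powR_div ?(ltW e0) ?(ltW p10)// le_eqVlt; apply/orP; left; apply/eqP.
  have arith (x y z a b c : R) : x * (y * z) * a * b * c = x * z * a * b * c * y.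
    by ring.
  exact: arith.
rewrite ler_pdivlMr//.
apply: le_trans (Lambda_subcritical_lower n1 oO Ox D0 OD ppn (_ : 0 < n%:R - p < 1)); last first.
  by rewrite e0.
have u0 : 0 < 1 - (n%:R - p) by rewrite subr_gt0.
have fE : (1 - (n%:R - p)) / far_norm n p = (1 - (n%:R - p)) * (K `^ p^-1 *
    ((n%:R - p) `^ ((p - 1) / p) * (p - 1) `^ (- ((p - 1) / p)))).
  congr (_ * _); rewrite /far_norm invfM -powRN opprK; congr (_ * _).
  by rewrite -powR_inv ?divr_ge0 ?ltW// invf_div powR_div ?ltW.
have X2 : 0 <= (n%:R - p) `^ ((p - 1) / p) * (p - 1) `^ (- ((p - 1) / p)).
  by rewrite mulr_ge0 ?powR_ge0.
have X1 := mulr_ge0 (powR_ge0 K p^-1) X2.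
rewrite fE (powRM _ (ltW u0) X1) (powRM _ (powR_ge0 _ _) X2).
rewrite (powRM _ (powR_ge0 _ _) (powR_ge0 _ _)) -!powRrM.
have -> : p^-1 * (p * (p / n%:R)) = p / n%:R by field; rewrite !gt_eqF.
have -> : - ((p - 1) / p) * (p * (p / n%:R)) = - ((p - 1) * (p / n%:R)).
  by field; rewrite !gt_eqF.
have -> : (p - 1) / p * (p * (p / n%:R)) = - ((p - 1) / n%:R) * (n%:R - p) + (p - 1).
  by field; rewrite !gt_eqF.
have -> : 2 * (p / n%:R) * ((n%:R - p) / 2) = p * ((n%:R - p) / n%:R).
  by field; rewrite gt_eqF.
rewrite (powR_posD (- ((p - 1) / n%:R) * (n%:R - p)) (p - 1) e0) le_eqVlt; apply/orP; left; apply/eqP.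
have arith (a b c k z x y : R) :
    a * b * (c * k * z * x) * y = a * b * (c * (k * (x * y * z))) by ring.
exact: arith.
Qed.

Lemma cvg_Lambda_right :
  Lambda Omega p / `|p - n%:R| `^ (p - 1) @[p --> n%:R^'+] --> ell.
Proof.
have P : p @[p --> (n%:R : R)^'+] --> (n%:R : R).
  by apply: cvg_at_right_filter; exact: cvg_id.
have pn : \forall p \near (n%:R : R)^'+, n%:R < p by exact: nbhs_right_gt.
apply: (squeeze_cvgr _ (cvg_supercritical_lower _ P) (cvg_supercritical_upper _ P)).
apply: filterS (filterI pn (near_supercritical _ P)) => p [{}pn d2].
have p1 : 1 < p by rewrite (lt_trans nR).
have e0 : 0 < p - n%:R by rewrite subr_gt0.
have p10 : 0 < p - 1 by rewrite subr_gt0.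
have -> : `|p - n%:R| = p - n%:R by rewrite gtr0_norm.
have q0 : 0 < (p - n%:R) `^ (p - 1) by rewrite powR_gt0.
apply/andP; split; last first.
  rewrite ler_pdivrMr//.
  apply: le_trans (Lambda_supercritical_upper n1 oO Ox D0 OD rad0 BO pn erefl d2) _.
  rewrite powR_div ?(ltW e0) ?(ltW p10)// le_eqVlt; apply/orP; left; apply/eqP.
  have arith (k x y z w : R) : k * (x * y) * z * w = k * y * z * w * x by ring.
  exact: arith.
rewrite ler_pdivlMr//.
apply: le_trans (Lambda_supercritical_lower n1 oO Ox D0 OD pn).
rewrite powR_div ?(ltW e0) ?(ltW p10)// le_eqVlt; apply/orP; left; apply/eqP.
have arith (k x y z : R) : k * y * z * x = k * (x * y) * z by ring.
exact: arith.
Qed.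

Lemma cvg_Lambda0 (F : set_system R) (FF : Filter F) : p @[p --> F] --> (n%:R : R) ->
  (\forall p \near F, p != n%:R) ->
  Lambda Omega p / `|p - n%:R| `^ (p - 1) @[p --> F] --> ell ->
  Lambda Omega p @[p --> F] --> (0 : R).
Proof.
move=> P pn c; have := @cvgM _ _ _ FF _ _ _ _ c (cvg_distance_powR FF P); rewrite mulr0 => {}c.
apply: cvg_trans c; apply: near_eq_cvg; apply: filterS pn => p pn.
by rewrite /= divfK// gt_eqF// powR_gt0// normr_gt0 subr_eq0.
Qed.

(** If l = [Lambda Omega n%:R] were positive, the inequality that it expresses at exponent n would,
    by Hoelder, give [Lambda Omega p] >= m p for p > n, with m p tending to l while [Lambda Omega p]
    tends to 0. *)
Lemma Lambda_critical0 : Lambda Omega n%:R = 0.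
Proof.
have P : p @[p --> (n%:R : R)^'+] --> (n%:R : R).
  by apply: cvg_at_right_filter; exact: cvg_id.
have pn : \forall p \near (n%:R : R)^'+, n%:R < p by exact: nbhs_right_gt.
have L0 : Lambda Omega p @[p --> (n%:R : R)^'+] --> (0 : R).
  apply: cvg_Lambda0 => //; last exact: cvg_Lambda_right.
  by apply: filterS pn => p np; rewrite gt_eqF.
have [ln0 hl _] := Lambda_supercritical n0 oO Ox D0 OD (ltW nR) (lexx (n%:R : R)).
apply/eqP; rewrite eq_le ln0 andbT leNgt; apply/negP => lpos.
set l := Lambda Omega n%:R in ln0 hl lpos.
pose V : R := unit_vol n * D ^+ n.
have V0 : 0 < V by rewrite mulr_gt0// exprn_gt0.
(* The constant produced by [Lp_monotone] applied to the gradient between the exponents n and p. *)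
pose m p := (l `^ n%:R^-1 * V `^ (p^-1 - n%:R^-1)) `^ p.
have cm : m p @[p --> (n%:R : R)^'+] --> l.
  have E : l = (l `^ n%:R^-1 * V `^ 0) `^ n%:R.
    by rewrite powRr0 mulr1 -powRrM mulVf ?gt_eqF// powRr1.
  rewrite [X in _ --> X]E; apply: cvg_powR2 => //.
    by rewrite mulr_gt0// powR_gt0.
  apply: cvgM; first exact: cvg_cst.
  apply: cvg_powR_exp => //; rewrite -[X in _ --> X](subrr (n%:R^-1 : R)).
  by apply: cvgB; [apply: cvgV => //; rewrite gt_eqF|exact: cvg_cst].
have : l <= 0.
  apply: (ler_cvg_to cm L0); apply: filterS pn => p np.
  have p1 : 1 < p by rewrite (lt_trans nR).
  have p0 : 0 < p by rewrite (lt_trans _ p1).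
  have [_ _] := Lambda_supercritical n0 oO Ox D0 OD (ltW p1) (ltW np); apply.
    exact: powR_ge0.
  move=> phi x Tphi; rewrite /m -powRM ?mulr_ge0 ?powR_ge0//.
  have G0 : forall y, D <= euclid y -> euclid (grad phi y) = 0.
    by move=> y Dy; rewrite (test_grad_off Tphi (outside_domain OD Dy)) euclid0.
  have mono := Lp_monotone n0 D0 (test_grad_measurable Tphi) G0 nR0 np
    (test_grad_integral_finite n0 D0 OD p0 Tphi).
  have h : l `^ n%:R^-1 * `|phi x| <= Lp n%:R (fun y => euclid (grad phi y)).
    apply: (powR_le_inv nR0); rewrite ?mulr_ge0 ?powR_ge0 ?Lp_ge0//.
    rewrite powRM ?powR_ge0// -powRrM mulVf ?gt_eqF// powRr1//.
    exact: hl.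
  rewrite ge0_ler_powR ?nnegrE ?(ltW p0) ?mulr_ge0 ?powR_ge0 ?Lp_ge0//.
  rewrite mulrAC; apply: le_trans (ler_wpM2r (powR_ge0 _ _) (le_trans h mono)) _.
  rewrite mulrAC -powR_posD// -opprB addNr powRr0 mul1r//.
by rewrite leNgt lpos.
Qed.

End asymptotics.

Theorem corollary2p10 (R : realType) (N : nat) (Omega : set 'rV[R]_N)
  (hN : (2 <= N)%N) (hOmega : bounded_smooth_domain Omega) :
  [/\ Lambda Omega p / `|p - N%:R| `^ (p - 1) @[p --> N%:R^'-] -->
        N%:R * omega R N / (N%:R - 1) ^+ (N - 1),
      Lambda Omega p / `|p - N%:R| `^ (p - 1) @[p --> N%:R^'+] -->
        N%:R * omega R N / (N%:R - 1) ^+ (N - 1) &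
      {for N%:R, continuous (Lambda Omega)}].
Proof.
have [oO _ Ox bO _] := hOmega.
have n0 : (0 < N)%N by exact: ltnW.
have [D [D0 OD]] := bounded_set_euclid bO.
have [x0 [rad [rad0 BO]]] := open_contains_ball oO Ox.
have nR1 : 0 <= N%:R - 1 :> R by rewrite subr_ge0 ler1n.
have cl := cvg_Lambda_left hN oO Ox D0 OD rad0 BO.
have cr := cvg_Lambda_right hN oO Ox D0 OD rad0 BO.
have limE : N%:R * omega R N / (N%:R - 1) ^+ (N - 1) =
    N%:R * unit_vol N * (N%:R - 1) `^ (- (N%:R - 1)) :> R.
  rewrite unit_volE// powRN; congr (_ / _).
  by rewrite -powR_mulrn// natrB.
split; [by rewrite limE|by rewrite limE|].
apply/left_right_continuousP; rewrite (Lambda_critical0 hN oO Ox D0 OD rad0 BO); split.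
- apply: (cvg_Lambda0 hN _ _ _ cl).
  + by apply: cvg_at_left_filter; exact: cvg_id.
  + have h : \forall p \near (N%:R : R)^'-, p < N%:R by exact: nbhs_left_lt.
    by apply: filterS h => p pN; rewrite lt_eqF.
- apply: (cvg_Lambda0 hN _ _ _ cr).
  + by apply: cvg_at_right_filter; exact: cvg_id.
  + have h : \forall p \near (N%:R : R)^'+, N%:R < p by exact: nbhs_right_gt.
    by apply: filterS h => p pN; rewrite gt_eqF.
Qed.
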